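(* Let $K\subset\mathbb{R}^n$, $n\ge2$, be compact and let $A\subset K$ be such that both $A$ and $\mathrm{int}_fK\setminus A$ are finely open (i.e. $A$ is a union of fine connected components of $\mathrm{int}_fK$). Suppose that $\operatorname{supp}\mu\subset\overline{A}$ for all $\mu\in\mathcal{J}_x(K)$ and all $x\in A$. Then $\mathcal{J}_x(K)\subset\mathcal{J}_x(\overline{A})$ (and hence $\mathcal{J}_x(K)=\mathcal{J}_x(\overline{A})$) for all $x\in A$.
   Context: For a domain $U\subset\mathbb{R}^n$ and $x\in U$, $\mathcal{J}_x(U)$ is the set of positive Radon measures $\mu$ with support compactly contained in $U$ such that $\int f\,d\mu\le f(x)$ for every superharmonic $f$ on $U$; for compact $E$ and $x\in E$, $\mathcal{J}_x(E)=\bigcap_U\mathcal{J}_x(U)$ over all domains $U\supset E$. The fine topology is the coarsest topology on $\mathbb{R}^n$ making all superharmonic functions continuous; $\mathrm{int}_fK$ is the fine interior; $\overline{A}$ is the Euclidean closure. *)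

(* Defs.v *)
From HB Require Import structures.
From mathcomp Require Import all_boot all_order all_algebra.
From mathcomp Require Import all_classical all_reals all_analysis.
Set Implicit Arguments. Unset Strict Implicit. Unset Printing Implicit Defensive.
Import Order.TTheory GRing.Theory Num.Theory.
Import numFieldNormedType.Exports.
Local Open Scope classical_set_scope.
Local Open Scope ring_scope.

Section Potential.
Variables (R : realType) (n : nat).

(* Points of R^n are row vectors; the matrix topology is the Euclidean one. *)
Notation V := 'rV[R]_n.

Definition enorm (x : V) : R := Num.sqrt (\sum_(i < n) x ord0 i ^+ 2).
Definition eball (c : V) (r : R) : set V := [set y | enorm (y - c) < r].
Definition cball (c : V) (r : R) : set V := [set y | enorm (y - c) <= r].
Definition esphere (c : V) (r : R) : set V := [set y | enorm (y - c) = r].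

Definition evec (i : 'I_n) : V := delta_mx ord0 i.
Definition partial (i : 'I_n) (h : V -> R) : V -> R := fun x => derive h x (evec i).

Definition harmonic_on (W : set V) (h : V -> R) : Prop :=
  forall x, W x ->
    (forall i : 'I_n,
       derivable h x (evec i) /\ {for x, continuous (partial i h)} /\
       forall j : 'I_n, derivable (partial i h) x (evec j) /\
                        {for x, continuous (partial j (partial i h))}) /\
    \sum_(i < n) partial i (partial i h) x = 0.

Definition superharmonic_on (U : set V) (f : V -> \bar R) : Prop :=
  open U /\
  (forall x, U x -> (-oo < f x)%E) /\
  (forall x, U x -> forall a : R, (a%:E < f x)%E ->
      \forall y \near x, (a%:E < f y)%E) /\
  (forall x, U x -> exists y, connected_component U x y /\ (f y < +oo)%E) /\
  (forall (c : V) (r : R), 0 < r -> cball c r `<=` U ->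
     forall h : V -> R, {within cball c r, continuous h} ->
       harmonic_on (eball c r) h ->
       (forall y, esphere c r y -> ((h y)%:E <= f y)%E) ->
       forall y, eball c r y -> ((h y)%:E <= f y)%E).

Definition domain (U : set V) : Prop := open U /\ connected U /\ U !=set0.

(* Fine topology: the topology generated by the subbasis making every
   superharmonic function (on every open set) continuous into \bar R. *)
Definition fine_subbasic (S : set V) : Prop :=
  exists (U : set V) (f : V -> \bar R) (a : R), superharmonic_on U f /\
    (S = [set y | U y /\ (a%:E < f y)%E] \/ S = [set y | U y /\ (f y < a%:E)%E]).

Definition fine_open (A : set V) : Prop :=
  forall x, A x -> exists (k : nat) (S : nat -> set V),
    (forall i, (i < k)%N -> fine_subbasic (S i) /\ S i x) /\
    (forall y, (forall i, (i < k)%N -> S i y) -> A y).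

Definition fine_interior (K : set V) : set V :=
  [set x | exists W, fine_open W /\ W x /\ W `<=` K].

Definition BV := g_sigma_algebraType (@open V).

Definition radon (mu : {measure set BV -> \bar R}) : Prop :=
  forall C : set V, compact C -> (mu C < +oo)%E.

Definition supp (mu : {measure set BV -> \bar R}) : set V :=
  [set x | forall N : set V, open N -> N x -> (0 < mu N)%E].

Definition jensen_dom (U : set V) (x : V) (mu : {measure set BV -> \bar R}) : Prop :=
  radon mu /\ compact (supp mu) /\ supp mu `<=` U /\
  forall f : V -> \bar R, superharmonic_on U f ->
    (\int[mu]_(y in (U : set BV)) f y <= f x)%E.

Definition jensen_cpt (E : set V) (x : V) (mu : {measure set BV -> \bar R}) : Prop :=
  forall U : set V, domain U -> E `<=` U -> jensen_dom U x mu.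

End Potential.

(* Main.v *)
Require Import Defs.
From HB Require Import structures.
From mathcomp Require Import finmap all_boot all_order all_algebra.
From mathcomp Require Import all_classical all_reals all_analysis.
From mathcomp Require Import measurable_realfun ring lra zify.
Set Implicit Arguments. Unset Strict Implicit. Unset Printing Implicit Defensive.
Import Order.TTheory GRing.Theory Num.Theory.
Import numFieldNormedType.Exports.
Local Open Scope classical_set_scope.
Local Open Scope ring_scope.

(** Write [E] for the closure of [A]. By the Hahn-Banach and Riesz theorems,
    the hypothesis on supports says that at every point of [A] the reduced function
    over [K] of a bump living off [E] vanishes:
    there are superharmonic functions [s] near [K], dominating the bump on [K],
    whose value at the point is as small as we please. Given [f] superharmonic near
    [E] and [kappa > 0], let [T] be the infimum of the superharmonic functions near
    [K] which dominate [f - kappa |.|^2] on [E]. Sums of the functions [s] are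
    barriers which allow one to paste [f], corrected by an affine function and
    restricted to a small ball, into the competitors for [T]; hence
    [T <= f - kappa |.|^2] wherever the reduced function vanishes. Integrating a
    competitor against a Jensen measure of [K] and letting [kappa] tend to [0] gives
    the Jensen inequality for [f].

    Only continuous superharmonic functions are used: the general ones are
    increasing limits of those. Jensen measures of [K] are tested on domains,
    whereas the pasted functions live on disconnected neighbourhoods of [K]; as
    [n >= 2], the latter extend superharmonically along a fine grid. *)

(** * The Euclidean norm *)

(** Two obstacles shape the proof. The hypothesis controls the points of [A] only: nothing is known
    about the reduced function at the other points of [E], although the small sphere along which
    functions are pasted may meet them. Hence the domination runs over the whole set where the
    reduced function vanishes. There the supremum of [T - (f - kappa |.|^2)] bounds [T] from above,
    and on the rest of the sphere the barriers take over. The quadratic term turns near-maximality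
    into a strict gap: up to an affine function it can be recentred at any point, where it vanishes,
    while it equals [kappa r^2] on the sphere of radius [r].

    Moreover [T], being an infimum, need not be continuous. So it is never pasted itself:
    compactness selects finitely many competitors, and their minimum is again one.

    Superharmonicity is defined by comparison with harmonic functions, and this says nothing direct
    about sums. Adding two superharmonic functions means splitting boundary values, hence solving a
    Dirichlet problem on balls up to a small error; polynomial data suffice, and these are solved
    algebraically. *)

Section Euclidean.
Variables (R : realType) (n : nat).
Local Notation V := 'rV[R]_n.
Implicit Types (x y z c : V) (r : R).

Definition dot x y : R := \sum_(i < n) x ord0 i * y ord0 i.

Lemma dotC x y : dot x y = dot y x.
Proof. by apply: eq_bigr => i _; rewrite mulrC. Qed.

Lemma dotDl x y z : dot (x + y) z = dot x z + dot y z.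
Proof. by rewrite -big_split; apply: eq_bigr => i _; rewrite mxE mulrDl. Qed.

Lemma dotDr x y z : dot z (x + y) = dot z x + dot z y.
Proof. by rewrite dotC dotDl !(dotC z). Qed.

Lemma dotZl a x y : dot (a *: x) y = a * dot x y.
Proof. by rewrite mulr_sumr; apply: eq_bigr => i _; rewrite mxE mulrA. Qed.

Lemma dotZr a x y : dot x (a *: y) = a * dot x y.
Proof. by rewrite dotC dotZl dotC. Qed.

Lemma dotNl x y : dot (- x) y = - dot x y.
Proof. by rewrite -scaleN1r dotZl mulN1r. Qed.

Lemma dotNr x y : dot x (- y) = - dot x y.
Proof. by rewrite dotC dotNl dotC. Qed.

Lemma dot_ge0 x : 0 <= dot x x.
Proof. by apply: sumr_ge0 => i _; rewrite -expr2 sqr_ge0. Qed.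

Lemma enormE x : enorm x = Num.sqrt (dot x x).
Proof. by []. Qed.

Lemma enorm_ge0 x : 0 <= enorm x. Proof. exact: sqrtr_ge0. Qed.

Lemma sqr_enorm x : enorm x ^+ 2 = dot x x.
Proof. by rewrite enormE sqr_sqrtr ?dot_ge0. Qed.

Lemma enorm0 : enorm (0 : V) = 0.
Proof. by rewrite enormE -[X in dot X](scale0r (0 : V)) dotZl mul0r sqrtr0. Qed.

Lemma enormN x : enorm (- x) = enorm x.
Proof. by rewrite !enormE dotNl dotNr opprK. Qed.

Lemma enormC x y : enorm (x - y) = enorm (y - x).
Proof. by rewrite -enormN opprB. Qed.

Lemma enormZ a x : enorm (a *: x) = `|a| * enorm x.
Proof. by rewrite !enormE dotZl dotZr mulrA -expr2 sqrtrM ?sqr_ge0// sqrtr_sqr. Qed.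

Lemma coord_le_enorm x i : `|x ord0 i| <= enorm x.
Proof.
rewrite -sqrtr_sqr ler_sqrt ?dot_ge0// (bigD1 i)//= lerDl.
by apply: sumr_ge0 => j _; rewrite sqr_ge0.
Qed.

Lemma enorm_eq0 x : (enorm x == 0) = (x == 0).
Proof.
apply/eqP/eqP => [x0|->]; last exact: enorm0.
apply/rowP => i; rewrite mxE; apply/eqP; rewrite -normr_le0 -x0.
exact: coord_le_enorm.
Qed.

Lemma dot_le_enorm x y : dot x y <= enorm x * enorm y.
Proof.
have [/eqP|x0] := eqVneq (enorm x) 0.
  rewrite enorm_eq0 => /eqP ->.
  by rewrite enorm0 mul0r -(scale0r (0 : V)) dotZl mul0r.
have [/eqP|y0] := eqVneq (enorm y) 0.
  rewrite enorm_eq0 => /eqP ->.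
  by rewrite enorm0 mulr0 -(scale0r (0 : V)) dotZr mul0r.
have xy : 0 < enorm x * enorm y by rewrite mulr_gt0 // lt_def ?x0 ?y0 enorm_ge0.
have := dot_ge0 (enorm y *: x - enorm x *: y).
rewrite !(dotDl, dotDr, dotNl, dotNr, dotZl, dotZr) -!sqr_enorm (dotC y x) => H.
by rewrite -subr_ge0 -(pmulr_rge0 _ xy); move: H; nra.
Qed.

Lemma sqr_enormD x y :
  enorm (x + y) ^+ 2 = enorm x ^+ 2 + 2 * dot x y + enorm y ^+ 2.
Proof. by rewrite !sqr_enorm !(dotDl, dotDr) (dotC y x); ring. Qed.

Lemma enormD x y : enorm (x + y) <= enorm x + enorm y.
Proof.
rewrite -(@ler_pXn2r _ 2)// ?nnegrE ?addr_ge0 ?enorm_ge0//.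
rewrite sqr_enormD sqrrD.
have := dot_le_enorm x y; lra.
Qed.

Lemma enorm_sub x y z : enorm (x - z) <= enorm (x - y) + enorm (y - z).
Proof. by apply: le_trans (enormD _ _); rewrite addrA subrK. Qed.

Lemma enormB x y : enorm x - enorm y <= enorm (x - y).
Proof. by rewrite lerBlDr; apply: le_trans (enormD _ _); rewrite subrK. Qed.

Lemma norm_le_enorm x : `|x| <= enorm x.
Proof.
rewrite /Num.norm/= mx_normrE; apply/bigmax_leP; split; first exact: enorm_ge0.
by move=> [i j] _ /=; rewrite (ord1 i); exact: coord_le_enorm.
Qed.

Lemma coord_le_norm x i : `|x ord0 i| <= `|x|.
Proof.
rewrite /Num.norm/= mx_normrE.
by apply/bigmax_geP; right; exists (ord0, i).
Qed.

(** The crude factor [n.+1] in place of the square root of [n] is positive for every [n], so that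
    radii can be divided by it. *)
Lemma enorm_le_norm x : enorm x <= n.+1%:R * `|x|.
Proof.
rewrite -(@ler_pXn2r _ 2)// ?nnegrE ?mulr_ge0 ?enorm_ge0//.
rewrite sqr_enorm exprMn.
apply: (@le_trans _ _ (\sum_(i < n) `|x| ^+ 2)).
  by apply: ler_sum => i _; rewrite -expr2 -real_normK ?num_real// lerXn2r ?nnegrE// coord_le_norm.
rewrite sumr_const card_ord -[leLHS]mulr_natl; apply: ler_wpM2r; first exact: sqr_ge0.
by rewrite -natrX ler_nat (leq_trans (leqnSn n))// -[leqLHS]expn1 leq_pexp2l.
Qed.

Lemma nbhs_eballP x (P : set V) :
  nbhs x P <-> exists2 r, 0 < r & eball x r `<=` P.
Proof.
split=> [/nbhs_ballP[r /= r0 xP]|[r r0 xP]].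
  exists r => // y xy; apply: xP; rewrite -ball_normE /= distrC.
  by apply: le_lt_trans xy; exact: norm_le_enorm.
apply/nbhs_ballP; exists (r / n.+1%:R) => /=; first by rewrite divr_gt0.
move=> y; rewrite -ball_normE /= => xy; apply: xP; rewrite /eball /=.
apply: le_lt_trans (enorm_le_norm _) _.
by rewrite mulrC -ltr_pdivlMr// distrC.
Qed.

Lemma open_eballP (U : set V) :
  open U <-> forall x, U x -> exists2 r, 0 < r & eball x r `<=` U.
Proof.
rewrite openE; split=> [oU x /oU /nbhs_eballP //|H x /H ?].
exact/nbhs_eballP.
Qed.

Lemma continuous_atP (f : V -> R) x :
  {for x, continuous f} <->
  forall e : R, 0 < e -> exists2 d : R, 0 < d &
    forall y, enorm (y - x) < d -> `|f x - f y| < e.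
Proof.
split=> [/(@cvgrPdist_lt R R V (nbhs x) _ f (f x)) fx e /fx|H].
  by move=> /nbhs_eballP[d d0 xd]; exists d.
apply/(@cvgrPdist_lt R R V (nbhs x) _ f (f x)) => e /H[d d0 xd].
by apply/nbhs_eballP; exists d.
Qed.

Lemma lip_continuous (f : V -> R) (k : R) :
  (forall x y, f x - f y <= k * enorm (x - y)) -> continuous f.
Proof.
move=> fk x; apply/continuous_atP => e e0.
have k1 : 0 < `|k| + 1 by rewrite ltr_wpDl.
exists (e / (`|k| + 1)) => [|y yx]; first by rewrite divr_gt0.
have ke : `|k| * enorm (y - x) < e.
  rewrite ltr_pdivlMr// in yx; apply: le_lt_trans yx.
  by rewrite mulrC ler_wpM2l ?enorm_ge0 // lerDl.
have kk (a b : V) : k * enorm (a - b) <= `|k| * enorm (a - b).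
  by apply: ler_wpM2r; [exact: enorm_ge0|exact: ler_norm].
have := le_trans (fk x y) (kk _ _); have := le_trans (fk y x) (kk _ _).
by rewrite (enormC x y) => *; rewrite ltr_norml; apply/andP; split; lra.
Qed.

Lemma enorm_continuous : continuous (@enorm R n).
Proof. by apply: (@lip_continuous _ 1) => x y; rewrite mul1r enormB. Qed.

Lemma enorm_sub_continuous c : continuous (fun x => enorm (x - c)).
Proof.
apply: (@lip_continuous _ 1) => x y; rewrite mul1r.
by apply: le_trans (enormB _ _) _; rewrite opprB addrA subrK.
Qed.

Lemma coord_continuous i : continuous (fun x : V => x ord0 i).
Proof.
apply: (@lip_continuous _ 1) => x y; rewrite mul1r.
by have := coord_le_enorm (x - y) i; rewrite !mxE; apply: le_trans; exact: ler_norm.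
Qed.

Lemma dot_continuous z : continuous (dot z).
Proof.
apply: (@lip_continuous _ (enorm z)) => x y.
by rewrite -dotNr -dotDr dot_le_enorm.
Qed.

Lemma open_eball c r : open (eball c r).
Proof.
apply: (@open_comp _ _ (fun y => enorm (y - c)) [set t | t < r]).
  by move=> x _; exact: enorm_sub_continuous.
exact: open_lt.
Qed.

Lemma closed_cball c r : closed (cball c r).
Proof.
apply: (@closed_comp _ _ (fun y => enorm (y - c)) [set t | t <= r]).
  by move=> x _; exact: enorm_sub_continuous.
exact: closed_le.
Qed.

Lemma closed_esphere c r : closed (esphere c r).
Proof.
apply: (@closed_comp _ _ (fun y => enorm (y - c)) [set t | t = r]).
  by move=> x _; exact: enorm_sub_continuous.
exact: closed_eq.
Qed.

Lemma compact_enorm (C : set V) k :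
  closed C -> (forall x, C x -> enorm x <= k) -> compact C.
Proof.
move=> cC Ck; apply: bounded_closed_compact => //.
exists k; split; first exact: num_real.
by move=> M kM x /Ck xk; apply: le_trans (norm_le_enorm x) _; apply: le_trans xk (ltW kM).
Qed.

Lemma compact_enorm_bounded (C : set V) : compact C ->
  exists2 k, 0 <= k & forall x, C x -> enorm x <= k.
Proof.
move=> /compact_bounded[k [_ kC]].
exists (n.+1%:R * (`|k| + 1)) => [|x Cx]; first by rewrite mulr_ge0.
apply: le_trans (enorm_le_norm x) _; rewrite ler_pM2l//.
by apply: (kC (`|k| + 1)) => //; rewrite ltr_pwDr// ler_norm.
Qed.

Lemma compact_cball c r : compact (cball c r).
Proof.
apply: (@compact_enorm _ (r + enorm c)); first exact: closed_cball.
by move=> x xc; have := enormD (x - c) c; rewrite subrK; have : enorm (x - c) <= r := xc; lra.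
Qed.

Lemma compact_esphere c r : compact (esphere c r).
Proof.
apply: (@subclosed_compact _ _ (cball c r)); first exact: closed_esphere.
  exact: compact_cball.
by move=> x; rewrite /esphere /cball /= => ->.
Qed.

Lemma eball_cball c r : eball c r `<=` cball c r.
Proof. by move=> x /ltW. Qed.

Lemma esphere_cball c r : esphere c r `<=` cball c r.
Proof. by move=> x; rewrite /esphere /cball /= => ->. Qed.

Lemma eball_center c r : 0 < r -> eball c r c.
Proof. by rewrite /eball /= subrr enorm0. Qed.

End Euclidean.

(** * Continuity on subsets and extrema on compact sets *)

Section Continuity.
Variables (R : realType) (n : nat).
Local Notation V := 'rV[R]_n.

Lemma within_continuousP (A : set V) (f : V -> R) :
  {within A, continuous f} <->
  forall x, A x -> forall e : R, 0 < e -> exists2 d : R, 0 < d &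
    forall y, A y -> enorm (y - x) < d -> `|f x - f y| < e.
Proof.
split=> [/subspace_continuousP fA x Ax e e0|H].
  have /(@cvgrPdist_lt R R V _ _ f (f x))/(_ e e0) := fA x Ax.
  by move=> /nbhs_eballP[d d0 xd]; exists d => // y Ay yx; exact: xd.
apply/subspace_continuousP => x Ax.
apply/(@cvgrPdist_lt R R V _ _ f (f x)) => e /(H x Ax)[d d0 xd].
by apply/nbhs_eballP; exists d => // y yx Ay; exact: xd.
Qed.

Lemma within_continuous_in (W A : set V) (f : V -> R) :
  (forall x, W x -> {for x, continuous f}) -> A `<=` W ->
  {within A, continuous f}.
Proof.
move=> fW AW; apply/within_continuousP => x /AW /fW /continuous_atP fx e /fx.
by move=> [d d0 H]; exists d => // y _; exact: H.
Qed.

Lemma within_continuousN (A : set V) (f : V -> R) :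
  {within A, continuous f} -> {within A, continuous (fun x => - f x)}.
Proof. by move=> cf x; apply: continuousN; exact: cf. Qed.

Lemma within_continuousD (A : set V) (f g : V -> R) :
  {within A, continuous f} -> {within A, continuous g} ->
  {within A, continuous (fun x => f x + g x)}.
Proof. by move=> cf cg x; apply: continuousD; [exact: cf|exact: cg]. Qed.

Lemma within_continuousB (A : set V) (f g : V -> R) :
  {within A, continuous f} -> {within A, continuous g} ->
  {within A, continuous (fun x => f x - g x)}.
Proof. by move=> cf cg; apply: within_continuousD => //; exact: within_continuousN. Qed.

Lemma within_continuousZ (a : R) (A : set V) (f : V -> R) :
  {within A, continuous f} -> {within A, continuous (fun x => a * f x)}.
Proof.
move=> /within_continuousP fA; apply/within_continuousP => x Ax e e0.
have a1 : 0 < `|a| + 1 by rewrite ltr_wpDl.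
have ea : 0 < e / (`|a| + 1) by rewrite divr_gt0.
have [d d0 xd] := fA x Ax _ ea; exists d => // y Ay yx.
have := xd y Ay yx; rewrite ltr_pdivlMr// -mulrBr normrM; apply: le_lt_trans.
by rewrite mulrC ler_wpM2l// lerDl.
Qed.

Lemma within_continuousT (A : set V) (f : V -> R) :
  continuous f -> {within A, continuous f}.
Proof. by move=> cf; apply: (@within_continuous_in setT) => // x _; exact: cf. Qed.

Lemma within_continuous_sub (A B : set V) (f : V -> R) : B `<=` A ->
  {within A, continuous f} -> {within B, continuous f}.
Proof.
move=> BA /within_continuousP fA; apply/within_continuousP => x /BA /fA H e /H.
by move=> [d d0 xd]; exists d => // y /BA; exact: xd.
Qed.

Lemma compact_minP (A : set V) (f : V -> R) : A !=set0 -> compact A ->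
  {within A, continuous f} -> exists2 c, A c & forall x, A x -> f c <= f x.
Proof.
move=> A0 cA /(compact_EVT_min A0 cA)[c]; rewrite inE => Ac H.
by exists c => // x Ax; apply: H; rewrite inE.
Qed.

Lemma compact_maxP (A : set V) (f : V -> R) : A !=set0 -> compact A ->
  {within A, continuous f} -> exists2 c, A c & forall x, A x -> f x <= f c.
Proof.
move=> A0 cA /(compact_EVT_max A0 cA)[c]; rewrite inE => Ac H.
by exists c => // x Ax; apply: H; rewrite inE.
Qed.

Lemma compact_sublevel (A : set V) (f : V -> R) a : compact A ->
  {within A, continuous f} -> compact [set x | A x /\ f x <= a].
Proof.
move=> cA /within_continuousP fA.
have clA : closed A by apply: compact_closed => //; exact: norm_hausdorff.
apply: (@subclosed_compact _ _ A) => //; last by move=> x [].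
move=> x xA; have Ax : A x by apply: clA => B /xA[y [[Ay _] By]]; exists y.
split=> //; rewrite leNgt; apply/negP => fx.
have fxa : 0 < f x - a by rewrite subr_gt0.
have [d d0 xd] := fA x Ax _ fxa.
have /xA[y [[Ay fy] yx]] : nbhs x (eball x d) by apply/nbhs_eballP; exists d.
by have := xd y Ay yx; rewrite ltr_norml => /andP[]; lra.
Qed.

End Continuity.

(** * Second derivatives along coordinate lines *)

Section Lines.
Variables (R : realType) (n : nat).
Local Notation V := 'rV[R]_n.
Implicit Types (f g h : V -> R) (x v : V).

Lemma line_growth f x v (t : R) :
  (fun u : R => u^-1 *: (((fun w : R => f (x + w *: v)) \o shift t) (u *: 1)
     - f (x + t *: v))) =
  (fun u : R => u^-1 *: ((f \o shift (x + t *: v)) (u *: v) - f (x + t *: v))).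
Proof.
apply/funext => u /=; congr (_ *: (f _ - _)).
by rewrite [u *: 1]mulr1 scalerDl addrCA.
Qed.

Lemma line_derivable f x v (t : R) :
  derivable f (x + t *: v) v = derivable (fun w : R => f (x + w *: v)) t 1.
Proof. by rewrite /derivable -line_growth. Qed.

Lemma line_derive f x v (t : R) :
  derive f (x + t *: v) v = derive (fun w : R => f (x + w *: v)) t 1.
Proof. by rewrite /derive -line_growth. Qed.

(** The number [a] is a second derivative at [x] of the restriction of [f] to a line. Nothing is
    asked across the line, so one-variable calculus provides it for separable functions. *)
Definition line2 f x (i : 'I_n) (a : R) := exists2 g : R -> R,
  (exists2 d, 0 < d & forall t : R, `|t| < d ->
     is_derive t 1 (fun u : R => f (x + u *: evec R i)) (g t)) &
  is_derive (0 : R) 1 g a.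

Lemma enorm_evec (i : 'I_n) : enorm (evec R i) = 1.
Proof.
rewrite enormE /dot (bigD1 i)//= big1 ?addr0; last first.
  by move=> j ji; rewrite !mxE (negPf ji) andbF mulr0.
by rewrite !mxE !eqxx mulr1 sqrtr1.
Qed.

Lemma line2_harmonic (W : set V) h x i : open W -> harmonic_on W h -> W x ->
  line2 h x i (partial i (partial i h) x).
Proof.
move=> oW hW Wx; exists (fun t => partial i h (x + t *: evec R i)); last first.
  have [/(_ i)[_ [_ /(_ i)[d _]]] _] := hW x Wx.
  have dP := line_derivable (partial i h) x (evec R i) 0.
  have dE := line_derive (partial i h) x (evec R i) 0.
  rewrite scale0r addr0 in dP dE.
  by split; [rewrite -dP|exact: esym dE].
move/open_eballP : oW => /(_ x Wx)[d d0 xd]; exists d => // t td.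
have Wt : W (x + t *: evec R i).
  by apply: xd; rewrite /eball /= addrC addKr enormZ enorm_evec mulr1.
split; last by rewrite -line_derive.
by rewrite -line_derivable; have [/(_ i)[]] := hW _ Wt.
Qed.

Lemma line2D f g x i a b : line2 f x i a -> line2 g x i b ->
  line2 (fun y => f y + g y) x i (a + b).
Proof.
move=> [p [d d0 fp] pa] [q [e e0 gq] qb]; exists (p \+ q); last first.
  exact: is_deriveD.
exists (Num.min d e) => [|t]; first by rewrite lt_min d0.
rewrite lt_min => /andP[td te].
by apply: is_deriveD; [exact: fp|exact: gq].
Qed.

Lemma line2N f x i a : line2 f x i a -> line2 (fun y => - f y) x i (- a).
Proof.
move=> [p [d d0 fp] pa]; exists (\- p); last exact: is_deriveN.
by exists d => // t td; apply: is_deriveN; exact: fp.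
Qed.

(** At the minimum [g 0 = 0]. Were [a < 0], then [g] would be negative just to the right of [0], and
    the mean value theorem would give [p t < p 0] there. *)
Lemma second_derivative_ge0 (p g : R -> R) (a d : R) : 0 < d ->
  (forall t : R, `|t| < d -> is_derive t 1 p (g t)) ->
  is_derive (0 : R) 1 g a -> (forall t : R, `|t| < d -> p 0 <= p t) -> 0 <= a.
Proof.
move=> d0 pg ga pmin.
have g0 : g 0 = 0.
  have p0 : is_derive (0 : R) 1 p (g 0) by apply: pg; rewrite normr0.
  have p00 : is_derive (0 : R) 1 p 0.
    apply: (@derive1_at_min _ p (- d) d 0); first lra.
    - move=> t; rewrite in_itv/= => /andP[dt td].
      have ptd : `|t| < d by rewrite ltr_norml dt.
      by have [] := pg t ptd.
    - by rewrite in_itv/=; lra.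
    - move=> t; rewrite in_itv/= => /andP[dt td].
      by apply: pmin; rewrite ltr_norml dt.
  by have [_ <-] := p0; have [_ ->] := p00.
rewrite leNgt; apply/negP => a0.
have [/derivable_nbhsP/= H gaE] := ga.
have : \forall t \near (0 : R)^'+, g t < 0.
  have [dg _] := ga.
  have /(@cvgrPdist_lt R R R _ _ _ _) : (h^-1 *: (g (h *: 1 + 0) - g 0)) @[h --> (0:R)^'] --> a.
    by rewrite -gaE; exact: dg.
  move=> /(_ (- a)); rewrite oppr_gt0 => /(_ a0).
  rewrite near_withinE => H1.
  rewrite near_withinE; apply: filterS H1 => t H2 t0.
  move: (H2 (lt0r_neq0 t0)).
  rewrite g0 subr0 addr0 [t *: 1]mulr1 ltr_norml => /andP[+ _].
  rewrite /GRing.scale/= => ?.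
  have : t^-1 * g t < 0 by lra.
  by rewrite pmulr_rlt0// invr_gt0.
rewrite near_withinE => /nbhs_ballP[e /= e0 ge].
pose t := Num.min (e / 2) (d / 2).
have t0 : 0 < t by rewrite lt_min; apply/andP; split; lra.
have te : t < e by rewrite gt_min; apply/orP; left; lra.
have td : t < d by rewrite gt_min; apply/orP; right; lra.
have pd s : s \in `[0, t]%R -> is_derive s 1 p (g s).
  rewrite in_itv/= => /andP[s0 st]; apply: pg.
  by rewrite ger0_norm//; exact: le_lt_trans td.
have pd1 s : s \in `]0, t[%R -> is_derive s 1 p (g s).
  by move=> /subset_itv_oo_cc; exact: pd.
have pc : {within `[0, t], continuous p}.
  apply: (@derivable_within_continuous R R p `[0, t]%R) => s st.
  by have [] := pd s st.
have [c] := @MVT R p g 0 t t0 pd1 pc.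
rewrite in_itv/= => /andP[c0 ct].
have gc : g c < 0.
  apply: ge => //; rewrite /ball/= sub0r normrN gtr0_norm//.
  exact: lt_trans ct te.
have : p 0 <= p t by apply: pmin; rewrite gtr0_norm.
by rewrite subr0; nra.
Qed.

Lemma line2_min f x i a : line2 f x i a ->
  (exists2 d, 0 < d & forall y, enorm (y - x) < d -> f x <= f y) -> 0 <= a.
Proof.
move=> [g [d d0 fg] ga] [e e0 fmin].
apply: (@second_derivative_ge0 (fun u => f (x + u *: evec R i)) g a (Num.min d e)) => //.
- by rewrite lt_min d0.
- by move=> t; rewrite lt_min => /andP[td _]; exact: fg.
- move=> t; rewrite lt_min => /andP[_ te]; rewrite scale0r addr0; apply: fmin.
  by rewrite addrC addKr enormZ enorm_evec mulr1.
Qed.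

End Lines.

Lemma is_derive_affine (R : realType) (a b t : R) :
  is_derive t 1 (fun u : R => a + u * b) b.
Proof.
by apply: is_derive_eq; rewrite add0r scaler0 add0r [_ *: 1]mulr1 mul1r.
Qed.

(** * Harmonic functions *)

Section Harmonic.
Variables (R : realType) (n : nat).
Local Notation V := 'rV[R]_n.
Implicit Types (f g h p : V -> R) (x y z v : V) (W : set V).

Lemma continuousD_at f g x : {for x, continuous f} -> {for x, continuous g} ->
  {for x, continuous (fun y => f y + g y)}.
Proof. exact: continuousD. Qed.

Lemma open_eq_near W f g x : open W -> W x -> (forall y, W y -> f y = g y) ->
  \forall y \near x, f y = g y.
Proof. by move=> oW Wx fg; apply: filterS fg _; exact: open_nbhs_nbhs. Qed.

Lemma open_eq_continuous W f g x : open W -> W x ->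
  (forall y, W y -> f y = g y) ->
  {for x, continuous f} -> {for x, continuous g}.
Proof.
move=> oW Wx fg /continuous_atP fx; apply/continuous_atP => e /fx[d d0 xd].
move/open_eballP : oW => /(_ x Wx)[r r0 xr].
exists (Num.min d r) => [|y]; first by rewrite lt_min d0.
rewrite lt_min => /andP[yd yr]; rewrite -!fg//; last exact: xr.
exact: xd.
Qed.

Lemma harmonic_ext W f g : open W -> (forall y, W y -> f y = g y) ->
  harmonic_on W f -> harmonic_on W g.
Proof.
move=> oW fg hf x Wx.
have d1 i y : W y -> partial i f y = partial i g y.
  by move=> Wy; apply: near_eq_derive; exact: open_eq_near fg.
have d2 i j y : W y -> partial j (partial i f) y = partial j (partial i g) y.
  by move=> Wy; apply: near_eq_derive; apply: open_eq_near (d1 i).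
have [H1 H2] := hf x Wx; split; last first.
  by rewrite -[RHS]H2; apply: eq_bigr => i _; rewrite d2.
move=> i; have [fd [fc fdd]] := H1 i; split.
  by apply: near_eq_derivable fd; exact: open_eq_near fg.
split; first exact: (open_eq_continuous oW Wx (d1 i) fc).
move=> j; have [fjd fjc] := fdd j; split.
  by apply: near_eq_derivable fjd; exact: open_eq_near (d1 i).
exact: (open_eq_continuous oW Wx (d2 i j) fjc).
Qed.

Lemma harmonicD W f g : open W -> harmonic_on W f -> harmonic_on W g ->
  harmonic_on W (fun x => f x + g x).
Proof.
move=> oW hf hg x Wx.
have d1 i y : W y -> partial i (fun x => f x + g x) y =
    partial i f y + partial i g y.
  move=> Wy; have [/(_ i)[fd _] _] := hf y Wy.
  by have [/(_ i)[gd _] _] := hg y Wy; exact: deriveD.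
have d2 i j y : W y -> partial j (partial i (fun x => f x + g x)) y =
    partial j (partial i f) y + partial j (partial i g) y.
  move=> Wy; have [/(_ i)[_ [_ /(_ j)[fd _]]] _] := hf y Wy.
  have [/(_ i)[_ [_ /(_ j)[gd _]]] _] := hg y Wy.
  by rewrite -deriveD//; apply: near_eq_derive; apply: open_eq_near (d1 i).
have [H1 H2] := hf x Wx; have [G1 G2] := hg x Wx; split; last first.
  transitivity (\sum_(i < n) (partial i (partial i f) x + partial i (partial i g) x)).
    by apply: eq_bigr => i _; rewrite d2.
  rewrite big_split -[RHS]addr0; congr (_ + _); [exact: H2|exact: G2].
move=> i; have [fd [fc fdd]] := H1 i; have [gd [gc gdd]] := G1 i; split.
  exact: derivableD.
split.
  apply: (@open_eq_continuous W (fun y => partial i f y + partial i g y)) => //.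
    by move=> y Wy; rewrite d1.
  exact: (continuousD_at fc gc).
move=> j; have [fjd fjc] := fdd j; have [gjd gjc] := gdd j; split.
  apply: (@near_eq_derivable _ _ _ (fun y => partial i f y + partial i g y)).
    by apply: (@open_eq_near W) => // y Wy; rewrite d1.
  exact: derivableD.
apply: (@open_eq_continuous W
  (fun y => partial j (partial i f) y + partial j (partial i g) y)) => //.
  by move=> y Wy; rewrite d2.
exact: (continuousD_at fjc gjc).
Qed.

Lemma continuousZ_at (a : R) f x : {for x, continuous f} ->
  {for x, continuous (fun y => a * f y)}.
Proof. by move=> fx; apply: (@continuousM _ _ (fun=> a) f) => //; exact: cst_continuous. Qed.

Lemma partialZ (a : R) f i x : derivable f x (evec R i) ->
  derivable (fun y => a * f y) x (evec R i) /\
  partial i (fun y => a * f y) x = a * partial i f x.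
Proof.
by move=> fx; split; [exact: (@derivableZ _ _ _ f a)|exact: (@deriveZ _ _ _ f a)].
Qed.

Lemma harmonicZ W (a : R) f : open W -> harmonic_on W f ->
  harmonic_on W (fun x => a * f x).
Proof.
move=> oW hf x Wx.
have d1 i y : W y -> partial i (fun x => a * f x) y = a * partial i f y.
  by move=> Wy; have [/(_ i)[/(partialZ a)[]]] := hf y Wy.
have d2 i j y : W y -> partial j (partial i (fun x => a * f x)) y =
    a * partial j (partial i f) y.
  move=> Wy; have [/(_ i)[_ [_ /(_ j)[/(partialZ a)[_ <-] _]]] _] := hf y Wy.
  by apply: near_eq_derive; apply: open_eq_near (d1 i).
have [H1 H2] := hf x Wx; split; last first.
  transitivity (\sum_(i < n) a * partial i (partial i f) x).
    by apply: eq_bigr => i _; rewrite d2.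
  by rewrite -mulr_sumr; move: H2 => ->; exact: mulr0.
move=> i; have [fd [fc fdd]] := H1 i; split.
  by have [] := partialZ a fd.
split.
  apply: (@open_eq_continuous W (fun y => a * partial i f y)) => //.
    by move=> y Wy; rewrite d1.
  exact: (continuousZ_at fc).
move=> j; have [fjd fjc] := fdd j; split.
  apply: (@near_eq_derivable _ _ _ (fun y => a * partial i f y)).
    by apply: (@open_eq_near W) => // y Wy; rewrite d1.
  by have [] := partialZ a fjd.
apply: (@open_eq_continuous W (fun y => a * partial j (partial i f) y)) => //.
  by move=> y Wy; rewrite d2.
exact: (continuousZ_at fjc).
Qed.

Lemma harmonicN W f : open W -> harmonic_on W f -> harmonic_on W (fun x => - f x).
Proof.
move=> oW /(harmonicZ (-1) oW); apply: harmonic_ext => // x _.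
by rewrite mulN1r.
Qed.

Lemma harmonic_sub W W' f : W' `<=` W -> harmonic_on W f -> harmonic_on W' f.
Proof. by move=> WW hf x /WW; exact: hf. Qed.

Lemma translate_growth f z x v :
  (fun u : R => u^-1 *: (((fun y => f (y + z)) \o shift x) (u *: v) - f (x + z)))
  = (fun u : R => u^-1 *: ((f \o shift (x + z)) (u *: v) - f (x + z))).
Proof. by apply/funext => u /=; rewrite addrA. Qed.

Lemma derivable_translate f z x v :
  derivable (fun y => f (y + z)) x v = derivable f (x + z) v.
Proof. by rewrite /derivable -translate_growth. Qed.

Lemma partial_translate f z i :
  partial i (fun y => f (y + z)) = fun y => partial i f (y + z).
Proof. by apply/funext => x; rewrite /partial /derive -translate_growth. Qed.

Lemma continuous_translate f z x :
  {for x + z, continuous f} -> {for x, continuous (fun y => f (y + z))}.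
Proof.
move=> /continuous_atP fx; apply/continuous_atP => e /fx[d d0 xd].
exists d => // y yx; apply: xd.
by rewrite opprD addrACA subrr addr0.
Qed.

Lemma harmonic_translate W f z : harmonic_on W f ->
  harmonic_on [set y | W (y + z)] (fun y => f (y + z)).
Proof.
move=> hf x /hf[H1 H2]; split=> [i|]; last first.
  by rewrite -[RHS]H2; apply: eq_bigr => i _; rewrite !partial_translate.
have [fd [fc fdd]] := H1 i; rewrite !partial_translate derivable_translate.
split; first exact: fd.
split; first exact: continuous_translate fc.
move=> j; have [fjd fjc] := fdd j; rewrite derivable_translate partial_translate.
by split; [exact: fjd|exact: continuous_translate fjc].
Qed.

Lemma partial_line f (g : V -> R) i :
  (forall y, is_derive (0 : R) 1 (fun u : R => f (y + u *: evec R i)) (g y)) ->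
  (forall y, derivable f y (evec R i)) /\ partial i f = g.
Proof.
move=> fg; split=> [y|].
  have dP := line_derivable f y (evec R i) 0.
  by rewrite scale0r addr0 in dP; rewrite dP; have [] := fg y.
apply/funext => y; have dE := line_derive f y (evec R i) 0.
by rewrite scale0r addr0 in dE; rewrite /partial dE; have [] := fg y.
Qed.

Lemma dot_evec v i : dot v (evec R i) = v ord0 i.
Proof.
rewrite /dot (bigD1 i)//= big1 ?addr0; last first.
  by move=> j ji; rewrite !mxE (negPf ji) andbF mulr0.
by rewrite !mxE !eqxx mulr1.
Qed.

Lemma partial_cst i (a : R) :
  (forall y, derivable (fun _ : V => a) y (evec R i)) /\
  partial i (fun _ : V => a) = fun=> 0.
Proof. by apply: partial_line => y; exact: is_derive_cst. Qed.

Lemma harmonic_affine W v x (a : R) :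
  harmonic_on W (fun y => dot v (y - x) + a).
Proof.
have d i : (forall y, derivable (fun y => dot v (y - x) + a) y (evec R i)) /\
  partial i (fun y => dot v (y - x) + a) = fun=> v ord0 i.
  apply: partial_line => y.
  rewrite (_ : (fun _ => _) =
    (fun u : R => (dot v (y - x) + a) + u * v ord0 i)); last first.
    apply/funext => u; rewrite -[y + _ - x]addrA (addrC (u *: _)) addrA.
    by rewrite (dotDr (y - x)) dotZr dot_evec addrAC.
  exact: is_derive_affine.
have [c1 c2] : (forall i (a : R) y, derivable (fun _ : V => a) y (evec R i)) /\
   (forall i (a : R), partial i (fun _ : V => a) = fun=> 0).
  by split=> i b; have [] := partial_cst i b.
move=> y Wy; split=> [i|].
  have [d1 d2] := d i; split; first exact: d1.
  rewrite d2; split; first exact: cst_continuous.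
  by move=> j; split; [exact: c1|rewrite c2; exact: cst_continuous].
by rewrite big1// => i _; have [_ ->] := d i; rewrite c2.
Qed.

Lemma harmonic_cst W (a : R) : harmonic_on W (fun=> a : R).
Proof.
rewrite (_ : (fun=> a) = (fun y => dot 0 (y - 0) + a)); first exact: harmonic_affine.
by apply/funext => y; rewrite -(scale0r (0 : V)) dotZl mul0r add0r.
Qed.

End Harmonic.

(** * Continuous superharmonic functions *)

Section Superharmonic.
Variables (R : realType) (n : nat).
Local Notation V := 'rV[R]_n.
Implicit Types (f g h s t : V -> R) (x y z c v : V) (W : set V).

(** Compactness as an induction on sets. The passages from local to uniform data below (radii,
    bounds, indices, finite minima of competitors) are instances of it, each with its own [P]. *)
Lemma compact_ind (K : set V) (P : set V -> Prop) : compact K ->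
  (forall A B, A `<=` B -> P B -> P A) -> P set0 ->
  (forall A B, P A -> P B -> P (A `|` B)) ->
  (forall x, K x -> exists2 d : R, 0 < d & P (eball x d)) ->
  exists O, [/\ open O, K `<=` O & P O].
Proof.
move=> cK Psub P0 PU PK.
have /choice[d dP] : forall x, exists d : R, K x -> 0 < d /\ P (eball x d).
  move=> x; have [/PK[d d0 Pd]|nKx] := pselect (K x); first by exists d.
  by exists 0.
move: cK; rewrite compact_cover => /(_ V K (fun x => eball x (d x))).
case=> [x Kx|x Kx|D DK KD].
- exact: open_eball.
- by exists x => //; apply: eball_center; have [] := dP x Kx.
exists (\bigcup_(x in [set` D]) eball x (d x)); split=> //.
  by apply: bigcup_open => x _; exact: open_eball.
have {KD} : {subset enum_fset D <= K} by move=> x /DK.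
rewrite (_ : [set` D] = [set x | x \in enum_fset D])//.
elim: (enum_fset D) => [|x l IH] H.
  by rewrite (_ : \bigcup_(_ in _) _ = set0)// -subset0 => y [].
apply: (Psub _ (eball x (d x) `|` \bigcup_(y in [set y | y \in l]) eball y (d y))).
  move=> y [z /=]; rewrite inE => /orP[/eqP-> zy|zl zy]; first by left.
  by right; exists z.
apply: PU.
  by have /set_mem/dP[] := H x (mem_head _ _).
by apply: IH => y yl; apply: H; rewrite inE yl orbT.
Qed.

(* [s] is total, but only its values on [W] matter. *)
Definition csh W s := [/\ open W, forall x, W x -> {for x, continuous s} &
  forall c (r : R), 0 < r -> cball c r `<=` W ->
    forall h, {within cball c r, continuous h} -> harmonic_on (eball c r) h ->
      (forall y, esphere c r y -> h y <= s y) ->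
      forall y, eball c r y -> h y <= s y].

Lemma csh_sub W W' s : open W' -> W' `<=` W -> csh W s -> csh W' s.
Proof.
move=> oW' W'W [_ cs ss]; split=> // [x /W'W/cs//|c r r0 cr].
by apply: ss => //; exact: subset_trans W'W.
Qed.

Lemma cball_sub_eball c c' (r r' : R) : enorm (c - c') + r < r' ->
  cball c r `<=` eball c' r'.
Proof.
move=> H y; rewrite /cball /eball /= => yc.
by have := enorm_sub y c c'; lra.
Qed.

(* At a minimum point of [s - h] farthest from [c], comparison with [h] plus an
   affine function increasing away from [c] gives a contradiction: this plays
   the role of the Poisson integral in the usual local-to-global argument. *)
Lemma csh_center W s : open W -> (forall x, W x -> {for x, continuous s}) ->
  (forall y, W y -> exists2 r0 : R, 0 < r0 & forall r, 0 < r < r0 ->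
     forall h, {within cball y r, continuous h} -> harmonic_on (eball y r) h ->
     (forall z, esphere y r z -> h z <= s z) -> h y <= s y) ->
  csh W s.
Proof.
move=> oW cs H; split=> // c r r0 crW h ch hh hs y cy.
rewrite leNgt; apply/negP => sy.
pose u z := s z - h z.
have cu : {within cball c r, continuous u}.
  by apply: within_continuousB => //; apply: within_continuous_in crW.
have [z0 z0c z0min] : exists2 z0, cball c r z0 &
    forall z, cball c r z -> u z0 <= u z.
  apply: compact_minP => //; last exact: compact_cball.
  by exists y; exact: eball_cball.
set m := u z0 in z0min.
have m0 : m < 0.
  by apply: (@le_lt_trans _ _ (u y)); [exact/z0min/eball_cball|rewrite /u subr_lt0].
have [y0 [y0c um] y0max] : exists2 y0, cball c r y0 /\ u y0 <= m &
    forall z, cball c r z /\ u z <= m -> enorm (z - c) <= enorm (y0 - c).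
  apply: (@compact_maxP _ _ [set z | cball c r z /\ u z <= m] (fun z => enorm (z - c))).
  - by exists z0.
  - by apply: compact_sublevel => //; exact: compact_cball.
  - by apply: within_continuousT; exact: enorm_sub_continuous.
have {}um : u y0 = m by apply/eqP; rewrite eq_le um z0min.
have y0r : enorm (y0 - c) < r.
  rewrite lt_neqAle; apply/andP; split; last exact: y0c.
  apply/negP => /eqP y0r; have := hs y0 y0r.
  by move: um m0; rewrite /u; lra.
have Wy0 : W y0 by apply: crW.
have [r1 r10 Hr1] := H y0 Wy0.
pose rho := Num.min r1 (r - enorm (y0 - c)) / 2.
have mr : 0 < Num.min r1 (r - enorm (y0 - c)) by rewrite lt_min r10/= subr_gt0.
have rho0 : 0 < rho by rewrite /rho divr_gt0.
have rhor1 : rho < r1.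
  have : Num.min r1 (r - enorm (y0 - c)) <= r1 by rewrite ge_min lexx.
  by move: mr; rewrite /rho; lra.
have rhor : enorm (y0 - c) + rho < r.
  have : Num.min r1 (r - enorm (y0 - c)) <= r - enorm (y0 - c).
    by rewrite ge_min lexx orbT.
  by move: mr; rewrite /rho; lra.
have sub : cball y0 rho `<=` eball c r by exact: cball_sub_eball.
pose l z := dot (y0 - c) (z - y0).
have cl : continuous l.
  apply: (@lip_continuous _ _ _ (enorm (y0 - c))) => a b.
  rewrite /l -dotNr -dotDr opprB addrA subrK; exact: dot_le_enorm.
(* On [Q] the squared distance to [c] is [rho^2 + 2 l z + |y0 - c|^2], larger than [|y0 - c|^2], so
   [u > m] by the choice of [y0]. On the rest of the sphere [l z + rho^2 / 8] is negative, so adding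
   a small multiple of it to [m] stays below [u] everywhere on the sphere; at [y0] it is
   positive. *)
pose Q := [set z | esphere y0 rho z /\ - l z <= rho ^+ 2 / 4].
have cQ : compact Q.
  have cNl : {within esphere y0 rho, continuous (fun z => - l z)}.
    by apply: within_continuousN; exact: within_continuousT.
  by apply: (compact_sublevel _ cNl); exact: compact_esphere.
have Qu z : Q z -> m < u z.
  move=> [zs lz]; have zc : cball c r z by exact/eball_cball/sub/esphere_cball.
  rewrite lt_neqAle z0min// andbT; apply/negP => /eqP uz.
  have : enorm (z - c) <= enorm (y0 - c) by apply: y0max; rewrite -uz.
  rewrite -(@ler_pXn2r _ 2)// ?nnegrE ?enorm_ge0//.
  have -> : z - c = (z - y0) + (y0 - c) by rewrite addrA subrK.
  rewrite sqr_enormD (dotC (z - y0)) -/(l z).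
  have -> : enorm (z - y0) = rho by exact: zs.
  by move: (exprn_gt0 2 rho0); lra.
have [e e0 eQ] : exists2 e : R, 0 < e &
    forall z, Q z -> m + e * (l z + rho ^+ 2 / 8) <= u z.
  have [Q0|/set0P/negP/negPn/eqP Q0] := pselect (Q !=set0); last first.
    by exists 1 => // z; rewrite Q0.
  have [q Qq qmin] : exists2 q, Q q & forall z, Q z -> u q <= u z.
    apply: compact_minP => //; apply: within_continuous_sub cu => z [zs _].
    exact/eball_cball/sub/esphere_cball.
  pose B := rho * enorm (y0 - c) + rho ^+ 2.
  have B0 : 0 < B.
    by rewrite ltr_wpDl ?exprn_gt0// mulr_ge0 ?enorm_ge0// ltW.
  have uq := Qu q Qq.
  exists ((u q - m) / B) => [|z Qz]; first by rewrite divr_gt0// subr_gt0.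
  have lB : l z + rho ^+ 2 / 8 <= B.
    have [zs _] := Qz; have := dot_le_enorm (y0 - c) (z - y0).
    have -> : enorm (z - y0) = rho by exact: zs.
    rewrite -/(l z) /B [_ * rho]mulrC.
    by move: (exprn_gt0 2 rho0); lra.
  have : (u q - m) / B * (l z + rho ^+ 2 / 8) <= (u q - m) / B * B.
    by rewrite ler_pM2l// divr_gt0// subr_gt0.
  rewrite divfK ?gt_eqF//; have := qmin z Qz; lra.
pose h' z := h z + (dot (e *: (y0 - c)) (z - y0) + (m + e * (rho ^+ 2 / 8))).
have : h' y0 <= s y0.
  apply: (Hr1 rho) => //; first by rewrite rho0.
  - apply: within_continuousD.
      by apply: within_continuous_sub ch => z /sub; exact: eball_cball.
    apply: within_continuousT => x.
    apply: (@continuousD_at _ _ (fun z => dot (e *: (y0 - c)) (z - y0)) (fun=> _));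
      last exact: cst_continuous.
    rewrite (_ : (fun _ => _) = (fun z => e * l z)).
      by apply: continuousZ_at; exact: cl.
    by apply/funext => z; rewrite dotZl.
  - apply: harmonicD; first exact: open_eball.
      by apply: harmonic_sub hh => z /eball_cball/sub.
    exact: harmonic_affine.
  - move=> z zs; rewrite /h' dotZl -/(l z).
    have zc : cball c r z by exact/eball_cball/sub/esphere_cball.
    have [lz|lz] := leP (- l z) (rho ^+ 2 / 4).
      by have := eQ z (conj zs lz); rewrite /u; lra.
    have := z0min z zc; rewrite /u => ?.
    have : e * (l z + rho ^+ 2 / 8) <= 0.
      rewrite pmulr_rle0//; move: (exprn_gt0 2 rho0); lra.
    lra.
rewrite /h' subrr -[X in dot _ X](scale0r (0 : V)) dotZr mul0r add0r.
have := mulr_gt0 e0 (exprn_gt0 2 rho0).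
by move: um; rewrite /u; lra.
Qed.

(** [csh_center] tests only centres of small balls, and such a ball about [x] lies in the
    neighbourhood where [s] agrees with [s']. *)
Lemma csh_local W s : open W ->
  (forall x, W x -> exists W' s', [/\ csh W' s', W' x &
     forall y, W' y -> s' y = s y]) -> csh W s.
Proof.
move=> oW H; apply: csh_center => // x /H[W' [s' [[oW' cs' ss'] W'x ss]]].
  exact: open_eq_continuous ss (cs' x W'x).
move/open_eballP : oW' => /(_ x W'x)[r0 r00 xr0]; exists r0 => // r /andP[r1 rr0].
have sub : cball x r `<=` W' by move=> y yr; apply: xr0; exact: le_lt_trans rr0.
move=> h ch hh hs; rewrite -ss//; apply: (ss' x r) => //.
  by move=> y ys; rewrite ss; [exact: hs|exact/sub/esphere_cball].
exact: eball_center.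
Qed.

Lemma csh_ext W s t : (forall y, W y -> s y = t y) -> csh W s -> csh W t.
Proof.
move=> st sW; apply: csh_local => [|x Wx]; first by case: sW.
by exists W, s.
Qed.

Lemma csh_min W s t : csh W s -> csh W t ->
  csh W (fun x => Num.min (s x) (t x)).
Proof.
move=> [oW cs ss] [_ ct st]; split=> // [x Wx|c r r0 cr h ch hh hst y cy].
  apply/continuous_atP => e e0.
  have /continuous_atP/(_ e e0)[d d0 xd] := cs x Wx.
  have /continuous_atP/(_ e e0)[d' d'0 xd'] := ct x Wx.
  exists (Num.min d d') => [|y]; first by rewrite lt_min d0.
  rewrite lt_min => /andP[/xd + /xd'].
  by rewrite /Num.min !ltr_norml; do 2 case: ifPn => ?; lra.
rewrite le_min; apply/andP; split.
  by apply: (ss c r) => // z /hst; rewrite le_min => /andP[].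
by apply: (st c r) => // z /hst; rewrite le_min => /andP[].
Qed.

Lemma csh_affine W s v x (a : R) : csh W s ->
  csh W (fun y => s y + (dot v (y - x) + a)).
Proof.
move=> [oW cs ss].
have ca : continuous (fun y => dot v (y - x) + a).
  move=> y; apply: (@continuousD_at _ _ (fun y => dot v (y - x)) (fun=> a));
    last exact: cst_continuous.
  by apply: (@continuous_translate _ _ (dot v)); exact: dot_continuous.
split=> // [y Wy|c r r0 cr h ch hh hs y cy].
  by apply: (@continuousD_at _ _ s (fun z => dot v (z - x) + a)); [exact: cs|exact: ca].
rewrite -lerBlDr; apply: (ss c r r0 cr (fun z => h z - (dot v (z - x) + a))).
- by apply: within_continuousB; [exact: ch|exact: within_continuousT].
- apply: harmonicD; [exact: open_eball|exact: hh|].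
  by apply: harmonicN; [exact: open_eball|exact: harmonic_affine].
- by move=> z /hs; rewrite lerBlDr.
- exact: cy.
Qed.

Lemma csh_addcst W s (a : R) : csh W s -> csh W (fun y => s y + a).
Proof.
move=> /(csh_affine 0 0 a); apply: csh_ext => y _.
by rewrite -[X in dot X](scale0r (0 : V)) dotZl mul0r add0r.
Qed.

Lemma csh_scale W s (a : R) : 0 < a -> csh W s -> csh W (fun y => a * s y).
Proof.
move=> a0 [oW cs ss]; split=> // [y Wy|c r r0 cr h ch hh hs y cy].
  by apply: continuousZ_at; exact: cs.
rewrite -ler_pdivrMl//; apply: (ss c r r0 cr (fun z => a^-1 * h z)).
- exact: within_continuousZ.
- by apply: harmonicZ; [exact: open_eball|exact: hh].
- by move=> z /hs; rewrite ler_pdivrMl.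
- exact: cy.
Qed.

(** For a given test function and a given point, a single majorant of [s] that nearly touches [s] at
    this point suffices. *)
Lemma csh_inf W s : open W -> (forall x, W x -> {for x, continuous s}) ->
  (forall y, W y -> forall e : R, 0 < e ->
     exists t, [/\ csh W t, forall z, W z -> s z <= t z & t y < s y + e]) ->
  csh W s.
Proof.
move=> oW cs H; split=> // c r r0 cr h ch hh hs y cy.
rewrite leNgt; apply/negP; rewrite -subr_gt0 => hsy.
have Wy : W y by exact/cr/eball_cball.
have [t [[_ _ tt] st ty]] := H y Wy _ hsy.
have : h y <= t y.
  apply: (tt c r) => // z zs; apply: le_trans (hs z zs) _.
  exact/st/cr/esphere_cball.
lra.
Qed.

(** If comparison with [h] failed, [s - h] would have an interior minimum. All its pure second
    derivatives are nonnegative there, whereas their sum is the negative sum of the [a i], as [h] is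
    harmonic. *)
Lemma csh_strict W s (a : 'I_n -> V -> R) : open W ->
  (forall x, W x -> {for x, continuous s}) ->
  (forall x, W x -> forall i, line2 s x i (a i x)) ->
  (forall x, W x -> \sum_(i < n) a i x < 0) -> csh W s.
Proof.
move=> oW cs H a0; split=> // c r r0 cr h ch hh hs y cy.
rewrite leNgt; apply/negP => hsy.
pose u z := s z - h z.
have cu : {within cball c r, continuous u}.
  by apply: within_continuousB => //; apply: within_continuous_in cr.
have [x xc xmin] : exists2 x, cball c r x &
    forall z, cball c r z -> u x <= u z.
  apply: compact_minP => //; last exact: compact_cball.
  by exists y; exact: eball_cball.
have xr : enorm (x - c) < r.
  rewrite lt_neqAle; apply/andP; split; last exact: xc.
  apply/negP => /eqP xr; have := hs x xr; have := xmin y (eball_cball cy).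
  by rewrite /u; lra.
have hl i := line2_harmonic i (open_eball (c := c) (r := r)) hh xr.
have ul i : line2 u x i (a i x - partial i (partial i h) x).
  by apply: line2D; [exact/H/cr|exact: line2N].
have ag0 i : 0 <= a i x - partial i (partial i h) x.
  apply: line2_min (ul i) _; exists (r - enorm (x - c)); first by rewrite subr_gt0.
  move=> z zx; apply: xmin; rewrite /cball /=.
  by have := enorm_sub z x c; lra.
have : 0 <= \sum_(i < n) (a i x - partial i (partial i h) x).
  by apply: sumr_ge0 => i _; exact: ag0.
have [_ hx] := hh x xr.
rewrite sumrB; move: hx => ->; rewrite subr0.
by rewrite leNgt a0//; exact: cr.
Qed.

Lemma csh_superharmonic W s : csh W s -> superharmonic_on W (EFin \o s).
Proof.
move=> [oW cs ss]; split=> //; split; first by move=> x _; rewrite ltNyr.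
split=> [x Wx a|]; last split.
- rewrite /= lte_fin => ax.
  have sa : 0 < s x - a by rewrite subr_gt0.
  have /continuous_atP/(_ _ sa)[d d0 xd] := cs x Wx.
  apply/nbhs_eballP; exists d => // y /xd; rewrite /= lte_fin ltr_norml => /andP[].
  lra.
- by move=> x Wx; exists x; split; [exact: connected_component_refl|rewrite ltry].
- move=> c r r0 cr h ch hh hs y cy; rewrite lee_fin.
  by apply: (ss c r) => // z /hs; rewrite lee_fin.
Qed.

End Superharmonic.

(** * The Dirichlet problem for polynomials *)

Section Polynomials.
Variables (R : realType) (n : nat) (c : 'rV[R]_n).
Local Notation V := 'rV[R]_n.
Implicit Types (p q u w : V -> R) (x y : V) (d e : nat) (i j : 'I_n).

(** Homogeneous polynomials in [x - c], as functions. The zero function has every degree, so that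
    derivatives and empty sums are not exceptional. *)
Inductive hpoly : nat -> (V -> R) -> Prop :=
| hpoly_cst a : hpoly 0 (fun=> a)
| hpoly0 d : hpoly d (fun=> 0)
| hpolyX d i p : hpoly d p -> hpoly d.+1 (fun x => (x ord0 i - c ord0 i) * p x)
| hpolyD d p q : hpoly d p -> hpoly d q -> hpoly d (fun x => p x + q x).

Lemma hpoly_ext d p q : p =1 q -> hpoly d p -> hpoly d q.
Proof. by move=> /funext ->. Qed.

Lemma hpolyZ a d p : hpoly d p -> hpoly d (fun x => a * p x).
Proof.
elim=> {d p} [b|d|d i p _ IH|d p q _ IHp _ IHq].
- exact: hpoly_cst.
- by apply: hpoly_ext (hpoly0 d) => x; rewrite mulr0.
- by apply: hpoly_ext (hpolyX i IH) => x; rewrite mulrCA.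
- by apply: hpoly_ext (hpolyD IHp IHq) => x; rewrite mulrDr.
Qed.

Lemma hpoly_sum (I : Type) (r : seq I) d (F : I -> V -> R) :
  (forall k, hpoly d (F k)) -> hpoly d (fun x => \sum_(k <- r) F k x).
Proof.
move=> HF; elim: r => [|a r IH].
  by apply: hpoly_ext (hpoly0 d) => x; rewrite big_nil.
by apply: hpoly_ext (hpolyD (HF a) IH) => x; rewrite big_cons.
Qed.

Lemma hpolyM d e p q : hpoly d p -> hpoly e q -> hpoly (d + e) (fun x => p x * q x).
Proof.
move=> + hq; elim=> {d p} [b|d|d i p _ IH|d p p' _ IHp _ IHq].
- exact: hpolyZ.
- by apply: hpoly_ext (hpoly0 (d + e)) => x; rewrite mul0r.
- by rewrite addSn; apply: hpoly_ext (hpolyX i IH) => x; rewrite mulrA.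
- by apply: hpoly_ext (hpolyD IHp IHq) => x; rewrite mulrDl.
Qed.

Definition sq x := dot (x - c) (x - c).

Lemma hpoly_sq : hpoly 2 sq.
Proof.
apply: (@hpoly_ext _ (fun x => \sum_(i < n) (x ord0 i - c ord0 i) *
  ((x ord0 i - c ord0 i) * 1))).
  by move=> x; apply: eq_bigr => i _; rewrite !mxE mulr1.
by apply: hpoly_sum => i; do 2 apply: hpolyX; exact: hpoly_cst.
Qed.

Lemma hpoly_continuous d p : hpoly d p -> continuous p.
Proof.
elim=> {d p} [b|d|d i p _ IH|d p q _ IHp _ IHq]; try exact: cst_continuous.
  move=> x; apply: (@continuousM _ _ (fun x : V => x ord0 i - c ord0 i) p); last exact: IH.
  apply: (@continuousD_at _ _ (fun x : V => x ord0 i) (fun=> - c ord0 i)).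
    exact: coord_continuous.
  exact: cst_continuous.
by move=> x; exact: (continuousD_at (IHp x) (IHq x)).
Qed.

Lemma is_derive_coord i j x :
  is_derive x (evec R i) (fun x : V => x ord0 j - c ord0 j) (i == j)%:R.
Proof.
have [d1 d2] : (forall y, derivable (fun x : V => x ord0 j - c ord0 j) y (evec R i)) /\
    partial i (fun x : V => x ord0 j - c ord0 j) = fun=> (i == j)%:R.
  apply: partial_line => y.
  rewrite (_ : (fun _ => _) =
    (fun u : R => (y ord0 j - c ord0 j) + u * (i == j)%:R)); last first.
    by apply/funext => u; rewrite !mxE eqxx/= (eq_sym j) addrAC.
  exact: is_derive_affine.
split; first exact: d1.
by have := congr1 (fun f => f x) d2.
Qed.

Lemma is_derive_prod p q (dp dq : R) x (v : V) :
  is_derive x v p dp -> is_derive x v q dq ->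
  is_derive x v (fun y => p y * q y) (p x * dq + q x * dp).
Proof. exact: is_deriveM. Qed.

(** For [d = 0] the truncated degree [d.-1] forgets that the derivative vanishes. The last clause
    records it; the product rule needs it to keep the degree of [(x_j - c_j) q] equal to [d]. *)
Lemma hpoly_derive d p i : hpoly d p ->
  exists q, [/\ hpoly d.-1 q, forall y, is_derive y (evec R i) p (q y) &
    d = 0%N -> forall y, q y = 0].
Proof.
elim=> {d p} [b|d|d j p hp [q [hq pq q0]]|d p q _ [p' [hp pp p0]] _ [q' [hq qq q0]]].
- by exists (fun=> 0); split=> //; [exact: hpoly0|move=> y; exact: is_derive_cst].
- by exists (fun=> 0); split=> //; [exact: hpoly0|move=> y; exact: is_derive_cst].
- exists (fun x => (x ord0 j - c ord0 j) * q x + p x * (i == j)%:R); split=> //.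
    apply: hpolyD; last first.
      by apply: hpoly_ext (hpolyZ (i == j)%:R hp) => x; rewrite mulrC.
    case: d hq q0 {hp} => [|d] hq q0; last exact: hpolyX.
    by apply: hpoly_ext (hpoly0 0) => x; rewrite q0// mulr0.
  by move=> y; apply: is_derive_prod => //; exact: is_derive_coord.
- exists (fun x => p' x + q' x); split; first exact: hpolyD.
    by move=> y; exact: is_deriveD.
  by move=> d0 y; rewrite p0// q0// addr0.
Qed.

Lemma hpoly_partial d p i : hpoly d p -> hpoly d.-1 (partial i p).
Proof.
move=> /(hpoly_derive i)[q [hq pq _]]; apply: hpoly_ext hq => x.
by have [_ <-] := pq x.
Qed.

Lemma hpoly_is_derive d p i x : hpoly d p ->
  is_derive x (evec R i) p (partial i p x).
Proof.
by move=> /(hpoly_derive i)[q [hq pq _]]; have [? _] := pq x; split.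
Qed.

Lemma hpoly_partial0 p i x : hpoly 0 p -> partial i p x = 0.
Proof.
move=> /(hpoly_derive i)[q [_ pq q0]].
by have [_ E] := pq x; rewrite -(q0 erefl x); exact: E.
Qed.

Lemma partialM d e p q i x : hpoly d p -> hpoly e q ->
  partial i (fun x => p x * q x) x = p x * partial i q x + q x * partial i p x.
Proof.
move=> /(hpoly_is_derive i x) dp /(hpoly_is_derive i x) dq.
by have [_] := is_derive_prod dp dq.
Qed.

Lemma partialD d e p q i x : hpoly d p -> hpoly e q ->
  partial i (fun x => p x + q x) x = partial i p x + partial i q x.
Proof.
move=> /(hpoly_is_derive i x) dp /(hpoly_is_derive i x) dq.
by have [_] := is_deriveD dp dq.
Qed.

Lemma partial_coordM d p i j x : hpoly d p ->
  partial i (fun x => (x ord0 j - c ord0 j) * p x) x =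
  (x ord0 j - c ord0 j) * partial i p x + (i == j)%:R * p x.
Proof.
move=> /(hpoly_is_derive i x) dp.
have [_ E] := is_derive_prod (is_derive_coord i j x) dp.
by rewrite [(i == j)%:R * _]mulrC -[RHS]E.
Qed.

(** Euler's identity for homogeneous functions; it produces the term [4 d] in [lap_sqM]. *)
Lemma euler d p x : hpoly d p ->
  \sum_(i < n) (x ord0 i - c ord0 i) * partial i p x = d%:R * p x.
Proof.
elim=> {d p} [b|d|d j p hp IH|d p q hp IHp hq IHq].
- rewrite mul0r big1// => i _; rewrite hpoly_partial0 ?mulr0//; exact: hpoly_cst.
- by rewrite mulr0 big1// => i _; have [_ ->] := partial_cst i (0 : R); rewrite mulr0.
- transitivity (\sum_(i < n) ((x ord0 j - c ord0 j) *
      ((x ord0 i - c ord0 i) * partial i p x) +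
      (i == j)%:R * ((x ord0 i - c ord0 i) * p x))).
    by apply: eq_bigr => i _; rewrite (partial_coordM _ _ _ hp); ring.
  rewrite big_split/= -mulr_sumr IH (bigD1 j)//= big1 ?addr0; last first.
    by move=> i ij; rewrite (negPf ij) mul0r.
  by rewrite eqxx/= -natr1; ring.
- rewrite mulrDr -IHp -IHq -big_split; apply: eq_bigr => i _.
  by rewrite (partialD _ _ hp hq) mulrDr.
Qed.

Definition lap p x := \sum_(i < n) partial i (partial i p) x.

Lemma hpoly_lap d p : hpoly d p -> hpoly d.-2 (lap p).
Proof. by move=> hp; apply: hpoly_sum => i; do 2 apply: hpoly_partial. Qed.

Lemma lap_low d p x : (d < 2)%N -> hpoly d p -> lap p x = 0.
Proof.
move=> d2 hp; rewrite /lap big1// => i _; apply: hpoly_partial0.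
by have := hpoly_partial i hp; case: d d2 {hp} => [|[]].
Qed.

Lemma lapD d e p q x : hpoly d p -> hpoly e q ->
  lap (fun x => p x + q x) x = lap p x + lap q x.
Proof.
move=> hp hq; rewrite /lap -big_split/=; apply: eq_bigr => i _.
rewrite -(partialD _ _ (hpoly_partial i hp) (hpoly_partial i hq)).
by congr (partial i _ x); apply/funext => y; rewrite (partialD _ _ hp hq).
Qed.

Lemma hpoly_partialZ d a p i x : hpoly d p ->
  partial i (fun x => a * p x) x = a * partial i p x.
Proof. by move=> /(hpoly_is_derive i x)[dp _]; have [] := partialZ a dp. Qed.

Lemma lapZ d a p x : hpoly d p -> lap (fun x => a * p x) x = a * lap p x.
Proof.
move=> hp; rewrite /lap mulr_sumr; apply: eq_bigr => i _.
rewrite -(hpoly_partialZ _ _ _ (hpoly_partial i hp)).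
by congr (partial i _ x); apply/funext => y; rewrite (hpoly_partialZ _ _ _ hp).
Qed.

Lemma partial_sq i x : partial i sq x = 2 * (x ord0 i - c ord0 i).
Proof.
have -> : sq = (fun x => \sum_(j < n) (x ord0 j - c ord0 j) *
    (x ord0 j - c ord0 j)).
  by apply/funext => y; apply: eq_bigr => j _; rewrite !mxE.
have : is_derive x (evec R i)
    (\sum_(j < n) (fun x : V => (x ord0 j - c ord0 j) * (x ord0 j - c ord0 j)))
    (\sum_(j < n) ((x ord0 j - c ord0 j) * (i == j)%:R +
                   (x ord0 j - c ord0 j) * (i == j)%:R)).
  by apply: is_derive_sum => j; apply: is_derive_prod; exact: is_derive_coord.
rewrite (_ : \sum_(j < n) _ = (fun x => \sum_(j < n) (x ord0 j - c ord0 j) *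
    (x ord0 j - c ord0 j))); last by apply/funext => y; rewrite fct_sumE.
move=> [_ E]; rewrite /partial E (bigD1 i)//= big1 ?addr0.
  by rewrite eqxx/=; ring.
by move=> j ji; rewrite (eq_sym i) (negPf ji) !mulr0 addr0.
Qed.

Lemma lap_sqM d p x : hpoly d p ->
  lap (fun x => sq x * p x) x = (2 * n%:R + 4 * d%:R) * p x + sq x * lap p x.
Proof.
move=> hp; have hX i : hpoly d (fun x => (x ord0 i - c ord0 i) * partial i p x).
  case: d hp => [|d] hp; last by apply: hpolyX; exact: (hpoly_partial i hp).
  by apply: hpoly_ext (hpoly0 0) => y; rewrite hpoly_partial0// mulr0.
transitivity (\sum_(i < n) (2 * p x + 4 * ((x ord0 i - c ord0 i) * partial i p x) +
    sq x * partial i (partial i p) x)).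
  apply: eq_bigr => i _.
  have -> : partial i (fun x => sq x * p x) = (fun x =>
      sq x * partial i p x + 2 * ((x ord0 i - c ord0 i) * p x)).
    by apply/funext => y; rewrite (partialM _ _ hpoly_sq hp) partial_sq; ring.
  have hq := hpoly_partial i hp; have hXp := hpolyX i hp.
  rewrite (partialD _ _ (hpolyM hpoly_sq hq) (hpolyZ 2 hXp)).
  rewrite (partialM _ _ hpoly_sq hq) partial_sq (hpoly_partialZ _ _ _ hXp).
  by rewrite (partial_coordM _ _ _ hp) eqxx/=; ring.
rewrite !big_split/= -!mulr_sumr (euler _ hp) sumr_const card_ord -mulr_natl.
rewrite /lap; ring.
Qed.

Hypothesis n0 : (0 < n)%N.

(* With [lambda' = lambda + 2n + 4d], the equation reads
   [lambda' u + |x|^2 lap u = q]; applying [lap] to the ansatz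
   [u = (q - |x|^2 w) / lambda'] shows that [w = lap u] solves the same problem
   in degree [d - 2]. *)
Lemma lap_sq_solve d q (l : R) : 0 <= l -> hpoly d q ->
  exists2 u, hpoly d u & forall x, l * u x + lap (fun x => sq x * u x) x = q x.
Proof.
elim/ltn_ind: d q l => d IH q l l0 hq.
pose l' := l + (2 * n%:R + 4 * d%:R).
have n0R : 0 < n%:R :> R by rewrite ltr0n.
have l'0 : l' != 0.
  by rewrite gt_eqF// /l'; have := ler0n R d; lra.
have [d2|d2] := ltnP d 2.
  exists (fun x => l'^-1 * q x) => [|x]; first exact: hpolyZ.
  rewrite (lap_sqM _ (hpolyZ _ hq)) (lapZ _ _ hq) (lap_low _ d2 hq) !mulr0 addr0.
  by rewrite -mulrDl -/l' mulrA divff// mul1r.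
have ->: d = (d.-2 + 2)%N by lia.
have dd : (d.-2 < d)%N by lia.
have l'ge0 : 0 <= l' by rewrite /l'; have := ler0n R d; lra.
have [w hw Hw] := IH _ dd _ l' l'ge0 (hpoly_lap hq).
have hsw : hpoly d (fun x => sq x * w x).
  by have := hpolyM hpoly_sq hw; rewrite (_ : (2 + d.-2)%N = d)//; lia.
have hu1 := hpolyD hq (hpolyZ (-1) hsw).
exists (fun x => l'^-1 * (q x + -1 * (sq x * w x))) => [|x].
  by have := hpolyZ l'^-1 hu1; rewrite (_ : (d.-2 + 2)%N = d)//; lia.
rewrite (lap_sqM _ (hpolyZ _ hu1)) (lapZ _ _ hu1) (lapD _ hq (hpolyZ (-1) hsw)).
rewrite (lapZ _ _ hsw).
have -> : lap q x + -1 * lap (fun x => sq x * w x) x = l' * w x.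
  by rewrite -Hw; ring.
rewrite [l'^-1 * (l' * _)]mulrA mulVf// mul1r addrA -mulrDl -/l' mulrA divff//.
by ring.
Qed.

Lemma hpoly_harmonic d p : hpoly d p -> (forall x, lap p x = 0) ->
  harmonic_on setT p.
Proof.
move=> hp p0 x _; split; last exact: p0.
move=> i; have hi := hpoly_partial i hp.
have [dp _] := hpoly_is_derive i x hp; split; first exact: dp.
split; first exact: hpoly_continuous hi _.
move=> j; have [dpi _] := hpoly_is_derive j x hi; split; first exact: dpi.
exact: hpoly_continuous (hpoly_partial j hi) _.
Qed.

(** If [lap (sq u) = lap p], then [p - sq u] is harmonic. On the sphere it differs from [p] by
    [r^2 u], a polynomial of degree smaller by two, and the induction supplies the harmonic function
    for this remainder. *)
Lemma dirichlet_hpoly d p (r : R) : hpoly d p ->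
  exists h, [/\ harmonic_on setT h, continuous h &
    forall x, esphere c r x -> h x = p x].
Proof.
elim/ltn_ind: d p => d IH p hp.
have [d2|d2] := ltnP d 2.
  exists p; split=> //; last exact: hpoly_continuous hp.
  by apply: (hpoly_harmonic hp) => x; exact: lap_low hp.
have [u hu Hu] := lap_sq_solve (lexx 0) (hpoly_lap hp).
have dd : (d.-2 < d)%N by lia.
have [h [hh ch hE]] := IH _ dd _ (hpolyZ (r ^+ 2) hu).
have hsu : hpoly d (fun x => sq x * u x).
  by have := hpolyM hpoly_sq hu; rewrite (_ : (2 + d.-2)%N = d)//; lia.
have hH := hpolyD hp (hpolyZ (-1) hsu).
exists (fun x => (p x + -1 * (sq x * u x)) + h x); split.
- apply: harmonicD; [exact: openT| |exact: hh].
  apply: hpoly_harmonic hH _ => x.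
  by rewrite (lapD _ hp (hpolyZ (-1) hsu)) (lapZ _ _ hsu) -Hu; ring.
- move=> x; apply: continuousD_at; last exact: ch.
  exact: hpoly_continuous hH _.
- move=> x xr; rewrite hE// /sq -sqr_enorm.
  by have -> : enorm (x - c) = r by []; ring.
Qed.

Inductive pol : (V -> R) -> Prop :=
| pol_hpoly d p : hpoly d p -> pol p
| polD p q : pol p -> pol q -> pol (fun x => p x + q x).

Lemma pol_ext p q : p =1 q -> pol p -> pol q.
Proof. by move=> /funext ->. Qed.

Lemma polM p q : pol p -> pol q -> pol (fun x => p x * q x).
Proof.
move=> + pq; elim=> {p} [d p hp|p p' _ IHp _ IHp']; last first.
  by apply: pol_ext (polD IHp IHp') => x; rewrite mulrDl.
elim: pq => {q} [e q hq|q q' _ IHq _ IHq'].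
  by apply: pol_hpoly (hpolyM hp hq).
by apply: pol_ext (polD IHq IHq') => x; rewrite mulrDr.
Qed.

Lemma pol_cst a : pol (fun=> a).
Proof. exact: pol_hpoly (hpoly_cst a). Qed.

Lemma polZ a p : pol p -> pol (fun x => a * p x).
Proof. by move=> pp; apply: polM => //; exact: pol_cst. Qed.

Lemma pol_sqr_dist y : pol (fun x => enorm (x - y) ^+ 2).
Proof.
have px i : pol (fun x => x ord0 i - y ord0 i).
  have H := pol_hpoly (hpolyX i (hpoly_cst 1)).
  apply: pol_ext (polD H (pol_cst (c ord0 i - y ord0 i))) => x; ring.
apply: (@pol_ext (fun x => \sum_(i <- index_enum 'I_n)
  (x ord0 i - y ord0 i) * (x ord0 i - y ord0 i))).
  by move=> x; rewrite sqr_enorm; apply: eq_bigr => i _; rewrite !mxE.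
elim: (index_enum _) => [|i l IH].
  by apply: pol_ext (pol_cst 0) => x; rewrite big_nil.
by apply: pol_ext (polD (polM (px i) (px i)) IH) => x; rewrite big_cons.
Qed.

Lemma pol_continuous p : pol p -> continuous p.
Proof.
elim=> {p} [d p|p q _ cp _ cq]; first exact: hpoly_continuous.
by move=> x; exact: (continuousD_at (cp x) (cq x)).
Qed.

Lemma dirichlet_pol p (r : R) : pol p ->
  exists h, [/\ harmonic_on setT h, continuous h &
    forall x, esphere c r x -> h x = p x].
Proof.
elim=> {p} [d p|p q _ [h [hh ch hp]] _ [k [hk ck kq]]].
  exact: dirichlet_hpoly.
exists (fun x => h x + k x); split; first exact: harmonicD openT hh hk.
  by move=> x; exact: (continuousD_at (ch x) (ck x)).
by move=> x xr; rewrite hp// kq.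
Qed.

End Polynomials.

(** * The Weierstrass approximation theorem on a compact set *)

Section Weierstrass.
Variables (R : realType) (n : nat) (c : 'rV[R]_n) (K : set 'rV[R]_n).
Local Notation V := 'rV[R]_n.
Hypothesis cK : compact K.
Implicit Types (p q f g : V -> R).

Definition pol_approx f := forall e : R, 0 < e ->
  exists2 p, pol c p & forall x, K x -> `|f x - p x| < e.

Lemma pol_bounded p : pol c p ->
  exists2 M : R, 0 < M & forall x, K x -> `|p x| <= M.
Proof.
move=> pp; have [K0|/set0P/negP/negPn/eqP->] := pselect (K !=set0); last by exists 1.
have cp : {within K, continuous (fun x => p x * p x)}.
  by apply: within_continuousT; exact: pol_continuous (polM pp pp).
have [y Ky ymax] := compact_maxP K0 cK cp.
exists (p y * p y + 1) => [|x /ymax H]; first by rewrite -expr2 ltr_wpDl ?sqr_ge0.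
by rewrite ler_norml; apply/andP; split; nra.
Qed.

(* The iteration [q <- q + (t^2 - q^2) / 2] increases to [|t|] on [-1, 1]. *)
Fixpoint abs_iter (p : V -> R) (k : nat) (x : V) : R :=
  if k is k'.+1 then
    abs_iter p k' x + (p x * p x - abs_iter p k' x * abs_iter p k' x) * 2^-1
  else 0.

Lemma pol_abs_iter p k : pol c p -> pol c (abs_iter p k).
Proof.
move=> pp; elim: k => [|k IH]; first exact: pol_cst.
have H := polD (polM pp pp) (polZ (-1) (polM IH IH)).
by apply: pol_ext (polD IH (polZ 2^-1 H)) => x /=; ring.
Qed.

(** The last inequality is the rate of convergence: after division by the absolute value of [p x],
    it bounds the error by [2 / k] uniformly in [x]. It is inductive because, with [a] this absolute
    value, a step multiplies the error by at most [1 - a / 2], and [(1 - a / 2) (1 + (k + 1) a / 2)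
    <= 1 + k a / 2]. *)
Lemma abs_iterP p k x : `|p x| <= 1 ->
  0 <= abs_iter p k x <= `|p x| /\
  (`|p x| - abs_iter p k x) * (1 + k%:R * `|p x| / 2) <= `|p x|.
Proof.
move=> px1; have p2 : p x * p x = `|p x| * `|p x|.
  by rewrite -!expr2 real_normK// num_real.
have a0 := normr_ge0 (p x).
elim: k => [|k [/andP[q0 qa] H]] /=; first by rewrite lexx a0; split=> //; lra.
rewrite p2; move: px1 a0 q0 qa H; set a := `|p x|; set q := abs_iter p k x.
move=> a1 a0 q0 qa H.
have k0 : 0 <= k%:R :> R by [].
split; first by apply/andP; split; nra.
have e0 : 0 <= a - q by lra.
have e1 : a - (q + (a * a - q * q) / 2) <= (a - q) * (1 - a / 2) by nra.
have k1 : 0 <= 1 + k.+1%:R * a / 2.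
  by rewrite addr_ge0// mulr_ge0// mulr_ge0.
apply: le_trans (ler_wpM2r k1 e1) _; apply: le_trans H.
rewrite -[leLHS]mulrA; apply: ler_wpM2l => //.
rewrite -natr1; set m := k%:R in k0 *.
have : 0 <= m * (a * a) by rewrite mulr_ge0// mulr_ge0.
have : 0 <= a * a by rewrite mulr_ge0.
nra.
Qed.

Lemma pol_approx_abs f : pol_approx f -> pol_approx (fun x => `|f x|).
Proof.
move=> fa e e0; have e20 : 0 < e / 2 by rewrite divr_gt0.
have [p pp fp] := fa _ e20; have [M M0 pM] := pol_bounded pp.
pose t x := M^-1 * p x.
have pt : pol c t by exact: polZ.
have t1 x : K x -> `|t x| <= 1.
  move=> /pM H; rewrite normrM gtr0_norm ?invr_gt0//.
  by rewrite mulrC ler_pdivrMr// mul1r.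
pose k := (Num.truncn (4 * M / e)).+1.
exists (fun x => M * abs_iter t k x) => [|x Kx].
  by apply: polZ; exact: pol_abs_iter.
have [/andP[q0 qa] H] := abs_iterP k (t1 x Kx).
have kM : 4 * M / e < k%:R by rewrite /k truncnS_gt.
have pE : `|p x| = M * `|t x|.
  by rewrite normrM gtr0_norm ?invr_gt0// mulrA divff ?gt_eqF// mul1r.
have tq : M * (`|t x| - abs_iter t k x) < e / 2.
  have [tx|t0] := eqVneq `|t x| 0.
    have -> : abs_iter t k x = 0 by apply: le_anti; rewrite q0 -tx qa.
    by rewrite tx subrr mulr0.
  have tx0 : 0 < `|t x| by rewrite lt_def t0 normr_ge0.
  have H1 : (`|t x| - abs_iter t k x) * (k%:R / 2) <= 1.
    rewrite -(ler_pM2r tx0) mul1r; move: H qa.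
    set a := `|t x|; set q := abs_iter _ _ _ => *; nra.
  have kM' : 4 * M < k%:R * e by rewrite -ltr_pdivrMr.
  set d := `|t x| - abs_iter t k x in H1 *.
  have d0 : 0 <= d by rewrite subr_ge0.
  have k0 : 0 < k%:R :> R by [].
  have : d * (4 * M) <= d * (k%:R * e) by apply: ler_wpM2l => //; exact: ltW.
  have : d * (k%:R * e) <= 2 * e by nra.
  have [->|dn] := eqVneq d 0; first by rewrite mulr0.
  have : d * (4 * M) < d * (k%:R * e) by rewrite ltr_pM2l// lt_def dn.
  nra.
have := fp x Kx; have := ler_dist_dist (f x) (p x).
rewrite pE => H1 H2.
have H3 := le_lt_trans H1 H2.
rewrite (_ : `|f x| - _ = (`|f x| - M * `|t x|) + M * (`|t x| - abs_iter t k x)); last by ring.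
apply: le_lt_trans (ler_normD _ _) _.
rewrite [X in _ + X]ger0_norm; last by rewrite mulr_ge0 ?subr_ge0// ltW.
by move: H3 tq; lra.
Qed.

Lemma pol_approx_pol p : pol c p -> pol_approx p.
Proof. by move=> pp e e0; exists p => // x _; rewrite subrr normr0. Qed.

Lemma pol_approxD f g : pol_approx f -> pol_approx g ->
  pol_approx (fun x => f x + g x).
Proof.
move=> fa ga e e0; have e20 : 0 < e / 2 by rewrite divr_gt0.
have [p pp fp] := fa _ e20; have [q pq gq] := ga _ e20.
exists (fun x => p x + q x) => [|x Kx]; first exact: polD.
by move: (fp x Kx) (gq x Kx); rewrite !ltr_norml; lra.
Qed.

Lemma pol_approxZ a f : pol_approx f -> pol_approx (fun x => a * f x).
Proof.
move=> fa e e0; have a1 : 0 < `|a| + 1 by rewrite ltr_wpDl.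
have ea : 0 < e / (`|a| + 1) by rewrite divr_gt0.
have [p pp fp] := fa _ ea; exists (fun x => a * p x) => [|x Kx]; first exact: polZ.
have := fp x Kx; rewrite ltr_pdivlMr// -mulrBr normrM; apply: le_lt_trans.
by rewrite mulrC ler_wpM2l// lerDl.
Qed.

Lemma pol_approx_min f g : pol_approx f -> pol_approx g ->
  pol_approx (fun x => Num.min (f x) (g x)).
Proof.
move=> fa ga; have H := pol_approxD (pol_approxZ 2^-1 (pol_approxD fa ga))
  (pol_approxZ (- 2^-1) (pol_approx_abs (pol_approxD fa (pol_approxZ (-1) ga)))).
move=> e e0; have [p pp Hp] := H e e0; exists p => // x Kx.
rewrite (_ : Num.min _ _ = 2^-1 * (f x + g x) + - 2^-1 * `|f x + -1 * g x|).
  exact: Hp.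
rewrite mulN1r; have [fg|fg] := leP (f x) (g x).
  by rewrite ler0_norm ?subr_le0//; field.
by rewrite gtr0_norm ?subr_gt0//; field.
Qed.

(** About each point a paraboloid lies above [f] on all of [K] and close to [f] near the point. A
    finite minimum of paraboloids is then close to [f] on [K], and minima are approximated through
    absolute values. *)
Lemma weierstrass f : {within K, continuous f} -> pol_approx f.
Proof.
move=> cf e e0.
have [K0|/set0P/negP/negPn/eqP KE] := pselect (K !=set0); last first.
  by exists (fun=> 0) => [|x]; [exact: pol_cst|rewrite KE].
have [a Ka amax] := compact_maxP K0 cK cf.
have [b Kb bmin] := compact_minP K0 cK cf.
pose P (A : set V) := exists g, [/\ pol_approx g, forall x, K x -> f x <= g x &
  forall x, K x -> A x -> g x <= f x + e / 2].
have [G [_ KG [g [ga fg gf]]]] : exists G, [/\ open G, K `<=` G & P G].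
  apply: compact_ind => //.
  - move=> A B AB [g [ga fg gf]]; exists g; split=> // x Kx /AB; exact: gf.
  - by exists (fun=> f a); split=> //; exact/pol_approx_pol/pol_cst.
  - move=> A B [g [ga fg gf]] [h [ha fh hf]]; exists (fun x => Num.min (g x) (h x)).
    split=> [|x Kx|x Kx [Ax|Bx]]; first exact: pol_approx_min.
    + by rewrite le_min fg//= fh.
    + by rewrite ge_min gf.
    + by rewrite ge_min hf ?orbT.
  - move=> x Kx; have e40 : 0 < e / 8 by rewrite divr_gt0.
    move/within_continuousP : cf => /(_ x Kx _ e40)[d d0 xd].
    (* At distance [d] from [x] the paraboloid has already risen by more than the oscillation of [f]
       on [K]. *)
    pose C := (f a - f b + 1) / d ^+ 2.
    have d20 : 0 < d ^+ 2 by rewrite exprn_gt0.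
    have C0 : 0 < C.
      by rewrite divr_gt0//; have := bmin a Ka; lra.
    exists (Num.min d (Num.min 1 (e / 8 / C))).
      by rewrite !lt_min d0 ltr01 divr_gt0.
    exists (fun y => (f x + e / 8) + C * enorm (y - x) ^+ 2); split.
    + apply: pol_approx_pol; apply: polD; first exact: pol_cst.
      by apply: polZ; exact: pol_sqr_dist.
    + move=> y Ky; have [yx|yx] := ltP (enorm (y - x)) d.
        have : 0 <= C * enorm (y - x) ^+ 2 by rewrite mulr_ge0 ?sqr_ge0// ltW.
        by have := xd y Ky yx; rewrite ltr_norml => /andP[]; lra.
      have : C * d ^+ 2 <= C * enorm (y - x) ^+ 2.
        by rewrite ler_pM2l// lerXn2r// ?nnegrE ?enorm_ge0// ltW.
      rewrite divfK ?gt_eqF//; have := amax y Ky; have := bmin x Kx; lra.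
    + move=> y Ky; rewrite /eball /= !lt_min => /and3P[yd y1 yC].
      have : C * enorm (y - x) ^+ 2 <= e / 8.
        rewrite ltr_pdivlMr// mulrC in yC; apply: le_trans (ltW yC).
        by have := enorm_ge0 (y - x); rewrite ler_pM2l//; nra.
      have := xd y Ky yd; rewrite ltr_norml => /andP[]; lra.
have e20 : 0 < e / 2 by rewrite divr_gt0.
have [p pp gp] := ga _ e20; exists p => // x Kx.
have := gp x Kx; have := fg x Kx; have := gf x Kx (KG x Kx).
by rewrite !ltr_norml; lra.
Qed.

End Weierstrass.

(** * Sums of superharmonic functions *)

Section Sum.
Variables (R : realType) (n : nat).
Local Notation V := 'rV[R]_n.
Hypothesis n0 : (0 < n)%N.

Lemma dirichlet_approx (c : V) (r : R) (f : V -> R) :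
  {within esphere c r, continuous f} -> forall e : R, 0 < e ->
  exists h, [/\ harmonic_on setT h, continuous h &
    forall x, esphere c r x -> `|f x - h x| < e].
Proof.
move=> cf e e0.
have [p pp fp] := weierstrass c (@compact_esphere _ _ c r) cf e0.
have [h [hh ch hp]] := dirichlet_pol n0 r pp.
by exists h; split=> // x xr; rewrite hp//; exact: fp.
Qed.

(** The boundary inequality [h <= s + t] bounds neither summand. A harmonic [k] within [e / 2] of
    [s] on the sphere splits it: [k - e / 2] is tested against [s], and [h - k - e / 2] against
    [t]. *)
Lemma csh_add (W : set V) (s t : V -> R) : csh W s -> csh W t ->
  csh W (fun x => s x + t x).
Proof.
move=> [oW cs ss] [_ ct st]; split=> // [x Wx|c r r0 cr h ch hh hst y cy].
  exact: (continuousD_at (cs x Wx) (ct x Wx)).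
apply/ler_addgt0Pr => e e0.
have e20 : 0 < e / 2 by rewrite divr_gt0.
have csr : {within esphere c r, continuous s}.
  by apply: within_continuous_in cs _ => z /esphere_cball/cr.
have [k [hk ck sk]] := dirichlet_approx csr e20.
have hkc (a : R) : harmonic_on (eball c r) (fun x => k x + a).
  apply: harmonicD; first exact: open_eball.
    exact: harmonic_sub hk.
  exact: harmonic_cst.
have ckc (a : R) : {within cball c r, continuous (fun x => k x + a)}.
  by apply: within_continuousT => x; apply: continuousD_at; [exact: ck|exact: cst_continuous].
have ks : k y + - (e / 2) <= s y.
  apply: (ss c r r0 cr (fun x => k x + - (e / 2))); [exact: ckc|exact: hkc| |exact: cy].
  by move=> z /sk; rewrite ltr_norml => /andP[]; lra.
have : h y - (k y + e / 2) <= t y.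
  apply: (st c r r0 cr (fun x => h x - (k x + e / 2))).
  - by apply: within_continuousB; [exact: ch|exact: ckc].
  - apply: harmonicD; [exact: open_eball|exact: hh|].
    by apply: harmonicN; [exact: open_eball|exact: hkc].
  - by move=> z zr; have := hst z zr; have := sk z zr; rewrite ltr_norml => /andP[]; lra.
  - exact: cy.
move: ks; lra.
Qed.

End Sum.

(** * Approximation of superharmonic functions *)

Section Separable.
Variables (R : realType) (n : nat).
Local Notation V := 'rV[R]_n.
Implicit Types (x y z c : V).

Lemma is_derive_translate (f : R -> R) (a t d : R) :
  is_derive (t + a) 1 f d -> is_derive t 1 (fun u => f (u + a)) d.
Proof.
have E : (fun h : R => h^-1 *: (((fun u => f (u + a)) \o shift t) (h *: 1) - f (t + a)))
  = (fun h : R => h^-1 *: ((f \o shift (t + a)) (h *: 1) - f (t + a))).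
  by apply/funext => h /=; rewrite addrA.
by move=> [fd fE]; split; rewrite /derivable /derive E.
Qed.

Lemma line2_separable (f f1 f2 : 'I_n -> R -> R) x i :
  (forall i (t : R), is_derive t 1 (f i) (f1 i t)) ->
  (forall i (t : R), is_derive t 1 (f1 i) (f2 i t)) ->
  line2 (fun y => \sum_j f j (y ord0 j)) x i (f2 i (x ord0 i)).
Proof.
move=> ff1 f12; exists (fun t => f1 i (t + x ord0 i)); last first.
  by apply: is_derive_translate; rewrite add0r.
exists 1 => // t _.
rewrite (_ : (fun _ => _) = (fun u => f i (u + x ord0 i)) +
    cst (\sum_(j | j != i) f j (x ord0 j))); last first.
  apply/funext => u; rewrite (bigD1 i)//=; congr (_ + _).
    by rewrite !mxE !eqxx mulr1 addrC.
  by apply: eq_bigr => j ji; rewrite !mxE (negPf ji) andbF mulr0 addr0.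
by rewrite -[f1 i _]addr0; apply: is_deriveD; exact: is_derive_translate.
Qed.

Lemma separable_continuous (f f1 : 'I_n -> R -> R) :
  (forall i (t : R), is_derive t 1 (f i) (f1 i t)) ->
  continuous (fun y : V => \sum_j f j (y ord0 j)).
Proof.
move=> ff1 y; have cf i : {for y, continuous (fun y : V => f i (y ord0 i))}.
  have [/derivable1_diffP/differentiable_continuous cfi _] := ff1 i (y ord0 i).
  apply: (@continuous_comp _ _ _ (fun y : V => y ord0 i) (f i)) => //.
  exact: coord_continuous.
elim: (index_enum _) => [|i l IH].
  rewrite (_ : (fun _ => _) = (fun=> 0)); first exact: cst_continuous.
  by apply/funext => z; rewrite big_nil.
rewrite (_ : (fun _ => _) =
  (fun z : V => f i (z ord0 i) + \sum_(j <- l) f j (z ord0 j))).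
  exact: (continuousD_at (cf i) IH).
by apply/funext => z; rewrite big_cons.
Qed.

Lemma csh_separable (W : set V) (f f1 f2 : 'I_n -> R -> R) : open W ->
  (forall i (t : R), is_derive t 1 (f i) (f1 i t)) ->
  (forall i (t : R), is_derive t 1 (f1 i) (f2 i t)) ->
  (forall y, W y -> \sum_i f2 i (y ord0 i) < 0) ->
  csh W (fun y => \sum_i f i (y ord0 i)).
Proof.
move=> oW ff1 f12 f20; apply: (@csh_strict _ _ _ _ (fun i y => f2 i (y ord0 i))) => //.
  by move=> y _; exact: (separable_continuous ff1).
by move=> y _ i; exact: line2_separable.
Qed.

Hypothesis n0 : (0 < n)%N.

Lemma csh_quad (W : set V) c (a : R) : open W -> 0 < a ->
  csh W (fun y => - (a * enorm (y - c) ^+ 2)).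
Proof.
move=> oW a0; apply: (@csh_ext _ _ _
  (fun y : V => \sum_i - (a * (y ord0 i - c ord0 i) ^+ 2))).
  move=> y _; rewrite sqr_enorm /dot mulr_sumr -sumrN; apply: eq_bigr => i _.
  by rewrite !mxE expr2.
apply: (@csh_separable _ (fun i t => - (a * (t - c ord0 i) ^+ 2))
  (fun i t => - (a * (2 * (t - c ord0 i)))) (fun i t => - (a * 2))) => //.
- by move=> i t; apply: is_derive_eq; rewrite /GRing.scale/=; ring.
- by move=> i t; apply: is_derive_eq; rewrite /GRing.scale/=; ring.
- move=> y _; rewrite sumr_const card_ord -mulr_natl.
  have : 0 < n%:R :> R by rewrite ltr0n.
  by move=> ?; have := mulr_gt0 a0 (ltr0Sn R 1); nra.
Qed.

(** The maximum principle. As [csh_strict] asks for a strictly negative Laplacian, the test is made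
    against [a + e - e |y - c|^2 / r^2], which equals [a] on the sphere and is at most [a + e]
    inside. *)
Lemma csh_cst (W : set V) (a : R) : open W -> csh W (fun=> a).
Proof.
move=> oW; split=> // [x _|c r r0 cr h ch hh hs y cy]; first exact: cst_continuous.
apply/ler_addgt0Pr => e e0.
have r20 : 0 < r ^+ 2 by rewrite exprn_gt0.
have er : 0 < e / r ^+ 2 by rewrite divr_gt0.
have [_ _ H] := csh_addcst (a + e) (csh_quad c openT er).
apply: le_trans (H c r r0 _ h ch hh _ y cy) _ => //.
  move=> z zr; have -> : enorm (z - c) = r by exact: zr.
  by rewrite divfK ?gt_eqF//; have := hs z zr; lra.
have := mulr_ge0 (ltW er) (sqr_ge0 (enorm (y - c))); lra.
Qed.

End Separable.

(** * Infima and Lipschitz regularization *)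

Section InfLipschitz.
Variables (R : realType) (n : nat).
Local Notation V := 'rV[R]_n.

Lemma inf_lb_le (S : set R) (x b : R) : (forall y, S y -> b <= y) -> S x -> inf S <= x.
Proof. by move=> Sb Sx; apply: ge_inf => //; exists b => y /Sb. Qed.

Lemma le_inf_lb (S : set R) (b : R) : S !=set0 -> (forall y, S y -> b <= y) -> b <= inf S.
Proof. by move=> S0 Sb; apply: lb_le_inf => // y /Sb. Qed.

Lemma inf_approx (S : set R) (e b : R) : S !=set0 -> (forall y, S y -> b <= y) ->
  0 < e -> exists2 x, S x & x < inf S + e.
Proof.
move=> S0 Sb e0; apply: inf_adherent => //; split=> //; by exists b => y /Sb.
Qed.

(** The inf-convolution of [F] with a cone of slope [L]. For [F = 0] and [L = 1] it is the distance
    to [Q]. *)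
Definition infconv (Q : set V) (F : V -> R) (L : R) (y : V) : R :=
  inf [set F u + L * enorm (u - y) | u in Q].

Lemma infconv_lip (Q : set V) (F : V -> R) (L b : R) : 0 <= L -> Q !=set0 ->
  (forall u, Q u -> b <= F u) ->
  forall x y, infconv Q F L x - infconv Q F L y <= L * enorm (x - y).
Proof.
move=> L0 [u0 Qu0] Fb x y; rewrite lerBlDl.
have lb z v : [set F u + L * enorm (u - z) | u in Q] v -> b <= v.
  by move=> [u Qu <-]; rewrite -[b]addr0 lerD ?Fb// mulr_ge0 ?enorm_ge0.
apply/ler_addgt0Pr => e e0.
have ne : [set F u + L * enorm (u - y) | u in Q] !=set0.
  by exists (F u0 + L * enorm (u0 - y)); exists u0.
have [_ [u Qu <-] Hu] := inf_approx ne (@lb y) e0.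
have : infconv Q F L x <= F u + L * enorm (u - x).
  by apply: (inf_lb_le (@lb x)); exists u.
have : L * enorm (u - x) <= L * enorm (u - y) + L * enorm (x - y).
  by rewrite -mulrDr ler_wpM2l// (enormC x); exact: enorm_sub.
rewrite /infconv; lra.
Qed.

End InfLipschitz.

(** * Increasing approximation by Lipschitz superharmonic functions *)

Section Approximation.
Variables (R : realType) (n : nat).
Local Notation V := 'rV[R]_n.
Hypothesis n0 : (0 < n)%N.

(** The approximants are inf-convolutions of the truncations [min (f, k)] with steepening cones,
    that is, infima of translates of [f] plus constants, capped by [k]. The translates must not
    leave [U]: the slope [(k + b) / rho] makes every shift of length at least [rho] cost so much
    that it does not beat the cap [k]. *)
Lemma superharmonic_approx (U K : set V) (f : V -> \bar R) : compact K ->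
  K `<=` U -> superharmonic_on U f ->
  exists (W : set V) (g : nat -> V -> R) (b : R), [/\ K `<=` W,
    forall k, csh W (g k),
    forall k x, W x -> b <= g k x,
    forall x, W x -> {homo (fun k => g k x) : k l / (k <= l)%N >-> k <= l} &
    forall x, W x -> ((forall k, ((g k x)%:E <= f x)%E) /\
      forall a : R, (a%:E < f x)%E -> exists k, a < g k x)].
Proof.
move=> cK KU [oU [fNy [flsc [_ fcmp]]]].
have [->|/set0P[x0 Kx0]] := eqVneq K set0.
  exists set0, (fun _ _ => 0), 0; split=> // k.
  by apply: csh_cst => //; exact: open0.
have lsc x (a : R) : U x -> (a%:E < f x)%E ->
    exists2 d : R, 0 < d & forall y, enorm (y - x) < d -> U y /\ (a%:E < f y)%E.
  move=> Ux afx; move/open_eballP : oU => /(_ x Ux)[d d0 xd].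
  have /nbhs_eballP[d' d'0 xd'] := flsc x Ux a afx.
  exists (Num.min d d') => [|y]; first by rewrite lt_min d0.
  by rewrite lt_min => /andP[yd yd']; split; [exact: xd|exact: xd'].
pose P (A : set V) := exists d b : R, [/\ 0 < d, 0 <= b & forall x, A x ->
  forall y, enorm (y - x) < d -> U y /\ ((- b)%:E < f y)%E].
have [G [_ KG [d [b [d0 b0 Hd]]]]] : exists G, [/\ open G, K `<=` G & P G].
  apply: compact_ind => //.
  - move=> A B AB [d [b [d0 b0 H]]]; exists d, b; split=> // x /AB; exact: H.
  - by exists 1, 0.
  - move=> A B [d [b [d0 b0 H]]] [d' [b' [d'0 b'0 H']]].
    exists (Num.min d d'), (Num.max b b'); split.
    + by rewrite lt_min d0.
    + by rewrite le_max b0.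
    + move=> x [Ax|Bx] y; rewrite lt_min => /andP[yd yd'].
        have [Uy fy] := H x Ax y yd; split=> //.
        by apply: le_lt_trans fy; rewrite lee_fin lerN2 le_max lexx.
      have [Uy fy] := H' x Bx y yd'; split=> //.
      by apply: le_lt_trans fy; rewrite lee_fin lerN2 le_max lexx orbT.
  - move=> x /KU Ux.
    have [a [a0 fa]] : exists a : R, 0 <= a /\ ((- a)%:E < f x)%E.
      have := fNy x Ux; case: (f x) => [t| |//] _.
        exists (`|t| + 1); split; first by rewrite addr_ge0.
        by rewrite lte_fin; have := ler_norm (- t); rewrite normrN; lra.
      by exists 0; rewrite lexx ltry.
    have [d d0 Hd] := lsc x _ Ux fa.
    exists (d / 2); first by rewrite divr_gt0.
    exists (d / 2), a; split=> //; first by rewrite divr_gt0.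
    move=> y yx z zy; apply: Hd; have := enorm_sub z y x.
    by move: yx; rewrite /eball /=; lra.
(* [W] will be the [rho]-neighbourhood of [K] and [Q] the [d]-neighbourhood, so that a shift of [W]
   by at most [rho] stays in [Q]. *)
pose rho := d / 3.
have rho0 : 0 < rho by rewrite divr_gt0.
pose W := [set y | exists2 x, K x & enorm (y - x) < rho].
pose Q := [set y | exists2 x, K x & enorm (y - x) < d].
have Qf u : Q u -> U u /\ ((- b)%:E < f u)%E 
  by move=> [x Kx]; exact: (Hd x (KG x Kx)).
have oW : open W.
  apply/open_eballP => y [x Kx yx]; exists (rho - enorm (y - x)).
    by rewrite subr_gt0.
  move=> z; rewrite /eball /= => zy; exists x => //.
  by have := enorm_sub z y x; lra.
have KW : K `<=` W by move=> x Kx; exists x => //; rewrite subrr enorm0.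
have WQ y z : W y -> enorm (z - y) <= rho -> Q z.
  move=> [x Kx yx] zy; exists x => //; have := enorm_sub z y x.
  by move: rho0; rewrite /rho in yx zy *; lra.
(* On [Q] the truncation lies between [- b] and [k], so [fine] loses nothing there. *)
pose F (k : nat) u : R := fine (mine (f u) k%:R%:E).
have FE k u : Q u -> (F k u)%:E = mine (f u) k%:R%:E.
  move=> /Qf[_ fb]; rewrite /F; case: (f u) fb => [t| |//] _.
    by rewrite -EFin_min.
  by rewrite minye.
have Fb k u : Q u -> - b <= F k u.
  move=> Qu; rewrite -lee_fin FE// le_min; have [_ /ltW->] := Qf u Qu.
  by rewrite lee_fin/= (@le_trans _ _ 0)// oppr_le0.
have Fk k u : Q u -> F k u <= k%:R.
  by move=> Qu; rewrite -lee_fin FE// ge_min lexx orbT.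
have Ff k u : Q u -> ((F k u)%:E <= f u)%E.
  by move=> Qu; rewrite FE// ge_min lexx.
have Fmono k l u : (k <= l)%N -> Q u -> F k u <= F l u.
  move=> kl Qu; rewrite -lee_fin !FE//.
  by rewrite le_min !ge_min lexx/= lee_fin ler_nat kl orbT.
pose L (k : nat) := (k%:R + b) / rho.
have L0 k : 0 <= L k by rewrite divr_ge0 ?addr_ge0// ltW.
pose g k := infconv Q (F k) (L k).
have Q0 : Q !=set0 by exists x0; exists x0; rewrite // subrr enorm0.
have lb k z v : [set F k u + L k * enorm (u - z) | u in Q] v -> - b <= v.
  by move=> [u Qu <-]; rewrite -[- b]addr0 lerD ?Fb// mulr_ge0 ?enorm_ge0.
have ne k z : [set F k u + L k * enorm (u - z) | u in Q] !=set0.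
  by have [u Qu] := Q0; exists (F k u + L k * enorm (u - z)); exists u.
have WQ0 y : W y -> Q y by move=> Wy; apply: (WQ y) => //; rewrite subrr enorm0 ltW.
have gle k y u : Q u -> g k y <= F k u + L k * enorm (u - y).
  by move=> Qu; apply: (inf_lb_le (@lb k y)); exists u.
have gF k y : W y -> g k y <= F k y.
  by move=> Wy; have := gle k y y (WQ0 y Wy); rewrite subrr enorm0 mulr0 addr0.
have far k y u : Q u -> rho <= enorm (u - y) -> k%:R <= F k u + L k * enorm (u - y).
  move=> Qu yu; have := Fb k u Qu.
  have : L k * rho <= L k * enorm (u - y) by rewrite ler_wpM2l.
  by rewrite /L divfK ?gt_eqF//; lra.
exists W, g, (- b); split=> //.
- move=> k; split=> //.
    by move=> x _; apply: lip_continuous; exact: (infconv_lip (L0 k) Q0 (Fb k)).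
  move=> c r r0 cr h ch hh hg y cy; apply: le_inf_lb; first exact: ne.
  move=> _ [u Qu <-].
  (* The maximum principle disposes of the cap [k] and, by [far], of all long shifts. For a short
     shift, the translate of [h] is tested against [f] on the translated ball. *)
  have hk : h y <= k%:R.
    have [_ _ H] := csh_cst n0 k%:R oW.
    apply: (H c r r0 cr h ch hh _ y cy) => z zr; apply: le_trans (hg z zr) _.
    have Wz : W z by exact/cr/esphere_cball.
    exact: le_trans (gF k z Wz) (Fk k z (WQ0 z Wz)).
  have Wy : W y by exact/cr/eball_cball.
  have [yu|uy] := leP rho (enorm (u - y)); first exact: le_trans hk (far _ _ _ Qu yu).
  have [z uE zr] : exists2 z : V, u = y + z & enorm z < rho.
    by exists (u - y) => //; rewrite addrC subrK.
  rewrite -lerBlDr -lee_fin FE// le_min; apply/andP; split; last first.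
    by rewrite lee_fin; have := mulr_ge0 (L0 k) (enorm_ge0 (u - y)); lra.
  have uyz : u - y = z by rewrite uE addrC addKr.
  rewrite uyz.
  have sub w : cball (c + z) r w -> W (w - z).
    by move=> wc; apply: cr; rewrite /cball /= addrAC -addrA -opprD.
  have subQ w : cball (c + z) r w -> Q w.
    move=> /sub Ww; apply: (WQ _ _ Ww); rewrite opprB addrC subrK; exact: ltW.
  suff : ((h (y + z - z)%R - L k * enorm z)%:E <= f (y + z)%R)%E.
    by rewrite addrK -uE.
  apply: (fcmp (c + z) r r0 _ (fun w => h (w - z) - L k * enorm z)).
  + by move=> w /subQ/Qf[].
  + apply: within_continuousB; last by apply: within_continuousT => ?; exact: cst_continuous.
    apply/within_continuousP => w wc e e0.
    have wc' : cball c r (w - z) by rewrite /cball /= addrAC -addrA -opprD.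
    move/within_continuousP : ch => /(_ _ wc' e e0)[d' d'0 H].
    exists d' => // v vc vw; apply: H.
      by rewrite /cball /= addrAC -addrA -opprD.
    by rewrite opprD addrACA subrr addr0.
  + apply: harmonicD; [exact: open_eball| |exact: harmonic_cst].
    have := @harmonic_translate _ _ _ _ (- z) hh.
    by apply: harmonic_sub => w; rewrite /eball /= => wc; rewrite addrAC -addrA -opprD.
  + move=> w wc; have wc' : cball (c + z) r w by exact: esphere_cball.
    have Qw := subQ w wc'.
    apply: le_trans (Ff k w Qw); rewrite lee_fin lerBlDr.
    apply: le_trans (hg (w - z) _) _.
      by rewrite /esphere /= addrAC -addrA -opprD.
    apply: le_trans (gle k (w - z) w Qw) _.
    by rewrite opprB addrCA subrr addr0.
  + by rewrite /eball /= opprD addrACA subrr addr0.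
- by move=> k x Wx; apply: le_inf_lb; [exact: ne|exact: lb].
- move=> x Wx k l kl; apply: le_inf_lb; first exact: ne.
  move=> _ [u Qu <-]; apply: le_trans (gle k x u Qu) _; apply: lerD; first exact: Fmono.
  apply: ler_wpM2r; first exact: enorm_ge0.
  by rewrite /L ler_pM2r ?invr_gt0// lerD2r ler_nat.
- move=> x Wx; split=> [k|a ax].
    by apply: le_trans (Ff k x (WQ0 x Wx)); rewrite lee_fin gF.
  have [Ux _] := Qf x (WQ0 x Wx).
  have [a' aa' a'x] : exists2 a' : R, a < a' & (a'%:E < f x)%E.
    case: (f x) ax => [t| |//].
      rewrite lte_fin => at1; exists ((a + t) / 2); rewrite ?lte_fin; lra.
    by move=> _; exists (a + 1); rewrite ?ltry; lra.
  have [e e0 He] := lsc x a' Ux a'x.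
  (* Within distance [e] of [x] both [f] and the cap exceed [a']; beyond it, the cone alone lifts
     the lower bound [- b] above [a']. *)
  pose m := Num.max a' ((a' + b) * rho / e).
  pose k := (Num.truncn m).+1.
  have mk : m < k%:R by rewrite /k truncnS_gt.
  have a'k : a' < k%:R by apply: le_lt_trans mk; rewrite /m le_max lexx.
  have ek : (a' + b) * rho / e < k%:R.
    by apply: le_lt_trans mk; rewrite /m le_max lexx orbT.
  exists k; apply: (lt_le_trans aa'); apply: le_inf_lb; first exact: ne.
  move=> _ [u Qu <-]; have [ue|ue] := ltP (enorm (u - x)) e.
    have [_ a'u] := He u ue.
    have : a' <= F k u by rewrite -lee_fin FE// le_min (ltW a'u) lee_fin ltW.
    by have := mulr_ge0 (L0 k) (enorm_ge0 (u - x)); lra.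
  have := Fb k u Qu.
  have : L k * e <= L k * enorm (u - x) by rewrite ler_wpM2l.
  have : a' + b <= L k * e.
    rewrite /L mulrAC ler_pdivlMr// -ler_pdivrMr//; lra.
  lra.
Qed.

End Approximation.

(** * Extension of superharmonic functions to domains *)

Section Components.
Variables (R : realType) (n : nat).
Local Notation V := 'rV[R]_n.
Implicit Types (W : set V) (x y v : V).

Lemma line_continuous x v : continuous (fun t : R => x + t *: v).
Proof.
move=> t; apply: (@continuousD _ _ _ (fun=> x) (fun t : R => t *: v)).
  exact: cst_continuous.
exact: scalel_continuous.
Qed.

Lemma component_line W x v (I : set R) (s t : R) : is_interval I -> I s -> I t ->
  (forall u, I u -> W (x + u *: v)) ->
  connected_component W (x + s *: v) (x + t *: v).
Proof.
move=> /connected_intervalP cI Is It IW.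
have cL : connected ((fun u : R => x + u *: v) @` I).
  apply: connected_continuous_connected => //.
  by apply: continuous_subspaceT; exact: line_continuous.
apply: (connected_component_max _ _ cL); first by exists s.
  by move=> _ [u /IW Wu <-].
by exists t.
Qed.

Lemma component_eball W c (r : R) y : eball c r y -> eball c r `<=` W ->
  connected_component W c y.
Proof.
move=> yc cW; have r0 : 0 < r by apply: le_lt_trans yc; exact: enorm_ge0.
have := @component_line W c (y - c) `[0, 1]%classic 0 1.
rewrite scale0r addr0 scale1r [c + _]addrC subrK; apply.
- exact: interval_is_interval.
- by rewrite /= in_itv/= lexx ler01.
- by rewrite /= in_itv/= lexx ler01.
- move=> u; rewrite /= in_itv/= => /andP[u0 u1]; apply: cW.
  rewrite /eball /= addrC addKr enormZ ger0_norm//.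
  by apply: le_lt_trans yc; rewrite ler_piMl ?enorm_ge0.
Qed.

Lemma open_component W x : open W -> open (connected_component W x).
Proof.
move=> /open_eballP oW; apply/open_eballP => y xy.
have [r r0 yr] := oW y (connected_component_sub xy).
exists r => // z yz; apply: connected_component_trans xy _.
exact: component_eball yr.
Qed.

End Components.

(** * The lattice grid and the extension along it *)

Section Grid.
Variables (R : realType) (n : nat).
Local Notation V := 'rV[R]_n.
Hypothesis n1 : (1 < n)%N.
Implicit Types (x y z : V) (k t : R).

(* [grid k] contains the edges of the lattice [(2 pi / k) Z^n]: there all coordinates
   but one contribute [3 / 2] to the sum, and the last one at least [- 3 / 4]. It is
   also where the Laplacian of [\sum_i bump_wave a k (y_i)] is very negative, since
   [bump_wave a k] has second derivative [- a k^2 grid_wave k]. *)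
Definition grid_wave k t : R := cos (k * t) + cos (2 * k * t) / 2.

Definition grid k : set V := [set y | 1 / 2 < \sum_i grid_wave k (y ord0 i)].

Lemma cos_double (t : R) : cos (2 * t) = 2 * cos t ^+ 2 - 1.
Proof.
have := cos2Dsin2 t; rewrite [2 * t]mulr_natl mulr2n cosD -!expr2; lra.
Qed.

Lemma grid_wave_ge k t : - (3 / 4) <= grid_wave k t.
Proof.
rewrite /grid_wave -mulrA cos_double.
have := sqr_ge0 (cos (k * t) + 1 / 2); rewrite sqrrD; lra.
Qed.

Lemma grid_wave_node k t : cos (k * t) = 1 -> grid_wave k t = 3 / 2.
Proof. by move=> E; rewrite /grid_wave -mulrA cos_double E; lra. Qed.

Lemma is_derive_cosM k t : is_derive t 1 (fun t => cos (k * t)) (- (k * sin (k * t))).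
Proof.
have H : is_derive t 1 (fun t => k * t) k.
  have := is_derive_affine 0 k t; rewrite (_ : (fun u => 0 + u * k) = (fun u => k * u))//.
  by apply/funext => u; rewrite add0r mulrC.
have := @is_derive1_comp _ cos (fun t => k * t) t _ _ _ H.
move=> /(_ _ (is_derive_cos _)); rewrite mulrC mulrN; apply.
Qed.

Lemma is_derive_sinM k t : is_derive t 1 (fun t => sin (k * t)) (k * cos (k * t)).
Proof.
have H : is_derive t 1 (fun t => k * t) k.
  have := is_derive_affine 0 k t; rewrite (_ : (fun u => 0 + u * k) = (fun u => k * u))//.
  by apply/funext => u; rewrite add0r mulrC.
have := @is_derive1_comp _ sin (fun t => k * t) t _ _ _ H.
move=> /(_ _ (is_derive_sin _)); rewrite mulrC; apply.
Qed.

Lemma grid_wave_derive k t :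
  is_derive t 1 (grid_wave k) (- (k * sin (k * t)) + - (2 * k * sin (2 * k * t)) / 2).
Proof.
have H := is_derive_cosM k t; have H' := is_derive_cosM (2 * k) t.
by rewrite /grid_wave; apply: is_derive_eq; rewrite /GRing.scale/=; ring.
Qed.

Lemma open_grid k : open (grid k).
Proof.
apply: (@open_comp _ _ (fun y : V => \sum_i grid_wave k (y ord0 i)) [set t | 1 / 2 < t]).
  move=> y _; apply: (@separable_continuous _ _ (fun=> grid_wave k) (fun _ t =>
    - (k * sin (k * t)) + - (2 * k * sin (2 * k * t)) / 2)) => i t.
  exact: grid_wave_derive.
exact: open_gt.
Qed.

(** The hypothesis [n >= 2] enters through [(n - 1) 3 / 2 - 3 / 4 >= 3 / 4 > 1 / 2]. *)
Lemma grid_edge k y i : (forall j, j != i -> cos (k * y ord0 j) = 1) -> grid k y.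
Proof.
move=> H; rewrite /grid /= (bigD1 i)//=.
have -> : \sum_(j | j != i) grid_wave k (y ord0 j) = (n.-1)%:R * (3 / 2).
  rewrite (eq_bigr (fun=> 3 / 2)); last by move=> j /H/grid_wave_node.
  rewrite sumr_const [RHS]mulr_natl; congr (_ *+ _).
  by rewrite -[n in RHS]card_ord -(cardC1 i); exact: eq_card.
have := grid_wave_ge k (y ord0 i).
have : 1 <= (n.-1)%:R :> R by rewrite ler1n; lia.
lra.
Qed.

Lemma grid_component k x y i : (forall j, cos (k * x ord0 j) = 1) ->
  (forall j, j != i -> x ord0 j = y ord0 j) -> connected_component (grid k) x y.
Proof.
move=> hx xy; have -> : y = x + (y ord0 i - x ord0 i) *: evec R i.
  apply/rowP => j; rewrite !mxE eqxx/=; have [->|ji] := eqVneq j i.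
    by rewrite mulr1 addrC subrK.
  by rewrite mulr0 addr0 xy.
rewrite -[x in connected_component _ x](addr0 x) -(scale0r (evec R i)).
apply: (@component_line _ _ _ _ _ setT) => // u _.
apply: (@grid_edge _ _ i) => j ji.
by rewrite !mxE (negPf ji) andbF mulr0 addr0.
Qed.

(** The coordinates are switched from [0] to those of [x] one at a time, each time along a lattice
    line contained in the grid. *)
Lemma grid_nodes_connected k x : (forall i, cos (k * x ord0 i) = 1) ->
  connected_component (grid k) 0 x.
Proof.
move=> hx; pose q (m : nat) : V := \row_(i < n) (if (i < m)%N then x ord0 i else 0).
have q0 m i : cos (k * q m ord0 i) = 1.
  by rewrite mxE; case: ifP => // _; rewrite mulr0 cos0.
suff H m : (m <= n)%N -> connected_component (grid k) 0 (q m).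
  have -> : x = q n by apply/rowP => i; rewrite mxE ltn_ord.
  exact: H.
elim: m => [_|m IH mn].
  rewrite (_ : q 0%N = 0); last by apply/rowP => i; rewrite !mxE.
  apply: connected_component_refl; apply: (@grid_edge _ _ (Ordinal (ltnW n1))) => j _.
  by rewrite mxE mulr0 cos0.
apply: connected_component_trans (IH (ltnW mn)) _.
apply: (@grid_component _ _ _ (Ordinal mn)) => // j jm.
have {}jm : j != m :> nat by apply: contraNneq jm => jm; apply/eqP/val_inj.
by rewrite !mxE (_ : (j < m.+1)%N = (j < m)%N)//; lia.
Qed.

Lemma grid_node_near k x : 0 < k -> exists2 y : V,
  (forall i, cos (k * y ord0 i) = 1) & enorm (y - x) <= n.+1%:R * (2 * pi / k).
Proof.
move=> k0; have p0 : 0 < 2 * pi / k :> R by rewrite divr_gt0// mulr_gt0// pi_gt0.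
pose y : V := \row_i ((Num.floor (x ord0 i / (2 * pi / k)))%:~R * (2 * pi / k)).
have cosz (m : int) : cos (m%:~R * (2 * pi)) = 1 :> R.
  have cosn (j : nat) : cos (j%:R * (2 * pi)) = 1 :> R.
    have := periodicn (@cosD2pi R) j 0.
    by rewrite mulr_natl [2 * pi]mulr_natl add0r cos0.
  case: m => m; first by rewrite -pmulrn cosn.
  by rewrite NegzE mulrNz mulNr cosN -pmulrn cosn.
exists y => [i|].
  rewrite mxE (_ : k * _ = (Num.floor (x ord0 i / (2 * pi / k)))%:~R * (2 * pi)) ?cosz//.
  by field; rewrite gt_eqF.
apply: le_trans (enorm_le_norm _) _; rewrite ler_pM2l//.
rewrite /Num.norm/= mx_normrE; apply/bigmax_leP; split; first exact: ltW.
move=> [i j] _ /=; rewrite !mxE.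
have := floor_itv (x ord0 j / (2 * pi / k)); rewrite (ord1 i) => /andP[].
rewrite ler_pdivlMr// ltr_pdivrMr// intrD1 => h1 h2.
rewrite ler_norml; apply/andP; split; lra.
Qed.

Lemma component_mono (A B : set V) x : A `<=` B ->
  connected_component A x `<=` connected_component B x.
Proof.
move=> AB y Axy; have Ax : A x.
  by apply: connected_component_sub (connected_component_sym Axy).
have := connected_component_max _ (subset_trans (@connected_component_sub _ A x) AB)
  (@component_connected _ A x).
by apply => //; exact: connected_component_refl.
Qed.

Definition nbd (K : set V) (r : R) : set V := [set y | exists2 x, K x & enorm (y - x) < r].

Lemma open_nbd K r : open (nbd K r).
Proof.
apply/open_eballP => y [x Kx yx]; exists (r - enorm (y - x)); first by rewrite subr_gt0.
move=> z; rewrite /eball /= => zy; exists x => //.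
by have := enorm_sub z y x; lra.
Qed.

(** Two derivatives turn the weight [1 / 8] into [(2 k)^2 / 8 = k^2 / 2], which is the weight in
    [grid_wave], up to [k^2]. *)
Definition bump_wave (a k t : R) := a * (cos (k * t) + cos (2 * k * t) / 8).

Lemma bump_wave_derive a k t : is_derive t 1 (bump_wave a k)
  (- (a * (k * sin (k * t) + 2 * k * sin (2 * k * t) / 8))).
Proof.
have H := is_derive_cosM k t; have H' := is_derive_cosM (2 * k) t.
by rewrite /bump_wave; apply: is_derive_eq; rewrite /GRing.scale/=; ring.
Qed.

Lemma bump_wave_derive2 a k t : is_derive t 1
  (fun t => - (a * (k * sin (k * t) + 2 * k * sin (2 * k * t) / 8)))
  (- (a * k ^+ 2 * grid_wave k t)).
Proof.
have H := is_derive_sinM k t; have H' := is_derive_sinM (2 * k) t.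
by apply: is_derive_eq; rewrite /GRing.scale/= /grid_wave; field.
Qed.

(** On the grid the Laplacian is below [2 n a - b k^2 / 2], which is negative. *)
Lemma csh_paraboloid_grid (a b k : R) z : 0 <= a ->
  4 * n%:R * a < b * k ^+ 2 ->
  csh (grid k) (fun y => a * enorm (y - z) ^+ 2 + \sum_i bump_wave b k (y ord0 i)).
Proof.
move=> a0 ab.
pose f (i : 'I_n) t := a * (t - z ord0 i) ^+ 2 + bump_wave b k t.
pose f1 (i : 'I_n) t := 2 * a * (t - z ord0 i) +
  - (b * (k * sin (k * t) + 2 * k * sin (2 * k * t) / 8)).
pose f2 (i : 'I_n) t := 2 * a + - (b * k ^+ 2 * grid_wave k t).
apply: (@csh_ext _ _ _ (fun y : V => \sum_i f i (y ord0 i))).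
  move=> y _; rewrite sqr_enorm /dot mulr_sumr -big_split; apply: eq_bigr => i _ /=.
  by rewrite /f !mxE expr2.
apply: (@csh_separable _ _ _ f f1 f2); first exact: open_grid.
- move=> i t; have H := bump_wave_derive b k t.
  by rewrite /f /f1; apply: is_derive_eq; rewrite /GRing.scale/=; ring.
- move=> i t; have H := bump_wave_derive2 b k t; apply: is_deriveD.
  by apply: is_derive_eq; rewrite /GRing.scale/=; ring.
- move=> y; rewrite /grid /= => gy.
  rewrite /f2 big_split/= sumr_const card_ord sumrN -mulr_sumr -[X in X + _]mulr_natl.
  have na : 0 <= 4 * n%:R * a by rewrite mulr_ge0// mulr_ge0.
  by move: ab gy na; set S := \sum_i _; set B := b * _; nra.
Qed.

Lemma bump_wave_small (b k : R) y : 0 <= b ->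
  `|\sum_i bump_wave b k (y ord0 i)| <= 2 * n%:R * b.
Proof.
move=> b0; apply: le_trans (ler_norm_sum _ _ _) _.
apply: (@le_trans _ _ (\sum_(i < n) 2 * b)).
  apply: ler_sum => i _; rewrite normrM ger0_norm// [leRHS]mulrC ler_wpM2l//.
  have := cos_le1 (k * y ord0 i); have := cos_geN1 (k * y ord0 i).
  have := cos_le1 (2 * k * y ord0 i); have := cos_geN1 (2 * k * y ord0 i).
  by move=> *; rewrite ler_norml; apply/andP; split; lra.
by rewrite sumr_const card_ord -[leLHS]mulr_natl mulrCA mulrA.
Qed.

(* Every C^2 function is, up to a small rapidly oscillating term, superharmonic
   on a thin neighbourhood of a fine lattice grid, since there the oscillating
   term is strongly concave in all directions but one. This lets a function on
   a neighbourhood of [K], possibly disconnected, be cut off and extended to a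
   domain along the grid. *)
Lemma csh_domain_extension (K W : set V) (s : V -> R) : compact K -> K !=set0 ->
  K `<=` W -> csh W s -> exists (U : set V) (F : V -> R),
  [/\ domain U, K `<=` U, csh U F & forall x, K x -> F x = s x].
Proof.
move=> cK [x0 Kx0] KW sW; have [oW cs _] := sW.
pose P (A : set V) := exists d m : R, [/\ 0 < d, 0 <= m & forall x, A x ->
  forall y, enorm (y - x) < d -> W y /\ `|s y| <= m].
have [G [_ KG [d [m [d0 m0 Hd]]]]] : exists G, [/\ open G, K `<=` G & P G].
  apply: compact_ind => //.
  - move=> A B AB [d [m [d0 m0 H]]]; exists d, m; split=> // x /AB; exact: H.
  - by exists 1, 0.
  - move=> A B [d [m [d0 m0 H]]] [d' [m' [d'0 m'0 H']]].
    exists (Num.min d d'), (Num.max m m'); split.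
    + by rewrite lt_min d0.
    + by rewrite le_max m0.
    + move=> x [Ax|Bx] y; rewrite lt_min => /andP[yd yd'].
        have [Wy sy] := H x Ax y yd; split=> //.
        by rewrite le_max sy.
      have [Wy sy] := H' x Bx y yd'; split=> //.
      by rewrite le_max sy orbT.
  - move=> x /KW Wx; move/open_eballP : oW => /(_ x Wx)[d d0 xd].
    have /continuous_atP/(_ _ ltr01)[d' d'0 xd'] := cs x Wx.
    pose r := Num.min d d'.
    have r0 : 0 < r by rewrite lt_min d0.
    exists (r / 2); first by rewrite divr_gt0.
    exists (r / 2), (`|s x| + 1); split; first by rewrite divr_gt0.
      by rewrite addr_ge0.
    move=> y yx z zy; have zr : enorm (z - x) < r.
      by have := enorm_sub z y x; move: yx; rewrite /eball /=; lra.
    move: zr; rewrite lt_min => /andP[zd zd']; split; first exact: xd.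
    have := xd' z zd'; have := ler_dist_dist (s x) (s z).
    rewrite ler_norml => /andP[] *; lra.
pose rho := d / 3.
have rho0 : 0 < rho by rewrite divr_gt0.
have dE : d = 3 * rho by rewrite /rho; field.
have rd1 : rho <= d by lra.
have rd2 : 2 * rho <= d by lra.
have nbdW r y : r <= d -> nbd K r y -> W y /\ `|s y| <= m.
  by move=> rd [x Kx yx]; apply: (Hd x (KG x Kx)); exact: lt_le_trans rd.
pose Z := ~` nbd K (2 * rho).
have Zfar z x : Z z -> K x -> 2 * rho <= enorm (z - x).
  by move=> Zz Kx; rewrite leNgt; apply/negP => zx; apply: Zz; exists x.
have Z0 : Z !=set0.
  have [kb kb0 Kkb] := compact_enorm_bounded cK.
  exists ((kb + 2 * rho) *: evec R (Ordinal (ltnW n1))) => -[x Kx].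
  have := enormB ((kb + 2 * rho) *: evec R (Ordinal (ltnW n1))) x.
  rewrite enormZ enorm_evec mulr1 ger0_norm; last by lra.
  by have := Kkb x Kx; lra.
pose D := infconv Z (fun=> 0) 1.
have lbD y v : [set 0 + 1 * enorm (u - y) | u in Z] v -> 0 <= v.
  by move=> [u _ <-]; rewrite add0r mul1r enorm_ge0.
have neD y : [set 0 + 1 * enorm (u - y) | u in Z] !=set0.
  by have [u Zu] := Z0; exists (0 + 1 * enorm (u - y)); exists u.
have D0 y : 0 <= D y by apply: le_inf_lb => //; exact: lbD.
have Dle y z : Z z -> D y <= enorm (z - y).
  by move=> Zz; apply: (inf_lb_le (@lbD y)); exists z => //; rewrite add0r mul1r.
have cD : continuous D.
  by apply: lip_continuous; apply: (infconv_lip (b := 0)) => //; exact: ler01.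
have DZ z : Z z -> D z = 0.
  by move=> Zz; apply/le_anti; rewrite D0 (le_trans (Dle z z Zz))// subrr enorm0.
have Dnbd y : nbd K rho y -> rho <= D y.
  move=> [x Kx yx]; apply: le_inf_lb => // _ [z Zz <-]; rewrite add0r mul1r.
  have := Zfar z x Zz Kx; have := enorm_sub z y x; lra.
(* [Psi] has to exceed [m], hence [s], on the [rho]-neighbourhood of [K], and to lie below [- m] on
   [Z]. Up to a wave of size at most [1 / 2] it is [C D^2 - m - 1], where [D >= rho] on the former
   set and [D = 0] on the latter. *)
pose C := (2 * m + 3) / rho ^+ 2.
have C0 : 0 < C by rewrite divr_gt0 ?exprn_gt0//; lra.
(* The amplitude [b = B / k^2] of the wave satisfies [b k^2 > 4 n C], as [csh_paraboloid_grid]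
   requires. In [k], the terms [8 n B + 1] keep the wave below [1 / 2], and the last one puts a
   lattice node within [rho] of every point. *)
pose B := 4 * n%:R * C + 1.
have nR : 1 <= n%:R :> R by rewrite ler1n ltnW.
have nC : 0 <= n%:R * C by apply: mulr_ge0; [lra|exact: ltW].
have B0 : 0 < B by rewrite /B; lra.
pose k := 8 * n%:R * B + 1 + n.+1%:R * (2 * pi) / rho.
have npi : 0 < n.+1%:R * (2 * pi) / rho by rewrite divr_gt0// mulr_gt0// mulr_gt0// pi_gt0.
have k1 : 8 * n%:R * B + 1 <= k by rewrite lerDl ltW.
have nB : 0 <= n%:R * B by apply: mulr_ge0; [lra|exact: ltW].
have k0 : 0 < k by lra.
have kk : 4 * n%:R * B <= k ^+ 2 / 2 by nra.
have krho : n.+1%:R * (2 * pi / k) < rho.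
  rewrite mulrA ltr_pdivrMr// -ltr_pdivrMl// mulrC.
  by rewrite /k ltrDr; lra.
pose b := B / k ^+ 2.
have k20 : 0 < k ^+ 2 by rewrite exprn_gt0.
have b0 : 0 < b by rewrite divr_gt0.
pose g y := \sum_i bump_wave b k (y ord0 i).
have gsmall y : `|g y| <= 1 / 2.
  apply: le_trans (bump_wave_small k y (ltW b0)) _.
  by rewrite /b mulrA ler_pdivrMr//; lra.
pose Psi y := (C * D y ^+ 2 + g y) + - (m + 1).
have cPsi : continuous Psi.
  move=> y; apply: continuousD_at; last exact: cst_continuous.
  apply: continuousD_at.
    apply: continuousZ_at.
    by apply: (@continuousM _ _ D D); exact: cD.
  by apply: (@separable_continuous _ _ (fun=> bump_wave b k) (fun _ t =>
    - (b * (k * sin (k * t) + 2 * k * sin (2 * k * t) / 8)))) => i t; exact: bump_wave_derive.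
have PsiN y : nbd K rho y -> m < Psi y.
  move=> /Dnbd Dy; have : C * rho ^+ 2 <= C * D y ^+ 2.
    by rewrite ler_pM2l// lerXn2r// ?nnegrE// ltW.
  rewrite divfK ?gt_eqF ?exprn_gt0// /Psi.
  by have := gsmall y; rewrite ler_norml => /andP[]; lra.
have PsiZ y : Z y -> Psi y < - m.
  move=> /DZ Dy; rewrite /Psi Dy expr0n mulr0.
  by have := gsmall y; rewrite ler_norml => /andP[]; lra.
have Psicsh : csh (grid k) Psi.
  (* [D] is the distance to [Z], so [Psi] is an infimum over [z] in [Z] of paraboloids centred at
     [z] plus the wave and a constant. *)
  apply: csh_inf; [exact: open_grid|by move=> y _; exact: cPsi|].
  move=> y _ e e0.
  pose del := Num.min 1 (e / (2 * C * (2 * D y + 1))).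
  have DD1 : 0 < 2 * D y + 1 by have := D0 y; lra.
  have DD : 0 < 2 * C * (2 * D y + 1) by apply: mulr_gt0 => //; exact: mulr_gt0.
  have del0 : 0 < del by rewrite lt_min ltr01 divr_gt0.
  have [_ [z Zz <-] Hz] := inf_approx (neD y) (@lbD y) del0.
  rewrite add0r mul1r -/(D y) in Hz.
  exists (fun y => (C * enorm (y - z) ^+ 2 + g y) + - (m + 1)); split.
  - apply: csh_addcst; apply: csh_paraboloid_grid; first exact: ltW.
    by rewrite /b divfK ?gt_eqF// /B; lra.
  - move=> x _; rewrite /Psi !lerD2r ler_pM2l// lerXn2r// ?nnegrE ?enorm_ge0//.
    by rewrite enormC Dle.
  - rewrite /Psi enormC.
    have d1 : del <= 1 by rewrite ge_min lexx.
    have d2 : del * (2 * C * (2 * D y + 1)) <= e.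
      by rewrite -ler_pdivlMr// ge_min lexx orbT.
    have h1 : enorm (z - y) ^+ 2 <= (D y + del) ^+ 2.
      have dd : 0 <= D y + del by apply: addr_ge0 => //; exact: ltW.
      by rewrite lerXn2r ?nnegrE ?enorm_ge0//; exact: ltW.
    have h2 : C * enorm (z - y) ^+ 2 <= C * (D y + del) ^+ 2 by rewrite ler_pM2l.
    have h3 : (D y + del) ^+ 2 <= D y ^+ 2 + del * (2 * D y + 1).
      by rewrite sqrrD; have := D0 y; nra.
    have h4 : C * (D y + del) ^+ 2 <= C * (D y ^+ 2 + del * (2 * D y + 1)) by rewrite ler_pM2l.
    have h5 : 0 < del * (C * (2 * D y + 1)).
      by apply: mulr_gt0 => //; exact: mulr_gt0.
    lra.
pose F y := if `[< nbd K (2 * rho) y >] then Num.min (s y) (Psi y) else Psi y.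
pose W0 := nbd K rho `|` grid k.
have oW0 : open W0 by apply: openU; [exact: open_nbd|exact: open_grid].
have nbd12 y : nbd K rho y -> nbd K (2 * rho) y.
  by move=> [x Kx yx]; exists x => //; lra.
have FN y : nbd K rho y -> F y = s y.
  move=> Ny; rewrite /F asboolT; last exact: nbd12.
  have [_] := nbdW _ y rd1 Ny; rewrite ler_norml => /andP[_ sm].
  by rewrite min_l// ltW// (le_lt_trans sm)// PsiN.
have KN : K `<=` nbd K rho by move=> x Kx; exists x => //; rewrite subrr enorm0.
have grid0 : grid k 0.
  by apply: (@grid_edge _ _ (Ordinal (ltnW n1))) => j _; rewrite mxE mulr0 cos0.
exists (connected_component W0 0), F; split.
- split; first exact: open_component.
  split; first exact: component_connected.
  by exists 0; apply: connected_component_refl; right.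
- move=> x Kx; have [y hy yx] := grid_node_near x k0.
  have W0y : connected_component W0 0 y.
    by apply: component_mono (grid_nodes_connected hy); right.
  apply: connected_component_trans W0y _; apply: connected_component_sym.
  apply: (@component_eball _ _ _ _ rho); first exact: le_lt_trans yx krho.
  by move=> z zx; left; exists x.
- apply: csh_local => [|x /connected_component_sub [Nx|gx]]; first exact: open_component.
    exists (nbd K rho), s; split=> //.
      apply: csh_sub sW; first exact: open_nbd.
      by move=> y /(nbdW _ y rd1)[].
    by move=> y /FN ->.
  have [Nx|Nx] := pselect (nbd K (2 * rho) x).
    exists (nbd K (2 * rho) `&` grid k), (fun y => Num.min (s y) (Psi y)); split=> //.
      have oI : open (nbd K (2 * rho) `&` grid k).
        by apply: openI; [exact: open_nbd|exact: open_grid].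
      apply: csh_min; last by apply: csh_sub Psicsh => // y [].
      by apply: csh_sub sW => // y [/(nbdW _ y rd2)[]].
    by move=> y [Ny _]; rewrite /F asboolT.
  (* The inequality [Psi < - m] persists near [x]. As [s >= - m] on the [2 rho]-neighbourhood of
     [K], the minimum there is [Psi], and [F] is not disturbed by the boundary of that
     neighbourhood. *)
  exists (grid k `&` [set y | Psi y < - m]), Psi; split.
  - apply: csh_sub Psicsh; last by move=> y [].
    apply: openI; first exact: open_grid.
    by apply: (@open_comp _ _ Psi [set t | t < - m]); [move=> y _; exact: cPsi|exact: open_lt].
  - by split=> //; exact: PsiZ.
  - move=> y [_ /= Py]; rewrite /F; case: ifPn => // /asboolP Ny.
    have [_] := nbdW _ y rd2 Ny; rewrite ler_norml => /andP[sm _].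
    by rewrite min_r// ltW// (lt_le_trans Py).
- by move=> x /KN/FN.
Qed.

End Grid.

(** * Jensen measures and continuous superharmonic functions *)

Section Borel.
Variables (R : realType) (n : nat).
Local Notation V := 'rV[R]_n.
Local Notation B := (BV R n).

Lemma measurable_open (U : set V) : open U -> measurable (U : set B).
Proof. by move=> oU; exact: sub_sigma_algebra. Qed.

Lemma measurable_closed (F : set V) : closed F -> measurable (F : set B).
Proof.
move=> cF; rewrite -[F]setCK; apply: (@measurableC _ B).
by apply: measurable_open; exact: closed_openC.
Qed.

Lemma compact_closedV (K : set V) : compact K -> closed K.
Proof. by apply: compact_closed; exact: norm_hausdorff. Qed.

Lemma measurable_compact (K : set V) : compact K -> measurable (K : set B).
Proof. by move=> /compact_closedV/measurable_closed. Qed.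

Lemma superharmonic_measurable (U : set V) (f : V -> \bar R) :
  superharmonic_on U f -> measurable_fun (U : set B) (f : B -> \bar R).
Proof.
move=> [oU [_ [flsc _]]].
apply: (measurability _ (ErealGenOInfty.measurableE R)) => _ [_ [a ->] <-].
apply: measurable_open; rewrite openE => x [Ux /=]; rewrite in_itv/= andbT => ax.
apply: filterI; first exact: open_nbhs_nbhs.
apply: filterS (flsc x Ux a ax) => y ay.
by rewrite /= in_itv/= andbT.
Qed.

Lemma csh_measurable (W : set V) (s : V -> R) : csh W s ->
  measurable_fun (W : set B) (EFin \o s : B -> \bar R).
Proof. by move=> /csh_superharmonic/superharmonic_measurable. Qed.

Variable mu : {measure set B -> \bar R}.

(** The open set is exhausted by the compact sets [C k], each covered by finitely many null open
    sets. *)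
Lemma supp_null (G : set V) : open G -> (forall x, G x -> ~ supp mu x) ->
  mu G = 0%E.
Proof.
move=> oG GS.
pose C (k : nat) := [set x : V | enorm x <= k%:R] `&`
  [set x : V | forall z, ~ G z -> k.+1%:R^-1 <= enorm (z - x)].
have clC k : closed (C k).
  apply: closedI.
    apply: (@closed_comp _ _ (fun y : V => enorm y) [set t | t <= k%:R]).
      by move=> x _; exact: enorm_continuous.
    exact: closed_le.
  rewrite (_ : [set x : V | _] = \bigcap_(z in ~` G) [set x : V | k.+1%:R^-1 <= enorm (x - z)]).
    apply: closed_bigI => z _.
    apply: (@closed_comp _ _ (fun y : V => enorm (y - z)) [set t | k.+1%:R^-1 <= t]).
      by move=> x _; exact: enorm_sub_continuous.
    exact: closed_ge.
  by apply/seteqP; split=> x H z /H; rewrite /= enormC.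
have CG k : C k `<=` G.
  move=> x [_ H]; apply: contrapT => nGx; have := H x nGx.
  by rewrite subrr enorm0 leNgt invr_gt0 ltr0n.
have cC k : compact (C k).
  by apply: (@compact_enorm _ _ _ k%:R) => // x [].
pose P (A : set V) := exists N : set V, [/\ open N, A `<=` N & mu N = 0%E].
have C0 k : mu.-negligible (C k : set B).
  have [N [_ CN [N' [oN' NN' N'0]]]] : exists N, [/\ open N, C k `<=` N & P N].
    apply: compact_ind => //.
    - move=> A A' AA' [N [oN A'N N0]]; exists N; split=> //; exact: subset_trans A'N.
    - by exists set0; split; [exact: open0| |rewrite measure0].
    - move=> A A' [N [oN AN N0]] [N' [oN' A'N' N'0]]; exists (N `|` N'); split.
      + exact: openU.
      + by apply: setUSS.
      + rewrite -[RHS]N0; apply: (measureU0 (mu := mu)) => //; exact: measurable_open.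
    - move=> x /CG/GS nS.
      have [N [oN Nx N0]] : exists N : set V, [/\ open N, N x & mu N = 0%E].
        apply: contrapT => H; apply: nS => N oN Nx.
        rewrite lt0e measure_ge0 andbT; apply/eqP => N0; apply: H.
        by exists N.
      move/open_eballP : (oN) => /(_ x Nx)[d d0 xd]; exists d => //.
      by exists N.
  exists N'; split; [exact: measurable_open|exact: N'0|exact: subset_trans NN'].
have H := negligible_bigcup C0.
apply: measure_negligible; first exact: measurable_open.
apply: negligibleS H => x Gx.
move/open_eballP : (oG) => /(_ x Gx)[d d0 xd].
pose m := Num.max (enorm x) d^-1; pose k := (Num.truncn m).+1.
have mk : m < k%:R by rewrite /k truncnS_gt.
exists k => //; split=> /=.
  by apply: ltW; apply: le_lt_trans mk; rewrite /m le_max lexx.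
move=> z nGz; rewrite leNgt; apply/negP => zx; apply: nGz; apply: xd.
apply: lt_trans zx _; rewrite invf_plt ?posrE//.
apply: (@lt_trans _ _ k%:R); last by rewrite ltr_nat.
by apply: le_lt_trans mk; rewrite /m le_max lexx orbT.
Qed.

Lemma integral_conull (K U : set V) (f : V -> \bar R) : compact K -> K `<=` U ->
  measurable (U : set B) -> measurable_fun (U : set B) (f : B -> \bar R) -> mu (~` K) = 0%E ->
  (\int[mu]_(y in (U : set B)) f y = \int[mu]_(y in (K : set B)) f y)%E.
Proof.
move=> cK KU mU mf K0; have mK := measurable_compact cK.
have KE : (K : set B) = (U : set B) `\` (~` K : set B).
  by rewrite setDE setCK; apply/esym/setIidr.
have mCK : measurable (~` K : set B) by exact: measurableC.
rewrite integralE [RHS]integralE; congr (_ - _)%E.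
  rewrite KE; apply: ge0_negligible_integral => //.
  exact: measurable_funepos.
rewrite KE; apply: ge0_negligible_integral => //.
exact: measurable_funeneg.
Qed.

Hypothesis n1 : (1 < n)%N.

Lemma jensen_csh (K W : set V) (s : V -> R) x : compact K -> K x -> K `<=` W ->
  csh W s -> mu (~` K) = 0%E -> jensen_cpt K x mu ->
  (\int[mu]_(y in (K : set B)) (s y)%:E <= (s x)%:E)%E.
Proof.
move=> cK Kx KW sW K0 J.
have [U [F [dU KU FU Fs]]] := csh_domain_extension n1 cK (ex_intro _ x Kx) KW sW.
have [_ [_ [_ JU]]] := J U dU KU.
have := JU _ (csh_superharmonic FU); rewrite (integral_conull cK KU _ _ K0).
- rewrite /= Fs//; apply: le_trans; rewrite le_eqVlt; apply/orP; left; apply/eqP.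
  by apply: eq_integral => y /set_mem Ky; rewrite /= Fs.
- by apply: measurable_open; case: FU.
- exact: csh_measurable FU.
Qed.

(** The approximants of [f] share a lower bound [b]. Subtracting [b] makes them nonnegative, as
    monotone convergence and the tested inequality demand; since [mu E = 1], the shift is recovered
    exactly at the end. *)
Lemma csh_jensen (E : set V) x : compact E -> E x -> mu (~` E) = 0%E ->
  supp mu `<=` E -> mu E = 1%E ->
  (forall W s, E `<=` W -> csh W s -> (forall y, E y -> 0 <= s y) ->
     (\int[mu]_(y in (E : set B)) (s y)%:E <= (s x)%:E)%E) ->
  jensen_cpt E x mu.
Proof.
move=> cE Ex E0 suppE mu1 H U [oU _] EU.
have mE := measurable_compact cE.
have muT C : compact C -> (mu C <= mu E)%E.
  move=> /measurable_compact mC; have mCE : measurable (~` E : set B) by exact: measurableC.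
  apply: (@le_trans _ _ (mu ((E : set B) `|` ~` (E : set B)))).
    by rewrite setUv; apply: le_measure => //; exact/mem_set.
  by rewrite le_eqVlt; apply/orP; left; apply/eqP; rewrite measureU0.
split; first by move=> C cC; by apply: le_lt_trans (muT C cC) _; rewrite mu1 ltry.
split.
  apply: (@subclosed_compact _ _ E) => // y yS N oN Ny.
  have /yS[z [Sz Nz]] : nbhs y N by exact: open_nbhs_nbhs.
  exact: Sz.
split; first exact: subset_trans EU.
move=> f fU.
have n0 : (0 < n)%N by exact: ltnW.
rewrite (integral_conull cE EU (measurable_open oU) (superharmonic_measurable fU) E0).
have [W [g [b [EW gW gb gmono gf]]]] := superharmonic_approx n0 cE EU fU.
pose h k y : \bar R := (g k y - b)%:E.
have mh k : measurable_fun (E : set B) (h k).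
  apply: (@measurable_funS _ _ B _ W) => //.
    by apply: measurable_open; have [] := gW 0%N.
  exact: csh_measurable (csh_addcst (- b) (gW k)).
have h0 k y : E y -> (0 <= h k y)%E by move=> /EW/(gb k); rewrite lee_fin subr_ge0.
have hmono y : E y -> {homo h^~ y : k l / (k <= l)%N >-> (k <= l)%E}.
  by move=> /EW/gmono gy k l /gy; rewrite lee_fin lerD2r.
have hlim y : E y -> (limn (h^~ y) = f y - b%:E)%E.
  move=> Ey; have [gfy gay] := gf y (EW y Ey).
  rewrite (cvg_lim _ (ereal_nondecreasing_cvgn (hmono y Ey)))//.
  apply/eqP; rewrite eq_le; apply/andP; split.
    apply: ge_ereal_sup => _ [k _ <-]; rewrite /h EFinB.
    by apply: leeB => //; exact: gfy.
  rewrite leeBlDr// leNgt; apply/negP.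
  have : (h 0%N y <= ereal_sup (range (h^~ y)))%E.
    by apply: ereal_sup_ubound; exists 0%N.
  have hs k : (h k y <= ereal_sup (range (h^~ y)))%E.
    by apply: ereal_sup_ubound; exists k.
  move: hs; case: (ereal_sup _) => [t| |] hs; last first.
  - by rewrite leNgt ltNyr.
  - by move=> _; rewrite addye// ltNge leey.
  - move=> _; rewrite -EFinD => /gay[k].
    by have := hs k; rewrite lee_fin; lra.
have mct := monotone_convergence mu mE mh h0 hmono.
have I1 : (\int[mu]_(y in (E : set B)) (f y - b%:E) <= f x - b%:E)%E.
  rewrite (_ : (\int[mu]_(y in (E : set B)) (f y - b%:E) =
    \int[mu]_(y in (E : set B)) limn (h^~ y))%E); last first.
    by apply: eq_integral => y /set_mem Ey; rewrite hlim.
  rewrite mct; apply: lime_le.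
    apply: ereal_nondecreasing_is_cvgn => k l kl; apply: ge0_le_integral => //.
    - by move=> y Ey; exact: h0.
    - by move=> y Ey; exact: hmono.
  apply: nearW => k; apply: le_trans (H W _ EW (csh_addcst (- b) (gW k)) _) _.
    by move=> y /(h0 k); rewrite lee_fin.
  by rewrite EFinB leeB//; have [] := gf x (EW x Ex).
have [fx|fx] := eqVneq (f x) +oo%E; first by rewrite fx leey.
have fxNy : f x != -oo%E by have [_ [+ _]] := fU; move=> /(_ x (EU x Ex)); rewrite ltNye.
have mf : measurable_fun (E : set B) (f : B -> \bar R).
  apply: (@measurable_funS _ _ B _ U) => //; first exact: measurable_open.
  exact: superharmonic_measurable.
have fb0 y : E y -> (0 <= f y - b%:E)%E.
  move=> Ey; rewrite leeBrDr// add0e; have [gfy _] := gf y (EW y Ey).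
  by apply: le_trans (gfy 0%N); rewrite lee_fin; exact/gb/EW.
have int1 : mu.-integrable (E : set B) (fun y => f y - b%:E)%E.
  apply/integrableP; split.
    by apply: emeasurable_funB => //; exact: measurable_cst.
  rewrite (_ : (\int[mu]_(y in _) _ = \int[mu]_(y in (E : set B)) (f y - b%:E))%E); last first.
    by apply: eq_integral => y /set_mem/fb0 fb; rewrite gee0_abs.
  apply: le_lt_trans I1 _; rewrite lteBlDr// ltey.
  by case: (f x) fx.
have int2 : mu.-integrable (E : set B) (fun=> b%:E).
  apply/integrableP; split; first exact: measurable_cst.
  by rewrite integral_cst// mu1 mule1 ltry.
rewrite (_ : (\int[mu]_(y in (E : set B)) f y =
    \int[mu]_(y in (E : set B)) ((f y - b%:E) + b%:E))%E); last first.
  by apply: eq_integral => y _; rewrite subeK.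
rewrite integralD// integral_cst// mu1 mule1.
by rewrite -leeBrDr.
Qed.

End Borel.

(** * The Hahn-Banach and Riesz theorems *)

Section HahnBanach.
Variables (R : realType) (E : lmodType R) (D : set E).
Hypothesis D0 : D 0.
Hypothesis DD : forall x y, D x -> D y -> D (x + y).
Hypothesis DZ : forall (t : R) x, D x -> D (t *: x).
Implicit Types (p q : E -> R) (x y g : E) (t : R).

Definition sublinear q :=
  (forall x y, D x -> D y -> q (x + y) <= q x + q y) /\
  (forall t x, 0 <= t -> D x -> q (t *: x) <= t * q x).

Let DN x : D x -> D (- x).
Proof. by rewrite -scaleN1r; exact: DZ. Qed.

Lemma sublinear_at0 q : sublinear q -> q 0 = 0.
Proof.
move=> [qD qZ]; apply/le_anti/andP; split.
  by have := qZ 0 0 (lexx 0) D0; rewrite scale0r mul0r.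
by have := qD 0 0 D0 D0; rewrite addr0; lra.
Qed.

Lemma sublinear_lb q x : sublinear q -> D x -> - q (- x) <= q x.
Proof.
move=> sq Dx; have := sq.1 x (- x) Dx (DN Dx).
by rewrite subrr sublinear_at0//; lra.
Qed.

(** A smaller sublinear functional whose value at [- g] is at most [- q g]. It serves twice: to
    obtain [L g = p g], and to show that a minimal functional is odd. *)
Definition tilt q g x := inf [set q (x + t *: g) - t * q g | t in [set t | 0 <= t]].

Lemma tilt_sublinear q g : sublinear q -> D g ->
  [/\ sublinear (tilt q g), forall x, D x -> tilt q g x <= q x &
    tilt q g (- g) <= - q g].
Proof.
move=> sq Dg; have [qD qZ] := sq; have q0 := sublinear_at0 sq.
have lb x : D x -> forall z,
    [set q (x + t *: g) - t * q g | t in [set t | 0 <= t]] z -> - q (- x) <= z.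
  move=> Dx _ [t /= t0 <-].
  have h1 : q (t *: g) <= q (x + t *: g) + q (- x).
    have tE : t *: g = (x + t *: g) + (- x) by rewrite addrC addKr.
    rewrite {1}tE.
    by apply: qD; [apply: DD => //; exact: DZ|exact: DN].
  have h2 : t * q g <= q (t *: g).
    have [->|tn] := eqVneq t 0; first by rewrite mul0r scale0r q0.
    have tp : 0 < t by rewrite lt_def tn.
    rewrite -ler_pdivlMl//.
    have := qZ t^-1 (t *: g); rewrite scalerA mulVf// scale1r; apply.
      by rewrite invr_ge0.
    exact: DZ.
  lra.
have le x t : D x -> 0 <= t -> tilt q g x <= q (x + t *: g) - t * q g.
  by move=> Dx t0; apply: (inf_lb_le (lb x Dx)); exists t.
have ne x : [set q (x + t *: g) - t * q g | t in [set t | 0 <= t]] !=set0.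
  by exists (q (x + 0 *: g) - 0 * q g); exists 0 => /=.
have leq x : D x -> tilt q g x <= q x.
  by move=> Dx; have := le x 0 Dx (lexx 0); rewrite scale0r addr0 mul0r subr0.
split=> //; last first.
  by have := le (- g) 1 (DN Dg) ler01; rewrite scale1r addNr q0 mul1r add0r.
split=> [x y Dx Dy|t x t0 Dx].
  apply/ler_addgt0Pr => e e0; have e20 : 0 < e / 2 by rewrite divr_gt0.
  have [_ [t /= t0 <-] ht] := inf_approx (ne x) (lb x Dx) e20.
  have [_ [s /= s0 <-] hs] := inf_approx (ne y) (lb y Dy) e20.
  have := le (x + y) (t + s) (DD Dx Dy) (addr_ge0 t0 s0).
  rewrite scalerDl addrACA => h.
  have := qD (x + t *: g) (y + s *: g) (DD Dx (DZ t Dg)) (DD Dy (DZ s Dg)).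
  by move: ht hs h; rewrite -/(tilt q g x) -/(tilt q g y) mulrDl; lra.
have [->|tn] := eqVneq t 0.
  by rewrite scale0r mul0r -q0; exact: leq.
have tp : 0 < t by rewrite lt_def tn.
rewrite -ler_pdivrMl//; apply: le_inf_lb => // _ [s /= s0 <-].
rewrite ler_pdivrMl//; have := le (t *: x) (t * s) (DZ t Dx) (mulr_ge0 t0 s0).
rewrite -scalerA -scalerDr mulrBr => h; apply: le_trans h _.
have := qZ t (x + s *: g) t0 (DD Dx (DZ s Dg)); rewrite mulrA; lra.
Qed.

(* A minimal sublinear functional is linear. *)
Lemma hahn_banach p g : sublinear p -> D g -> exists L : E -> R,
  [/\ forall x y, D x -> D y -> L (x + y) = L x + L y,
      forall t x, D x -> L (t *: x) = t * L x,
      forall x, D x -> L x <= p x & L g = p g].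
Proof.
move=> sp Dg; have [sp0 p0p p0g] := tilt_sublinear sp Dg.
pose T := {q : E -> R | sublinear q /\ forall x, D x -> q x <= tilt p g x}.
pose t0 : T := exist _ (tilt p g) (conj sp0 (fun x _ => lexx _)).
(* The order is reversed, so that the maximal element given by Zorn's lemma is a minimal
   functional. *)
pose rT (q r : T) := `[< forall x, D x -> sval r x <= sval q x >].
have [||A Atot|[L [sL Lp]] Lmin] := @ZL_preorder T t0 rT.
- by move=> q; apply/asboolP.
- move=> q r s /asboolP qr /asboolP rs; apply/asboolP => x Dx.
  exact: le_trans (rs x Dx) (qr x Dx).
- have [[a Aa]|/forallNP A0] := pselect (exists a, A a); last first.
    by exists t0 => s /A0.
  pose m x := inf [set sval q x | q in A].
  have lb x : D x -> forall z, [set sval q x | q in A] z -> - tilt p g (- x) <= z.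
    move=> Dx _ [[q [sq qp]] Aq <-] /=; apply: le_trans (sublinear_lb sq Dx).
    by rewrite lerN2; exact/qp/DN.
  have ne x : [set sval q x | q in A] !=set0 by exists (sval a x); exists a.
  have le x (q : T) : D x -> A q -> m x <= sval q x.
    by move=> Dx Aq; apply: (inf_lb_le (lb x Dx)); exists q.
  have sm : sublinear m.
    split=> [x y Dx Dy|t x tge0 Dx].
      apply/ler_addgt0Pr => e e0; have e20 : 0 < e / 2 by rewrite divr_gt0.
      have [_ [q Aq <-] hq] := inf_approx (ne x) (lb x Dx) e20.
      have [_ [r Ar <-] hr] := inf_approx (ne y) (lb y Dy) e20.
      have : sval q (x + y) <= sval q x + sval q y by case: (proj2_sig q) => -[+ _] _; apply.
      have : sval r (x + y) <= sval r x + sval r y by case: (proj2_sig r) => -[+ _] _; apply.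
      have := le _ q (DD Dx Dy) Aq; have := le _ r (DD Dx Dy) Ar.
      rewrite -/(m x) in hq; rewrite -/(m y) in hr.
      (* In a chain one of [q] and [r] lies below the other, and this one serves both summands. *)
      case: (Atot q r Aq Ar) => /asboolP.
        by move=> /(_ x Dx); lra.
      by move=> /(_ y Dy); lra.
    have [->|tn] := eqVneq t 0.
      rewrite scale0r mul0r; apply: le_trans (le 0 a D0 Aa) _.
      by rewrite sublinear_at0//; case: (proj2_sig a).
    have tp : 0 < t by rewrite lt_def tn.
    rewrite -ler_pdivrMl//; apply: le_inf_lb => // _ [q Aq <-].
    rewrite ler_pdivrMl//; apply: le_trans (le _ q (DZ t Dx) Aq) _.
    by case: (proj2_sig q) => -[_ +] _; apply.
  have mp x : D x -> m x <= tilt p g x.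
    by move=> Dx; apply: le_trans (le x a Dx Aa) _; case: (proj2_sig a) => _; apply.
  exists (exist _ m (conj sm mp)) => q Aq; apply/asboolP => x Dx.
  exact: le.
(* By minimality [L] lies below [tilt L x], whose value at [- x] is at most [- L x]. *)
have LN x : D x -> L (- x) = - L x.
  move=> Dx; apply/le_anti/andP; split; last first.
    by have := sublinear_lb sL Dx; lra.
  have [sq qL qx] := tilt_sublinear sL Dx.
  have qp y : D y -> tilt L x y <= tilt p g y.
    by move=> Dy; apply: le_trans (qL y Dy) (Lp y Dy).
  have /asboolP/= := Lmin (exist _ (tilt L x) (conj sq qp)) (asboolT qL).
  by move=> /(_ (- x) (DN Dx)) h; exact: le_trans h qx.
have [LD LZ] := sL.
exists L; split.
- move=> x y Dx Dy; apply/le_anti; rewrite LD//=.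
  have := LD (x + y) (- y) (DD Dx Dy) (DN Dy); rewrite addrK LN//; lra.
- have LZge t x : 0 <= t -> D x -> L (t *: x) = t * L x.
    move=> tge0 Dx; apply/le_anti; rewrite LZ//=.
    by have := LZ t (- x) tge0 (DN Dx); rewrite scalerN !LN ?mulrN ?lerN2//; exact: DZ.
  move=> t x Dx; have [tge0|tlt0] := leP 0 t; first exact: LZge.
  rewrite -[t]opprK scaleNr LN; last exact: DZ.
  by rewrite LZge ?mulNr// oppr_ge0 ltW.
- by move=> x Dx; exact: le_trans (Lp x Dx) (p0p x Dx).
- apply/le_anti; rewrite (le_trans (Lp g Dg) (p0p g Dg))/=.
  by have := Lp (- g) (DN Dg); rewrite LN//; lra.
Qed.

End HahnBanach.

(** * Lipschitz minorants of indicator functions *)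

Section Bump.
Variables (R : realType) (n : nat).
Local Notation V := 'rV[R]_n.
Implicit Types (G : set V) (x : V).

(* The largest [k]-Lipschitz minorant of the indicator function of [G]. *)
Definition bump G (k : R) : V -> R := infconv setT (\1_G) k.

Lemma indic_bounds G x : (0 <= \1_G x :> R) && (\1_G x <= 1 :> R).
Proof. by rewrite indicE; case: (_ \in _); rewrite ?lexx ler01. Qed.

Let bump_lb G (k : R) : 0 <= k -> forall x z,
  [set \1_G u + k * enorm (u - x) | u in setT] z -> 0 <= z.
Proof.
by move=> k0 x _ [u _ <-]; rewrite addr_ge0 ?mulr_ge0 ?enorm_ge0.
Qed.

Let bump_ne G (k : R) x : [set \1_G u + k * enorm (u - x) | u in setT] !=set0.
Proof. by exists (\1_G x + k * enorm (x - x)); exists x. Qed.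

Lemma bump_ge0 G (k : R) x : 0 <= k -> 0 <= bump G k x.
Proof. by move=> k0; apply: le_inf_lb; [exact: bump_ne|exact: bump_lb]. Qed.

Lemma bump_le G (k : R) x : 0 <= k -> bump G k x <= \1_G x :> R.
Proof.
move=> k0; apply: (inf_lb_le (bump_lb k0 (x := x))); exists x => //.
by rewrite subrr enorm0 mulr0 addr0.
Qed.

Lemma bump_continuous G (k : R) : 0 <= k -> continuous (bump G k).
Proof.
move=> k0; apply: lip_continuous; apply: (infconv_lip (b := 0)) => //; by exists 0.
Qed.

Lemma bump_mono G (k l : R) x : 0 <= k -> k <= l -> bump G k x <= bump G l x.
Proof.
move=> k0 kl; apply: le_inf_lb; first exact: bump_ne.
move=> _ [u _ <-]; apply: (@le_trans _ _ (\1_G u + k * enorm (u - x))).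
  by apply: (inf_lb_le (bump_lb k0 (x := x))); exists u.
by rewrite lerD2l ler_wpM2r// enorm_ge0.
Qed.

Lemma bump_gt0 G (k : R) x : 0 < k -> open G -> G x -> 0 < bump G k x.
Proof.
move=> k0 /open_eballP oG Gx; have [r r0 xr] := oG x Gx.
apply: (@lt_le_trans _ _ (Num.min 1 (k * r))).
  by rewrite lt_min ltr01 mulr_gt0.
apply: le_inf_lb; first exact: bump_ne.
move=> _ [u _ <-]; have [ur|ru] := ltP (enorm (u - x)) r.
  rewrite indicE mem_set; last exact: xr.
  by rewrite ge_min lerDl mulr_ge0 ?enorm_ge0// ltW.
rewrite ge_min; apply/orP; right.
have /andP[h _] := indic_bounds G u.
by rewrite -[leLHS]add0r lerD// ler_pM2l.
Qed.

Lemma bump_eq1 G x : open G -> G x -> exists k : nat, bump G k%:R x = 1.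
Proof.
move=> /open_eballP oG Gx; have [r r0 xr] := oG x Gx.
exists (Num.truncn r^-1).+1; apply/le_anti/andP; split.
  apply: le_trans (bump_le _ _ _) _; first exact: ler0n.
  by have /andP[] := indic_bounds G x.
have kr : 1 <= (Num.truncn r^-1).+1%:R * r.
  by rewrite -ler_pdivrMr// mul1r ltW// truncnS_gt.
apply: le_inf_lb; first exact: bump_ne.
move=> _ [u _ <-]; have [ur|ru] := ltP (enorm (u - x)) r.
  rewrite indicE mem_set; last exact: xr.
  by rewrite lerDl mulr_ge0 ?enorm_ge0.
have /andP[h _] := indic_bounds G u.
apply: le_trans kr _; rewrite -[leLHS]add0r lerD// ler_pM2l//.
Qed.

Lemma continuous_max (f : V -> R) (a : R) : continuous f ->
  continuous (fun x => Num.max (f x) a).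
Proof.
move=> cf x; apply/continuous_atP => e e0.
have /continuous_atP/(_ e e0)[d d0 xd] := cf x; exists d => // y /xd.
by rewrite /Num.max !ltr_norml; do 2 case: ifPn => ?; lra.
Qed.

Lemma measurable_continuous (f : V -> R) : continuous f ->
  measurable_fun setT (EFin \o f : BV R n -> \bar R).
Proof.
move=> cf; apply: (measurability _ (ErealGenOInfty.measurableE R)) => _ [_ [a ->] <-].
rewrite setTI (_ : _ @^-1` _ = f @^-1` [set t | a < t]).
  apply: measurable_open; apply: open_comp; last exact: open_gt.
  by move=> x _; exact: cf.
by apply/seteqP; split=> x /=; rewrite in_itv/= andbT lte_fin.
Qed.

End Bump.

(** * The Riesz measure of a positive functional *)

Section Riesz.
Variables (R : realType) (n : nat) (K : set 'rV[R]_n) (L : ('rV[R]_n -> R) -> R).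
Local Notation V := 'rV[R]_n.
Hypothesis cK : compact K.
Hypothesis LD : forall f g : V -> R, continuous f -> continuous g ->
  L (fun x => f x + g x) = L f + L g.
Hypothesis LZ : forall (a : R) (f : V -> R), continuous f ->
  L (fun x => a * f x) = a * L f.
Hypothesis Lge0 : forall f : V -> R, continuous f ->
  (forall x, K x -> 0 <= f x) -> 0 <= L f.
Hypothesis L1 : L (fun=> 1) = 1.
Implicit Types (G H : set V) (f g : V -> R).

Lemma functional_le f g : continuous f -> continuous g ->
  (forall x, K x -> f x <= g x) -> L f <= L g.
Proof.
move=> cf cg fg.
have cNf : continuous (fun x => -1 * f x) by move=> x; apply: continuousZ_at; exact: cf.
have : 0 <= L (fun x => g x + -1 * f x).
  apply: Lge0 => [x|x Kx]; first exact: (continuousD_at (cg x) (cNf x)).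
  by have := fg x Kx; lra.
by rewrite LD// LZ//; lra.
Qed.

Lemma functional_cst a : L (fun=> a) = a.
Proof.
rewrite (_ : (fun=> a) = (fun x : V => a * (fun=> 1) x)); last first.
  by apply/funext => x; rewrite mulr1.
by rewrite LZ ?L1 ?mulr1//; exact: cst_continuous.
Qed.

Definition below G := [set f : V -> R | continuous f /\ forall x, f x <= \1_G x].
(** Open sets are measured from inside by continuous functions; [outer] then measures all sets from
    outside by open ones. *)
Definition nu G := sup [set L f | f in below G].

Let below0 G : below G (fun=> 0).
Proof.
split=> [|x]; first exact: cst_continuous.
by have /andP[] := indic_bounds G x.
Qed.

Lemma nu_ub G f : below G f -> L f <= nu G.
Proof.
move=> fG; apply: ub_le_sup; last by exists f.
exists 1 => _ [g [cg gG] <-]; rewrite -L1; apply: functional_le => //.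
  exact: cst_continuous.
by move=> x _; apply: le_trans (gG x) _; have /andP[] := indic_bounds G x.
Qed.

Lemma nu_le G a : (forall f, below G f -> L f <= a) -> nu G <= a.
Proof.
move=> Ga; apply: ge_sup; first by exists (L (fun=> 0)); exists (fun=> 0).
by move=> _ [f /Ga + <-].
Qed.

Lemma nu_ge0 G : 0 <= nu G.
Proof.
by rewrite -(functional_cst 0); apply: nu_ub.
Qed.

Lemma nu_mono G H : G `<=` H -> nu G <= nu H.
Proof.
move=> GH; apply: nu_le => f [cf fG]; apply: nu_ub; split=> // x.
apply: le_trans (fG x) _; rewrite !indicE ler_nat.
by have [/set_mem/GH/mem_set->|] := boolP (x \in G).
Qed.

Lemma nu_setT : nu setT = 1.
Proof.
apply/le_anti/andP; split.
  apply: nu_le => f [cf fT]; rewrite -L1; apply: functional_le => //.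
    exact: cst_continuous.
  by move=> x _; have := fT x; rewrite indicT.
rewrite -[leLHS]L1; apply: nu_ub; split; first exact: cst_continuous.
by move=> x; rewrite indicT.
Qed.

(** The number of terms and the Lipschitz constant grow together, so that one index governs both and
    the sums increase with it. *)
Let sumb (G : nat -> set V) (m : nat) (x : V) : R := \sum_(j < m) bump (G j) m%:R x.

Let sumb_cont (G : nat -> set V) m : continuous (sumb G m).
Proof.
move=> x; rewrite /sumb; elim: (index_enum _) => [|i l IH].
  rewrite (_ : (fun _ => _) = (fun=> 0)); first exact: cst_continuous.
  by apply/funext => z; rewrite big_nil.
rewrite (_ : (fun _ => _) =
  (fun z : V => bump (G i) m%:R z + \sum_(j <- l) bump (G j) m%:R z)).
  by apply: continuousD_at IH; exact: bump_continuous.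
by apply/funext => z; rewrite big_cons.
Qed.

Let sumb_mono (G : nat -> set V) m m' x : (m <= m')%N -> sumb G m x <= sumb G m' x.
Proof.
move=> mm'; rewrite /sumb.
apply: (@le_trans _ _ (\sum_(0 <= j < m) bump (G j) m'%:R x)).
  by rewrite big_mkord; apply: ler_sum => i _; apply: bump_mono; rewrite ?ler_nat.
rewrite -(big_mkord xpredT (fun j => bump (G j) m'%:R x)).
rewrite (big_cat_nat (leq0n m) mm')/= lerDl; apply: sumr_ge0 => i _; exact: bump_ge0.
Qed.

Let L_sumb (G : nat -> set V) m : L (sumb G m) <= \sum_(j < m) nu (G j).
Proof.
have bm j : L (bump (G j) m%:R) <= nu (G j).
  by apply: nu_ub; split=> [|x]; [exact: bump_continuous|exact: bump_le].
rewrite /sumb; set r := index_enum _.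
suff [_ ->] : continuous (fun x => \sum_(j <- r) bump (G j) m%:R x) /\
    L (fun x => \sum_(j <- r) bump (G j) m%:R x) =
    \sum_(j <- r) L (bump (G (j : 'I_m)) m%:R).
  by apply: ler_sum.
elim: r => [|i l [cl IH]].
  rewrite (_ : (fun _ => _) = (fun=> 0)); last by apply/funext => z; rewrite big_nil.
  by rewrite big_nil functional_cst; split=> //; exact: cst_continuous.
rewrite (_ : (fun _ => _) =
  (fun z : V => bump (G i) m%:R z + \sum_(j <- l) bump (G j) m%:R z)); last first.
  by apply/funext => z; rewrite big_cons.
have ci := @bump_continuous _ _ (G i) m%:R (ler0n _ m).
split; first by move=> x; exact: (continuousD_at (ci x) (cl x)).
by rewrite LD// IH big_cons.
Qed.

(** At a point of the union some bump reaches [1], and outside it [f <= 0]; so [f < e + sumb G m]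
    for some [m] depending on the point. Compactness of [K] and monotonicity in [m] make [m]
    uniform. *)
Lemma nu_countable (G : nat -> set V) (f : V -> R) e : (forall j, open (G j)) ->
  below (\bigcup_j G j) f -> 0 < e ->
  exists m, L f <= e + \sum_(j < m) nu (G j).
Proof.
move=> oG [cf fG] e0.
pose P (A : set V) := exists m, forall x, A x -> f x < e + sumb G m x.
have [H [_ KH [m Hm]]] : exists H, [/\ open H, K `<=` H & P H].
  apply: compact_ind => //.
  - by move=> A B AB [m Hm]; exists m => x /AB; exact: Hm.
  - by exists 0%N.
  - move=> A B [m Hm] [m' Hm']; exists (maxn m m') => x [/Hm|/Hm'] h;
      apply: lt_le_trans h _; rewrite lerD2l; apply: sumb_mono.
      exact: leq_maxl.
    exact: leq_maxr.
  - move=> x Kx.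
    have [m Hm] : exists m, f x < e + sumb G m x.
      have [fx0|fx0] := leP (f x) 0.
        by exists 0%N; rewrite /sumb big_ord0; lra.
      have [j _ Gjx] : (\bigcup_j G j) x.
        apply: contrapT => nG; have := fG x; rewrite indicE memNset//.
        by rewrite leNgt fx0.
      have [k kx] := bump_eq1 (oG j) Gjx.
      exists (maxn j.+1 k); apply: (@lt_le_trans _ _ (e + 1)).
        apply: (@le_lt_trans _ _ 1); last by rewrite ltrDr.
        by apply: le_trans (fG x) _; have /andP[] := indic_bounds (\bigcup_j G j) x.
      rewrite lerD2l /sumb.
      have jm : (j < maxn j.+1 k)%N by rewrite leq_max ltnSn.
      rewrite (bigD1 (Ordinal jm))//= -[leLHS]addr0 lerD//.
        by rewrite -[leLHS]kx; apply: bump_mono; rewrite ?ler_nat ?leq_maxr.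
      by apply: sumr_ge0 => i _; exact: bump_ge0.
    have d0 : 0 < (e + sumb G m x - f x) / 2 by rewrite divr_gt0// subr_gt0.
    have /continuous_atP/(_ _ d0)[r r0 xr] := cf x.
    have /continuous_atP/(_ _ d0)[r' r'0 xr'] := @sumb_cont G m x.
    exists (Num.min r r'); first by rewrite lt_min r0.
    exists m => y; rewrite /eball /= lt_min => /andP[/xr + /xr'].
    rewrite !ltr_norml; lra.
exists m; apply: (@le_trans _ _ (L (fun x => e + sumb G m x))).
  apply: functional_le => // [x|x /KH/Hm/ltW//].
  by apply: continuousD_at; [exact: cst_continuous|exact: sumb_cont].
rewrite LD ?functional_cst ?lerD2l ?L_sumb//; first exact: cst_continuous.
Qed.

Definition outer (X : set V) : \bar R :=
  (inf [set nu G | G in [set G | open G /\ X `<=` G]])%:E.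

Let outer_lb X : forall z, [set nu G | G in [set G | open G /\ X `<=` G]] z -> 0 <= z.
Proof. by move=> _ [G _ <-]; exact: nu_ge0. Qed.

Let outer_ne X : [set nu G | G in [set G | open G /\ X `<=` G]] !=set0.
Proof. by exists (nu setT); exists setT => //; split=> //; exact: openT. Qed.

Lemma outer_le X G : open G -> X `<=` G -> (outer X <= (nu G)%:E)%E.
Proof.
by move=> oG XG; rewrite lee_fin; apply: (inf_lb_le (@outer_lb X)); exists G.
Qed.

Lemma outer_open G : open G -> outer G = (nu G)%:E.
Proof.
move=> oG; apply/le_anti/andP; split; first exact: outer_le.
rewrite lee_fin; apply: le_inf_lb; first exact: outer_ne.
by move=> _ [H [_ GH] <-]; exact: nu_mono.
Qed.

Lemma outer_approx X e : 0 < e -> exists G, [/\ open G, X `<=` G &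
  ((nu G)%:E <= outer X + e%:E)%E].
Proof.
move=> e0; have [_ [G [oG XG] <-] h] := inf_approx (@outer_ne X) (@outer_lb X) e0.
by exists G; split=> //; rewrite -EFinD lee_fin ltW.
Qed.

Let outer_ge0 X : (0 <= outer X)%E.
Proof. by rewrite lee_fin; apply: le_inf_lb; [exact: outer_ne|exact: outer_lb]. Qed.

Let outer_mono : {homo outer : A B / A `<=` B >-> (A <= B)%E}.
Proof.
move=> A B AB; rewrite lee_fin; apply: le_inf_lb; first exact: outer_ne.
move=> _ [G [oG BG] <-]; rewrite -lee_fin; apply: outer_le => //.
exact: subset_trans BG.
Qed.

Let outer0 : outer set0 = 0%E.
Proof.
apply/le_anti; rewrite outer_ge0 andbT outer_open; last exact: open0.
rewrite lee_fin; apply: nu_le => f [cf f0]; rewrite -(functional_cst 0).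
apply: functional_le => //; first exact: cst_continuous.
by move=> x _; have := f0 x; rewrite indic0.
Qed.

Let outer_subadd : sigma_subadditive outer.
Proof.
move=> X; apply/lee_addgt0Pr => e e0.
have e20 : 0 < e / 2 by rewrite divr_gt0.
have ej (j : nat) : 0 < e / 4 / 2 ^+ j by rewrite divr_gt0 ?exprn_gt0// divr_gt0.
have /choice[G HG] : forall j, exists G, [/\ open G, X j `<=` G &
    ((nu G)%:E <= outer (X j) + (e / 4 / 2 ^+ j)%:E)%E].
  by move=> j; exact: outer_approx.
apply: (@le_trans _ _ (nu (\bigcup_j G j))%:E).
  apply: outer_le; first by apply: bigcup_open => j _; have [] := HG j.
  by apply: subset_bigcup => j _; have [] := HG j.
have geo m : \sum_(j < m) (e / 4 / 2 ^+ j) <= e / 2.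
  suff : \sum_(j < m) (e / 4 / 2 ^+ j) = e / 2 - e / 2 / 2 ^+ m.
    by move=> ->; rewrite gerBl// divr_ge0// ?exprn_ge0// ltW.
  elim: m => [|m IH]; first by rewrite big_ord0 expr0 divr1 subrr.
  rewrite big_ord_recr/= IH exprS; field.
  by rewrite expf_neq0.
have key f : below (\bigcup_j G j) f -> ((L f)%:E <= \sum_(i <oo) outer (X i) + e%:E)%E.
  move=> fG; have oG j : open (G j) by have [] := HG j.
  have [m Hm] := nu_countable oG fG e20.
  apply: (@le_trans _ _ ((e / 2) + \sum_(j < m) nu (G j))%:E); first by rewrite lee_fin.
  apply: (@le_trans _ _ ((\sum_(j < m) outer (X j)) + e%:E)%E); last first.
    rewrite leeD2r// -(big_mkord xpredT (fun j => outer (X j))).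
    exact: nneseries_lim_ge.
  rewrite /outer sumEFin -EFinD lee_fin.
  have : \sum_(j < m) nu (G j) <= \sum_(j < m)
      (inf [set nu G | G in [set G | open G /\ X j `<=` G]] + e / 4 / 2 ^+ j).
    by apply: ler_sum => j _; have [_ _] := HG j; rewrite /outer -EFinD lee_fin.
  rewrite big_split/=; have := geo m; lra.
case: (\sum_(i <oo) outer (X i) + e%:E)%E key => [t| |] key; last 2 first.
- exact: leey.
- by have := key _ (below0 _); rewrite leeNy_eq.
- by rewrite lee_fin; apply: nu_le => f /key; rewrite lee_fin.
Qed.

HB.instance Definition _ := isOuterMeasure.Build R V outer
  outer0 outer_ge0 outer_mono outer_subadd.

(** For [f] below the intersection, let [g] be the positive part of [f - e], and let [h] be below
    [H'], the part of [H] where [f < e]. Where [f < e] the function [g] vanishes, and elsewhere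
    [h <= 0]; so [g + h] is below [H]. Moreover [H'] contains the difference of [H] and [G]. *)
Lemma nu_split G H : open G -> open H ->
  ((nu (H `&` G))%:E + outer (H `\` G) <= (nu H)%:E)%E.
Proof.
move=> oG oH.
pose o := inf [set nu G' | G' in [set G' | open G' /\ (H `\` G) `<=` G']].
rewrite (_ : outer _ = o%:E)// -EFinD lee_fin -lerBrDr; apply: nu_le => f [cf fHG].
apply/ler_addgt0Pr => e e0.
pose g x := Num.max (f x + - e) 0.
have cfe : continuous (fun x => f x + - e).
  by move=> x; apply: continuousD_at; [exact: cf|exact: cst_continuous].
have cg : continuous g by exact: continuous_max.
pose H' := H `&` [set x | f x < e].
have oH' : open H'.
  apply: openI => //; apply: (@open_comp _ _ f [set t | t < e]); last exact: open_lt.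
  by move=> x _; exact: cf.
have oH'H : o <= nu H'.
  rewrite -lee_fin; apply: outer_le => // x [Hx nGx]; split=> //=.
  apply: le_lt_trans (fHG x) _; rewrite indicE memNset//.
  by move=> -[].
have gh h : below H' h -> L g + L h <= nu H.
  move=> [ch hH']; rewrite -LD//; apply: nu_ub; split.
    by move=> x; exact: (continuousD_at (cg x) (ch x)).
  move=> x; rewrite /g; have [fe|fe] := ltP (f x) e.
    rewrite max_r; last by lra.
    rewrite add0r; apply: le_trans (hH' x) _; rewrite !indicE ler_nat.
    by have [/set_mem[Hx _]|] := boolP (x \in H'); first by rewrite mem_set.
  rewrite max_l; last by lra.
  have := hH' x; rewrite indicE memNset; last by move=> [_ /=]; lra.
  have := fHG x; rewrite !indicE.
  have [/set_mem[Hx _]|_] := boolP (x \in H `&` G); first by rewrite (mem_set Hx) /=; lra.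
  have : 0 <= (x \in H)%:R :> R by [].
  by rewrite /=; lra.
have : nu H' <= nu H - L g.
  by apply: nu_le => h /gh; lra.
have : L f <= L (fun x => g x + e).
  apply: functional_le => // [x|x _].
    by apply: continuousD_at; [exact: cg|exact: cst_continuous].
  have : f x + - e <= g x by rewrite le_max lexx.
  lra.
rewrite LD//; last exact: cst_continuous.
rewrite functional_cst; lra.
Qed.

Lemma outer_caratheodory G : open G -> caratheodory_measurable outer G.
Proof.
move=> oG; apply: le_caratheodory_measurable => X.
apply/lee_addgt0Pr => e e0; have [H [oH XH hH]] := outer_approx X e0.
apply: le_trans hH; apply: le_trans (nu_split oG oH); apply: leeD.
  by apply: outer_le; [exact: openI|exact: setSI].
by apply: outer_mono; rewrite setDE; exact: setSI.
Qed.

Lemma outer_borel (A : set (BV R n)) : measurable A -> caratheodory_measurable outer A.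
Proof.
apply: smallest_sub; last by move=> G; exact: outer_caratheodory.
split.
- exact: caratheodory_measurable_set0.
- by move=> A0 mA; rewrite setTD; exact: caratheodory_measurable_setC.
- exact: caratheodory_measurable_bigcup.
Qed.

Definition riesz_measure : set (BV R n) -> \bar R := outer.

Let riesz0 : riesz_measure set0 = 0%E. Proof. exact: outer0. Qed.
Let riesz_ge0 X : (0 <= riesz_measure X)%E. Proof. exact: outer_ge0. Qed.

Let riesz_sigma_additive : semi_sigma_additive riesz_measure.
Proof.
move=> F mF tF mUF.
by apply: (@caratheodory_measure_sigma_additive R V outer F) => //;
  [move=> i; exact/outer_borel|exact/outer_borel].
Qed.

HB.instance Definition _ := isMeasure.Build _ (BV R n) R riesz_measure
  riesz0 riesz_ge0 riesz_sigma_additive.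

Lemma riesz_open G : open G -> riesz_measure G = (nu G)%:E.
Proof. exact: outer_open. Qed.

Lemma riesz_setC : riesz_measure (~` K) = 0%E.
Proof.
have oK : open (~` K) by apply: closed_openC; exact: compact_closedV.
rewrite riesz_open//; congr EFin; apply/le_anti; rewrite nu_ge0 andbT.
apply: nu_le => f [cf fK]; rewrite -(functional_cst 0).
apply: functional_le => //; first exact: cst_continuous.
by move=> x Kx; apply: le_trans (fK x) _; rewrite indicE memNset// => /(_ Kx).
Qed.

Lemma riesz_support : riesz_measure K = 1%E.
Proof.
have mK := measurable_compact cK.
have mCK : measurable (~` K : set (BV R n)) by exact: measurableC.
rewrite -nu_setT -riesz_open; last exact: openT.
by rewrite -(setUv K) measureU0//; exact: riesz_setC.
Qed.

(** The function is cut into horizontal slices of height [d]. The integral of the lowest slice is at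
    most [d nu {f > 0}], and [L] of it is at least [d nu {f > d}], which is the error term for the
    function above it. Thus the errors telescope to [d nu {phi > 0} <= d]. *)
Lemma riesz_integral (phi : V -> R) : continuous phi -> (forall x, 0 <= phi x) ->
  (\int[riesz_measure]_(y in (K : set (BV R n))) (phi y)%:E <= (L phi)%:E)%E.
Proof.
have mK := measurable_compact cK.
have mcont (f : V -> R) : continuous f ->
    measurable_fun (K : set (BV R n)) (fun y : BV R n => (f y)%:E).
  move=> /measurable_continuous; apply: (@measurable_funS _ _ (BV R n) _ setT).
    exact: measurableT.
  exact: subsetT.
have opos (f : V -> R) (a : R) : continuous f -> open [set x | a < f x].
  move=> cf; apply: (@open_comp _ _ f [set t | a < t]); last exact: open_gt.
  by move=> x _; exact: cf.
have step (d : R) : 0 < d -> forall N (f : V -> R), continuous f ->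
    (forall x, 0 <= f x) -> (forall x, K x -> f x <= N%:R * d) ->
    (\int[riesz_measure]_(y in (K : set (BV R n))) (f y)%:E <=
     (d * nu [set x | 0 < f x] + L f)%:E)%E.
  move=> d0; elim=> [|N IH] f cf f0 fN.
    rewrite integral0_eq.
      rewrite lee_fin addr_ge0 ?mulr_ge0 ?nu_ge0 ?(ltW d0)//.
      by apply: Lge0.
    move=> x Kx; congr EFin; apply/le_anti; rewrite f0 andbT.
    by have := fN x Kx; rewrite mul0r.
  pose f1 x := Num.max (f x + - d) 0.
  pose f0' x := f x + -1 * f1 x.
  have cfd : continuous (fun x => f x + - d).
    by move=> x; apply: continuousD_at; [exact: cf|exact: cst_continuous].
  have cf1 : continuous f1 by exact: continuous_max.
  have cf0' : continuous f0'.
    by move=> x; apply: continuousD_at; [exact: cf|apply: continuousZ_at; exact: cf1].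
  have f1E x : f1 x = if d < f x then f x - d else 0.
    rewrite /f1; case: ltP => fd; [rewrite max_l|rewrite max_r]; lra.
  have f10 x : 0 <= f1 x by rewrite f1E; case: ifPn => //; lra.
  have f0'0 x : 0 <= f0' x by rewrite /f0' f1E; have := f0 x; case: ifPn; lra.
  have fE x : f x = f0' x + f1 x by rewrite /f0'; lra.
  have -> : L f = L f0' + L f1 by rewrite -LD//; congr L; apply/funext => x.
  under eq_integral do rewrite fE EFinD.
  have -> : (\int[riesz_measure]_(y in (K : set (BV R n))) ((f0' y)%:E + (f1 y)%:E) =
      \int[riesz_measure]_(y in (K : set (BV R n))) (f0' y)%:E +
      \int[riesz_measure]_(y in (K : set (BV R n))) (f1 y)%:E)%E.
    apply: ge0_integralD => //.
    - by move=> x _; rewrite lee_fin.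
    - exact: mcont.
    - by move=> x _; rewrite lee_fin.
    - exact: mcont.
  have h1 : d * nu [set x | 0 < f1 x] <= L f0'.
    rewrite -ler_pdivlMl//; apply: nu_le => h [ch hf].
    rewrite ler_pdivlMl// -LZ//; apply: functional_le => //.
      by move=> x; apply: continuousZ_at; exact: ch.
    move=> x _; have := hf x; rewrite indicE /f0' f1E.
    have [/set_mem /=|/negP nx] := boolP (_ \in _).
      rewrite f1E; case: ifPn => [fd _|]; last by rewrite ltxx.
      by move=> /(ler_wpM2l (ltW d0)); rewrite mulr1; lra.
    case: ifPn => [fd|_].
      by exfalso; apply: nx; apply: mem_set; rewrite /= f1E fd subr_gt0.
    by move=> /(ler_wpM2l (ltW d0)); rewrite mulr0; have := f0 x; lra.
  have h2 : (\int[riesz_measure]_(y in (K : set (BV R n))) (f0' y)%:E <=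
      (d * nu [set x | 0 < f x])%:E)%E.
    have mP : measurable ([set x | (0 : R) < f x] : set (BV R n)).
      by apply: measurable_open; exact: opos.
    apply: (@le_trans _ _ (\int[riesz_measure]_(y in (K : set (BV R n)))
        (d%:E * (\1_([set x | (0 : R) < f x]) y)%:E))%E).
      apply: ge0_le_integral => //.
      - by move=> x _; rewrite lee_fin.
      - exact: mcont.
      - apply: measurable_funeM; apply/measurable_EFinP; exact: measurable_indic.
      move=> x _; rewrite -EFinM lee_fin indicE /f0' f1E.
      have [_|/negP nx] := boolP (_ \in _); first by rewrite mulr1; case: ifPn; have := f0 x; lra.
      have : f x <= 0 by rewrite leNgt; apply/negP => fx; apply: nx; exact: mem_set.
      by rewrite mulr0; case: ifPn; lra.
    rewrite ge0_integralZl_EFin//; last 2 first.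
    - apply/measurable_EFinP; exact: measurable_indic.
    - exact: ltW.
    rewrite integral_indic// EFinM; apply: lee_wpmul2l; first by rewrite lee_fin ltW.
    rewrite -riesz_open; last exact: opos.
    by apply: outer_mono; exact: subIsetl.
  apply: le_trans (leeD h2 (IH f1 cf1 f10 _)) _.
    by move=> x /fN; rewrite f1E mulrSr mulrDl mul1r; case: ifPn => //; have := ler0n R N; nra.
  by rewrite -EFinD lee_fin; lra.
move=> cphi phi0.
have [M M0 KM] : exists2 M : R, 0 < M & forall x, K x -> phi x <= M.
  have [K0|/set0P/negP/negPn/eqP->] := pselect (K !=set0); last by exists 1.
  have [y Ky ymax] := compact_maxP K0 cK (within_continuousT cphi).
  exists (phi y + 1) => [|x /ymax]; last by lra.
  by rewrite ltr_wpDl.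
apply/lee_addgt0Pr => e e0; rewrite -EFinD.
apply: le_trans (step _ e0 (Num.truncn (M / e)).+1 phi cphi phi0 _) _.
  move=> x /KM /le_trans; apply; rewrite -ler_pdivrMr// ltW// truncnS_gt//.
rewrite lee_fin addrC lerD2l -[leRHS]mulr1 ler_pM2l// -nu_setT; exact: nu_mono.
Qed.

Lemma riesz : exists mu : {measure set (BV R n) -> \bar R},
  [/\ mu (~` K) = 0%E, mu K = 1%E,
      forall G f, open G -> below G f -> ((L f)%:E <= mu G)%E &
      forall f, continuous f -> (forall x, 0 <= f x) ->
        (\int[mu]_(y in (K : set (BV R n))) (f y)%:E <= (L f)%:E)%E].
Proof.
exists riesz_measure; split; [exact: riesz_setC|exact: riesz_support| |exact: riesz_integral].
by move=> G f oG fG; rewrite [leRHS]riesz_open// lee_fin; exact: nu_ub.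
Qed.

End Riesz.

(** * Reduced functions *)

Section Duality.
Variables (R : realType) (n : nat).
Local Notation V := 'rV[R]_n.
Hypothesis n1 : (1 < n)%N.

(** Let [p f] be the infimum at [x] of the superharmonic majorants of [f] on [K]. A linear [L <= p]
    carries everything at once: tested on nonpositive functions it is positive, on constants it has
    mass one, and on superharmonic functions it satisfies the Jensen inequality. If the conclusion
    failed, [L] equal to [p] at the bump would be at least [eta] there, and the measure would charge
    the complement of [E]. *)
Lemma support_reduced (K E : set V) x (eta : R) : compact K -> closed E -> E `<=` K ->
  K x -> (forall mu, jensen_cpt K x mu -> supp mu `<=` E) -> 0 < eta ->
  exists W s, [/\ K `<=` W, csh W s, forall y, K y -> bump (~` E) 1 y <= s y & s x < eta].
Proof.
move=> cK cE EK Kx HS eta0; apply: contrapT => Hno.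
have n0 : (0 < n)%N by exact: ltnW.
pose S (f : V -> R) := [set a | exists W s, [/\ K `<=` W, csh W s,
  forall y, K y -> f y <= s y & a = s x]].
pose p (f : V -> R) := inf (S f).
have Slb f a : S f a -> f x <= a by move=> [W [s [_ _ fs ->]]]; exact: fs.
have Scst f a : (forall y, K y -> f y <= a) -> S f a.
  move=> fa; exists setT, (fun=> a); split=> //; apply: csh_cst => //; exact: openT.
have S0 f : continuous f -> S f !=set0.
  move=> cf; have [y Ky ymax] := compact_maxP (ex_intro _ x Kx) cK (within_continuousT cf).
  by exists (f y); exact: Scst.
have pS f a : S f a -> p f <= a by apply: inf_lb_le; exact: Slb.
have p_cst f a : (forall y, K y -> f y <= a) -> p f <= a by move=> /Scst/pS.
pose D := [set f : V -> R^o | continuous f].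
have D0 : D 0 by exact: cst_continuous.
have DD f g : D f -> D g -> D (f + g).
  by move=> cf cg y; exact: (continuousD_at (cf y) (cg y)).
have DZ t f : D f -> D (t *: f) by move=> cf y; apply: continuousZ_at; exact: cf.
have sp : sublinear D (p : (V -> R^o) -> R).
  split=> [f g cf cg|t f t0 cf].
    apply/ler_addgt0Pr => e e0; have e20 : 0 < e / 2 by rewrite divr_gt0.
    have [a [W [s [KW sW fs ->]]] ha] := inf_approx (S0 f cf) (Slb f) e20.
    have [b [W' [s' [KW' sW' gs ->]]] hb] := inf_approx (S0 g cg) (Slb g) e20.
    apply: (@le_trans _ _ (s x + s' x)); last by rewrite -/(p f) -/(p g) in ha hb *; lra.
    apply: pS; exists (W `&` W'), (fun y => s y + s' y).
    have oW : open (W `&` W') by apply: openI; [case: sW|case: sW'].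
    split=> //; first by move=> y Ky; split; [exact: KW|exact: KW'].
      by apply: csh_add => //; [apply: csh_sub sW|apply: csh_sub sW'] => // y [].
    by move=> y Ky; apply: lerD; [exact: fs|exact: gs].
  have [->|tn0] := eqVneq t 0.
    by rewrite mul0r scale0r; apply: p_cst.
  have tp : 0 < t by rewrite lt_def tn0.
  rewrite -ler_pdivrMl//; apply: le_inf_lb; first exact: S0.
  move=> _ [W [s [KW sW fs ->]]]; rewrite ler_pdivrMl//; apply: pS.
  exists W, (fun y => t * s y); split=> //; first exact: csh_scale.
  by move=> y Ky; rewrite ler_pM2l//; exact: fs.
have cb : D (bump (~` E) 1) by exact: bump_continuous.
have [L [LD LZ Lp Lb]] := hahn_banach D0 DD DZ sp cb.
have Lge0 (f : V -> R) : continuous f -> (forall y, K y -> 0 <= f y) -> 0 <= L f.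
  move=> cf f0; have := Lp _ (DZ (-1) f cf); rewrite LZ// mulN1r => h.
  have : p ((-1 : R) *: (f : V -> R^o)) <= 0.
    by apply: p_cst => y /f0 fy; rewrite [leLHS](mulN1r (f y)) oppr_le0.
  lra.
have D1 : D (fun=> 1) by exact: cst_continuous.
have L1 : L (fun=> 1) = 1.
  apply/le_anti/andP; split; first by apply: le_trans (Lp _ D1) _; exact: p_cst.
  have := Lp _ (DZ (-1) _ D1); rewrite LZ// mulN1r => h.
  have : p ((-1 : R) *: ((fun=> 1) : V -> R^o)) <= -1.
    by apply: p_cst => y _; rewrite [leLHS](mulN1r 1).
  lra.
have [mu [muC muK muG muI]] := @riesz R n K L cK LD (fun a f cf => LZ a f cf) Lge0 L1.
have J : jensen_cpt K x mu.
  apply: (csh_jensen n1) => //.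
    move=> y ys; apply: contrapT => nKy.
    have oK : open (~` K) by apply: closed_openC; exact: compact_closedV.
    by have := ys _ oK nKy; rewrite muC ltxx.
  move=> W s KW sW s0; apply/lee_addgt0Pr => e e0.
  have e20 : 0 < e / 2 by rewrite divr_gt0.
  have csK : {within K, continuous s} by case: sW => _ cs _; exact: within_continuous_in cs KW.
  (* [L] is controlled only on functions continuous on the whole space, and [riesz] integrates
     nonnegative ones; so [s] gives way to a polynomial close to it on [K], raised by [e / 2] and
     cut at [0]. *)
  have [q pq sq] := weierstrass 0 cK csK e20.
  pose f y := Num.max (q y + e / 2) 0.
  have cf : continuous f.
    apply: continuous_max => y; apply: continuousD_at; last exact: cst_continuous.
    exact: pol_continuous pq y.
  apply: (@le_trans _ _ (L f)%:E).
    apply: le_trans (muI f cf _); last by move=> y; rewrite le_max lexx orbT.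
    apply: ge0_le_integral => //.
    - exact: measurable_compact.
    - apply: (@measurable_funS _ _ (BV R n) _ W) => //; last exact: (csh_measurable sW).
      by apply: measurable_open; case: sW.
    - apply: (@measurable_funS _ _ (BV R n) _ setT) => //; exact: measurable_continuous.
    - move=> y Ky; rewrite lee_fin /f le_max; apply/orP; left.
      by have := sq y Ky; rewrite ltr_norml; lra.
  rewrite -EFinD lee_fin; apply: le_trans (Lp f cf) _; apply: pS.
  exists W, (fun y => s y + e); split=> //; first exact: csh_addcst.
  move=> y Ky; have := sq y Ky; have := s0 y Ky; rewrite ltr_norml /f /Num.max.
  by case: ifP => _; lra.
have oE : open (~` E) by exact: closed_openC.
have muE : mu (~` E) = 0%E by apply: supp_null => // y nEy /(HS mu J).
have := muG _ _ oE (conj cb (fun y => bump_le (~` E) y ler01)).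
rewrite muE lee_fin Lb leNgt => /negP; apply; apply: lt_le_trans eta0 _.
apply: le_inf_lb; first exact: S0.
move=> _ [W [s [KW sW fs ->]]]; rewrite leNgt; apply/negP => sx.
by apply: Hno; exists W, s.
Qed.

End Duality.

(** * Majorants near K of functions superharmonic near E *)

Section Majorant.
Variables (R : realType) (n : nat).
Local Notation V := 'rV[R]_n.
Hypothesis n1 : (1 < n)%N.
Variables (K E : set V).
Hypotheses (cK : compact K) (cE : compact E) (EK : E `<=` K).
Implicit Types (W U C : set V) (f s t : V -> R) (x y z : V).

Let n0 : (0 < n)%N. Proof. exact: ltnW. Qed.
Let g0 := bump (~` E) (1 : R).

Lemma compact_margin (C U : set V) : compact C -> open U -> C `<=` U ->
  exists2 r : R, 0 < r & forall x, C x -> cball x r `<=` U.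
Proof.
move=> cC /open_eballP oU CU.
have [H [_ CH [r r0 Hr]]] : exists H, [/\ open H, C `<=` H &
    exists2 r : R, 0 < r & forall x, H x -> cball x r `<=` U].
  apply: compact_ind => //.
  - by move=> A B AB [r r0 Br]; exists r => // x /AB; exact: Br.
  - by exists 1.
  - move=> A B [r r0 Ar] [r' r'0 Br]; exists (Num.min r r'); first by rewrite lt_min r0.
    by move=> x [/Ar|/Br] xU y; rewrite /cball /= le_min => /andP[y1 y2]; apply: xU.
  - move=> x /CU/oU[d d0 xd]; have d20 : 0 < d / 2 by rewrite divr_gt0.
    exists (d / 2) => //; exists (d / 3); first by rewrite divr_gt0.
    move=> y yx z zy; apply: xd; apply: cball_sub_eball zy.
    by have : enorm (y - x) < d / 2 := yx; lra.
by exists r => // x /CH; exact: Hr.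
Qed.

Lemma csh_addI (W W' : set V) s t : csh W s -> csh W' t ->
  csh (W `&` W') (fun x => s x + t x).
Proof.
move=> sW tW'; have oW : open (W `&` W') by apply: openI; [case: sW|case: tW'].
by apply: csh_add => //; [apply: csh_sub sW|apply: csh_sub tW'] => // y [].
Qed.

Lemma csh_minI (W W' : set V) s t : csh W s -> csh W' t ->
  csh (W `&` W') (fun x => Num.min (s x) (t x)).
Proof.
move=> sW tW'; have oW : open (W `&` W') by apply: openI; [case: sW|case: tW'].
by apply: csh_min => //; [apply: csh_sub sW|apply: csh_sub tW'] => // y [].
Qed.

(* The points at which the reduced function of [g0] with respect to [K] vanishes. *)
Definition reduced_null : set V := [set x | K x /\ forall eta : R, 0 < eta ->
  exists W s, [/\ K `<=` W, csh W s, forall y, K y -> g0 y <= s y & s x < eta]].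

Lemma reduced_null_sub : reduced_null `<=` E.
Proof.
move=> x [Kx Hx]; apply: contrapT => nEx.
have oE : open (~` E) by apply: closed_openC; exact: compact_closedV.
have [W [s [_ _ gs]]] := Hx _ (bump_gt0 ltr01 oE nEx).
by have := gs x Kx; rewrite leNgt => /negP.
Qed.

(** The summands are competitors for the reduced function with values at [x] below [e / 2^(k+1)]. At
    a point of [C] all competitors are at least some [eta > 0], so the partial sums grow there at
    least like [m eta], while at [x] they stay below [e]. *)
Lemma barrier (C : set V) x (L e : R) : compact C -> C `<=` K ->
  (forall y, C y -> ~ reduced_null y) -> reduced_null x -> 0 < L -> 0 < e ->
  exists W s, [/\ K `<=` W, csh W s, forall y, K y -> 0 <= s y,
    forall y, C y -> L < s y & s x < e].
Proof.
move=> cC CK CN [Kx Hx] L0 e0.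
have ek (k : nat) : 0 < e / 2 ^+ k.+1 by rewrite divr_gt0// exprn_gt0.
have /choice[s hs] : forall k : nat, exists s, exists W, [/\ K `<=` W, csh W s,
    forall y, K y -> g0 y <= s y & s x < e / 2 ^+ k.+1].
  by move=> k; have [W [s h]] := Hx _ (ek k); exists s, W.
have gs k y : K y -> g0 y <= s k y by have [W [_ _ h _]] := hs k; exact: h.
pose S m y := \sum_(k < m) s k y.
have SS m y : S m.+1 y = S m y + s m y by rewrite /S big_ord_recr.
have S0 y : S 0%N y = 0 by rewrite /S big_ord0.
have S_csh m : exists2 W, K `<=` W & csh W (S m).
  elim: m => [|m [W KW SW]].
    exists setT => //; rewrite (_ : S 0%N = fun=> 0); first by apply: csh_cst => //; exact: openT.
    exact/funext.
  have [W' [KW' sW' _ _]] := hs m; exists (W `&` W').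
    by move=> y Ky; split; [exact: KW|exact: KW'].
  by apply: csh_ext (csh_addI SW sW') => y _; rewrite SS.
have Sx m : S m x <= e - e / 2 ^+ m.
  elim: m => [|m IH]; first by rewrite S0 expr0 divr1 subrr.
  have [_ [_ _ _]] := hs m; rewrite SS.
  have : e / 2 ^+ m = e / 2 ^+ m.+1 + e / 2 ^+ m.+1.
    by rewrite exprS; field; rewrite expf_neq0.
  lra.
have S_mono m m' y : K y -> (m <= m')%N -> S m y <= S m' y.
  move=> Ky; elim: m' => [|m' IH]; first by rewrite leqn0 => /eqP ->.
  rewrite leq_eqVlt ltnS => /orP[/eqP -> //|/IH h]; apply: le_trans h _.
  by rewrite SS lerDl; apply: le_trans (gs _ _ Ky); exact: bump_ge0.
pose P (N : set V) := exists m, forall y, K y -> N y -> L < S m y.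
have [N [_ CsN [m Hm]]] : exists N, [/\ open N, C `<=` N & P N].
  apply: compact_ind => //.
  - by move=> A B AB [m Hm]; exists m => y Ky /AB; exact: Hm.
  - by exists 0%N.
  - move=> A B [m Hm] [m' Hm']; exists (maxn m m') => y Ky [/(Hm y Ky)|/(Hm' y Ky)] h;
      apply: lt_le_trans h _; apply: S_mono => //.
      exact: leq_maxl.
    exact: leq_maxr.
  - move=> y Cy; have Ky := CK y Cy.
    have [eta eta0 Heta] : exists2 eta : R, 0 < eta & forall W s, K `<=` W -> csh W s ->
        (forall z, K z -> g0 z <= s z) -> eta <= s y.
      apply: contrapT => Hno; apply: (CN y Cy); split=> // eta eta0.
      apply: contrapT => Hno'; apply: Hno; exists eta => // W s' KW sW gs'.
      by rewrite leNgt; apply/negP => sy; apply: Hno'; exists W, s'.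
    pose m := (Num.truncn (L / eta)).+1.
    have Lm : L < m%:R * eta by rewrite -ltr_pdivrMr// truncnS_gt.
    have Sm k : k%:R * eta <= S k y.
      elim: k => [|k IH]; first by rewrite S0 mul0r.
      have [W [KW sW h _]] := hs k.
      by rewrite SS mulrSr mulrDl mul1r lerD// (Heta W).
    have [W KW [_ cS _]] := S_csh m.
    have dS : 0 < S m y - L by rewrite subr_gt0; apply: lt_le_trans Lm (Sm m).
    have /continuous_atP/(_ _ dS)[d d0 yd] := cS y (KW y Ky).
    exists d => //; exists m => z Kz /yd; rewrite ltr_norml; lra.
have [W KW SW] := S_csh m; exists W, (S m); split=> //.
- move=> y Ky; have := S_mono 0%N m y Ky (leq0n m); by rewrite S0.
- by move=> y Cy; apply: Hm; [exact: CK|exact: CsN].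
- apply: le_lt_trans (Sx m) _; rewrite ltrBlDr ltrDl divr_gt0// exprn_gt0//.
Qed.

Section Reduced.
Variables (f : V -> R) (U : set V) (kappa : R).
Hypotheses (EU : E `<=` U) (fU : csh U f) (kappa0 : 0 < kappa).

Let fk y := f y - kappa * enorm y ^+ 2.
Let adm W s := [/\ K `<=` W, csh W s & forall y, E y -> fk y <= s y].
Let S y := [set a | exists W s, adm W s /\ a = s y].
Let T y := inf (S y).

Let fk_cont : {within E, continuous fk}.
Proof.
apply: (@within_continuous_in _ _ U) => // y Uy.
have [_ cf _] := fU; have [_ cq _] := csh_quad n0 (0 : V) openT kappa0.
rewrite (_ : fk = fun z => f z + - (kappa * enorm (z - 0) ^+ 2)).
  exact: continuousD_at (cf y Uy) (cq y I).
by apply/funext => z; rewrite subr0.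
Qed.

Let adm_cst : exists a, adm setT (fun=> a).
Proof.
have [E0|/set0P/negP/negPn/eqP E0] := pselect (E !=set0); last first.
  by exists 0; split=> // [|y]; [apply: csh_cst => //; exact: openT|rewrite E0].
have [y Ey ymax] := compact_maxP E0 cE fk_cont.
by exists (fk y); split=> //; apply: csh_cst => //; exact: openT.
Qed.

Let S0 y : S y !=set0.
Proof. by have [a Ha] := adm_cst; exists a; exists setT, (fun=> a). Qed.

Let S_lb y : E y -> forall a, S y a -> fk y <= a.
Proof. by move=> Ey _ [W [s [[_ _ h] ->]]]; exact: h. Qed.

Let T_le y W s : E y -> adm W s -> T y <= s y.
Proof. by move=> Ey Hs; apply: (inf_lb_le (S_lb Ey)); exists W, s. Qed.

Let T_approx y (e : R) : E y -> 0 < e -> exists W s, adm W s /\ s y < T y + e.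
Proof.
by move=> Ey e0; have [_ [W [s [Hs ->]]] h] := inf_approx (@S0 y) (S_lb Ey) e0; exists W, s.
Qed.

Let adm_min W W' s t : adm W s -> adm W' t ->
  adm (W `&` W') (fun y => Num.min (s y) (t y)).
Proof.
move=> [KW sW fs] [KW' tW' ft]; split; last 1 first.
- by move=> y Ey; rewrite le_min fs// ft.
- by move=> y Ky; split; [exact: KW|exact: KW'].
- exact: csh_minI.
Qed.

(* Otherwise [T - fk] is nearly maximal at some [x]. Adding an affine function to [f]
   gives a function [w] which lies slightly below [T] at [x], and above [T] on the part
   of a small sphere about [x] lying in [reduced_null], as [kappa > 0]; a barrier lifts it
   above [T] on the rest of the sphere. Pasting it into an admissible function inside the
   ball gives an admissible function smaller than [T] at [x]. *)
Let reduced_le x : reduced_null x -> T x <= fk x.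
Proof.
move=> x_null; rewrite leNgt; apply/negP => fkT.
pose D y := T y - fk y.
have [oU cf _] := fU.
have [b Hb] := adm_cst.
have [M0 hM0] : exists M0, forall y, E y -> D y <= M0.
  have [E0|/set0P/negP/negPn/eqP ->] := pselect (E !=set0); last by exists 0.
  have [y Ey ymin] := compact_minP E0 cE fk_cont.
  exists (b - fk y) => z Ez; have := T_le Ez Hb; have := ymin z Ez; rewrite /D; lra.
pose M := sup [set D y | y in reduced_null].
have hasM : has_sup [set D y | y in reduced_null].
  split; first by exists (D x); exists x.
  by exists M0 => _ [y /reduced_null_sub Ey <-]; exact: hM0.
have DM y : reduced_null y -> D y <= M.
  by move=> yn; apply: ub_le_sup; [case: hasM|exists y].
have Mpos : 0 < M by apply: lt_le_trans (DM x x_null); rewrite subr_gt0.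
have [r r0 rU] := compact_margin cE oU EU.
(* Recall [D z > M - c]. The bound [4 c <= M] makes [w >= fk] on [E], which the pasted function
   needs to be admissible; [4 c <= kappa r^2] makes [w] exceed [T + 2 c] at the points of the sphere
   in [reduced_null]. *)
pose c := Num.min M (kappa * r ^+ 2) / 4.
have kr : 0 < kappa * r ^+ 2 by rewrite mulr_gt0// exprn_gt0.
have c0 : 0 < c by rewrite divr_gt0// lt_min Mpos.
have cM : 4 * c <= M by rewrite /c mulrC divfK// ge_min lexx.
have ckr : 4 * c <= kappa * r ^+ 2 by rewrite /c mulrC divfK// ge_min lexx orbT.
have [_ [z z_null <-] Dz] := sup_adherent c0 hasM.
rewrite -/M in Dz.
have Ez := reduced_null_sub z_null.
have Kz := EK Ez.
have zU := rU z Ez.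
(* The difference of [kappa |y|^2] and [kappa |y - z|^2] is affine in [y]. The slope and the
   constant are those which recentre the paraboloid at [z] and give [w z = T z - c]. *)
pose w y := f y + (dot (- (2 * kappa) *: z) (y - z) + (D z - c - kappa * enorm z ^+ 2)).
have wE y : w y = fk y + kappa * enorm (y - z) ^+ 2 + D z - c.
  have : enorm y ^+ 2 = enorm (y - z) ^+ 2 + 2 * dot (y - z) z + enorm z ^+ 2.
    by rewrite -sqr_enormD subrK.
  by rewrite /w /fk dotZl [dot z _]dotC => ->; ring.
have wU : csh U w by exact: csh_affine.
have cw y : U y -> {for y, continuous w} by have [_ cw _] := wU; exact: cw.
pose Kr := K `&` esphere z r.
have cKr : compact Kr.
  apply: (@subclosed_compact _ _ K) => //; last by move=> y [].
  by apply: closedI; [exact: compact_closedV|exact: closed_esphere].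
have KrU y : Kr y -> U y by move=> [_ /esphere_cball/zU].
(* The part of the sphere where [w] is not above [T + c]. It is phrased with the competitors because
   off [E] their values need not be bounded below, and because each of them contributes a closed
   condition. *)
pose C := [set y | Kr y /\ forall W s, adm W s -> w y <= s y + c].
have cC : compact C.
  apply: (@subclosed_compact _ _ Kr) => //; last by move=> y [].
  rewrite (_ : C = Kr `&` \bigcap_(q in [set q : set V * (V -> R) | adm q.1 q.2])
      [set y | Kr y /\ w y - q.2 y <= c]); last first.
    apply/seteqP; split=> [y [Ky h]|y [Ky h]].
      by split=> // -[W s] /= Hs; split=> //; have := h W s Hs; lra.
    by split=> // W s Hs; have [_ /=] := h (W, s) Hs; lra.
  apply: closedI; first exact: compact_closedV.
  apply: closed_bigI => -[W s] /= [KW [_ cs _] _]; apply: compact_closedV.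
  apply: compact_sublevel => //; apply: within_continuousB.
    exact: within_continuous_in cw KrU.
  by apply: within_continuous_in cs _ => y [/KW].
have CN y : C y -> ~ reduced_null y.
  move=> [[Ky yr] Cy] y_null; have Ey := reduced_null_sub y_null.
  have [W [s [Hs sy]]] := T_approx Ey c0.
  have := Cy W s Hs; rewrite wE (_ : enorm (y - z) = r)//.
  by have := DM y y_null; rewrite {1}/D; lra.
(* Where the barrier exceeds [L], already the constant competitor [b] lies below [w + s1]. *)
have [L L0 hL] : exists2 L : R, 0 < L & forall y, Kr y -> b - w y < L.
  have [Kr0|/set0P/negP/negPn/eqP ->] := pselect (Kr !=set0); last by exists 1.
  have [y Ky ymin] := compact_minP Kr0 cKr (within_continuous_in cw KrU).
  exists (`|b - w y| + 1) => [|u Ku]; first by rewrite ltr_wpDl.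
  by have := ymin u Ku; have := ler_norm (b - w y); lra.
have [W1 [s1 [KW1 s1W s10 s1C s1z]]] :=
  barrier cC (fun y (Cy : C y) => Cy.1.1) CN z_null L0 c0.
pose w' y := w y + s1 y.
have wW1 : csh (U `&` W1) w' by exact: csh_addI.
pose P (N : set V) := exists W s, adm W s /\ forall y, N y -> s y < w' y.
have [N [oN KrN [W0 [s0 [Hs0 s0N]]]]] : exists N, [/\ open N, Kr `<=` N & P N].
  apply: compact_ind => //.
  - by move=> A B AB [W [s [Hs sB]]]; exists W, s; split=> // y /AB; exact: sB.
  - by exists setT, (fun=> b).
  - move=> A B [W [s [Hs sA]]] [W' [s' [Hs' sB]]].
    exists (W `&` W'), (fun y => Num.min (s y) (s' y)); split; first exact: adm_min.
    by move=> y [/sA|/sB]; rewrite gt_min => ->; rewrite ?orbT.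
  - move=> y Ky; have Wy : (U `&` W1) y by split; [exact: KrU|apply: KW1; case: Ky].
    have [W [s [[KW sW fs] sy]]] : exists W s, adm W s /\ s y < w' y.
      have [Cy|nCy] := pselect (C y).
        exists setT, (fun=> b); split=> //.
        by have := hL y Ky; have := s1C y Cy; rewrite /w'; lra.
      apply: contrapT => Hno; apply: nCy; split=> // W s Hs; rewrite leNgt; apply/negP => h.
      apply: Hno; exists W, s; split=> //.
      by have := s10 y Ky.1; rewrite /w'; lra.
    have d0 : 0 < (w' y - s y) / 2 by rewrite divr_gt0// subr_gt0.
    have [_ cs _] := sW; have [_ cw' _] := wW1.
    have /continuous_atP/(_ _ d0)[d1 d10 yd1] := cs y (KW y Ky.1).
    have /continuous_atP/(_ _ d0)[d2 d20 yd2] := cw' y Wy.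
    exists (Num.min d1 d2); first by rewrite lt_min d10.
    exists W, s; split=> // u; rewrite /eball /= lt_min => /andP[/yd1 + /yd2].
    by rewrite !ltr_norml; lra.
have [KW0 s0W fs0] := Hs0.
(* On the neighbourhood [N] of the sphere within [K] one has [s0 < w'], so the minimum has become
   [s0] before the boundary of the ball is reached. *)
pose G y := if enorm (y - z) < r then Num.min (w' y) (s0 y) else s0 y.
pose Om := ((U `&` W1 `&` W0) `&` eball z r) `|` (W0 `&` N) `|` (W0 `\` cball z r).
have oUW : open (U `&` W1 `&` W0) by apply: openI; [case: wW1|case: s0W].
have oUb : open ((U `&` W1 `&` W0) `&` eball z r) by apply: openI => //; exact: open_eball.
have oWN : open (W0 `&` N) by apply: openI => //; case: s0W.
have oWb : open (W0 `\` cball z r).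
  by apply: openI; [case: s0W|apply: closed_openC; exact: closed_cball].
have oOm : open Om by apply: openU => //; exact: openU.
have GOm : csh Om G.
  apply: csh_local => // y [[yb|yN]|yb].
  - exists ((U `&` W1 `&` W0) `&` eball z r), (fun y => Num.min (w' y) (s0 y)); split=> //.
      by apply: csh_sub (csh_minI wW1 s0W) => // u [].
    by move=> u [_ ur]; rewrite /G ifT.
  - exists (W0 `&` N), s0; split=> //; first by apply: csh_sub s0W => // u [].
    by move=> u [_ /s0N us]; rewrite /G; case: ifP => // _; rewrite min_r// ltW.
  - exists (W0 `\` cball z r), s0; split=> //; first by apply: csh_sub s0W => // u [].
    by move=> u [_ ur]; rewrite /G ifF//; apply/negP => /ltW.
have KOm : K `<=` Om.
  move=> y Ky; have [yr|yr|yr] := ltgtP (enorm (y - z)) r.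
  - left; left; split=> //; split; last exact: KW0.
    by split; [apply: zU; exact: ltW|exact: KW1].
  - by right; split; [exact: KW0|rewrite /cball /= leNgt yr].
  - by left; right; split; [exact: KW0|exact: KrN].
have HG : adm Om G.
  split=> // y Ey; rewrite /G; case: ifP => [yr|_]; last exact: fs0.
  rewrite le_min fs0// andbT /w' wE.
  have := s10 y (EK Ey).
  have : 0 <= kappa * enorm (y - z) ^+ 2 by rewrite mulr_ge0 ?sqr_ge0// ltW.
  lra.
(* At the centre [w' z = T z - c + s1 z < T z]. *)
have := T_le Ez HG; rewrite /G subrr enorm0 r0 leNgt => /negP; apply.
rewrite gt_min; apply/orP; left; rewrite /w' wE subrr enorm0 expr0n/= mulr0 addr0 {1}/D.
lra.
Qed.

Lemma reduced_majorant x (e : R) : reduced_null x -> 0 < e -> exists W s,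
  [/\ K `<=` W, csh W s, forall y, E y -> fk y <= s y & s x < fk x + e].
Proof.
move=> xn e0; have [W [s [[KW sW fs] sx]]] := T_approx (reduced_null_sub xn) e0.
by exists W, s; split=> //; have := reduced_le xn; lra.
Qed.

End Reduced.

Lemma csh_majorant x U f (e : R) : reduced_null x -> E `<=` U -> csh U f -> 0 < e ->
  exists W s, [/\ K `<=` W, csh W s, forall y, E y -> f y <= s y & s x < f x + e].
Proof.
move=> xn EU fU e0; have [k k0 Ek] := compact_enorm_bounded cE.
have d0 : 0 < k ^+ 2 + 1 by rewrite ltr_wpDl ?sqr_ge0.
have kappa0 : 0 < e / 2 / (k ^+ 2 + 1) by rewrite !divr_gt0.
have e20 : 0 < e / 2 by rewrite divr_gt0.
have [W [s [KW sW fs sx]]] := reduced_majorant EU fU kappa0 xn e20.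
have Ebd y : E y -> 0 <= e / 2 / (k ^+ 2 + 1) * enorm y ^+ 2 <= e / 2.
  move=> Ey; apply/andP; split; first by rewrite mulr_ge0 ?sqr_ge0// ltW.
  rewrite -[leRHS](divfK (lt0r_neq0 d0)) ler_pM2l//.
  have : enorm y ^+ 2 <= k ^+ 2 by rewrite ler_pXn2r ?nnegrE ?enorm_ge0//; exact: Ek.
  by move=> /le_trans; apply; rewrite lerDl.
exists W, (fun y => s y + e / 2); split=> //; first exact: csh_addcst.
  by move=> y Ey; have := fs y Ey; have /andP[_] := Ebd y Ey; lra.
by have /andP[h _] := Ebd x (reduced_null_sub xn); lra.
Qed.

End Majorant.

Lemma reduced_null_jensen (R : realType) (n : nat) (K E : set 'rV[R]_n) x
    (mu : {measure set (BV R n) -> \bar R}) : (1 < n)%N ->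
  compact K -> compact E -> E `<=` K -> reduced_null K E x ->
  mu (~` E) = 0%E -> jensen_cpt K x mu -> jensen_cpt E x mu.
Proof.
move=> n1 cK cE EK xn muE J.
have n0 : (0 < n)%N by exact: ltnW.
have Ex := reduced_null_sub cE xn.
have mE := measurable_compact cE; have mK := measurable_compact cK.
have muK : mu (~` K) = 0%E.
  apply/le_anti/andP; split; last exact: measure_ge0.
  rewrite -muE; apply: le_measure; last exact: subsetC.
    by apply: mem_set; exact: measurableC.
  by apply: mem_set; exact: measurableC.
have JE W s : K `<=` W -> csh W s ->
    (\int[mu]_(y in (E : set (BV R n))) (s y)%:E <= (s x)%:E)%E.
  move=> KW sW; rewrite -(integral_conull cE EK mK _ muE).
    exact: (jensen_csh n1 cK xn.1 KW sW).
  apply: (@measurable_funS _ _ (BV R n) _ W) => //; last exact: csh_measurable.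
  by apply: measurable_open; case: sW.
(* Both [1] and [-1] are superharmonic, which forces [mu E = 1]. *)
have one (a : R) : (a%:E * mu E <= a%:E)%E.
  rewrite -(integral_cst mu mE); apply: (JE setT (fun=> a)) => //.
  by apply: csh_cst => //; exact: openT.
apply: (csh_jensen n1 cE Ex muE).
- move=> y ys; apply: contrapT => nEy.
  have oE : open (~` E) by apply: closed_openC; exact: compact_closedV.
  by have := ys _ oE nEy; rewrite muE ltxx.
- have := one 1; have := one (-1); rewrite mul1e => h1 h2.
  have fE : mu E \is a fin_num.
    by rewrite ge0_fin_numE ?measure_ge0//; apply: le_lt_trans h2 _; exact: ltry.
  move: h1 h2; rewrite -(fineK fE) -EFinM !lee_fin => h1 h2.
  by congr EFin; apply/le_anti/andP; split; lra.
move=> U f EU fU f0; apply/lee_addgt0Pr => e e0; rewrite -EFinD.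
have [W [s [KW sW fs sx]]] := csh_majorant n1 cK cE EK xn EU fU e0.
apply: (@le_trans _ _ (s x)%:E); last by rewrite lee_fin ltW.
apply: le_trans (JE W s KW sW); apply: ge0_le_integral => //.
- apply: (@measurable_funS _ _ (BV R n) _ U) => //; last exact: (csh_measurable fU).
  by apply: measurable_open; case: fU.
- apply: (@measurable_funS _ _ (BV R n) _ W) => //; last exact: (csh_measurable sW).
    by apply: measurable_open; case: sW.
  exact: subset_trans EK KW.
Qed.

Theorem theorem4p5 (R : realType) (n : nat) (hn : (2 <= n)%N)
  (K A : set 'rV[R]_n) :
  compact K -> A `<=` K ->
  fine_open A -> fine_open (fine_interior K `\` A) ->
  (forall x, A x -> forall mu, jensen_cpt K x mu -> supp mu `<=` closure A) ->
  forall x, A x -> forall mu, jensen_cpt K x mu -> jensen_cpt (closure A) x mu.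
Proof.
move=> cK AK _ _ HS x Ax mu J.
have EK : closure A `<=` K.
  by rewrite [X in _ `<=` X](closure_id K).1; [exact: closure_subset|exact: compact_closedV].
have cE : compact (closure A) by apply: subclosed_compact EK => //; exact: closed_closure.
apply: (@reduced_null_jensen _ _ K) => //.
  split=> [|eta eta0]; first exact: AK.
  by apply: support_reduced => //; [exact: closed_closure|exact: AK|exact: HS].
apply: supp_null => [|y nEy /(HS x Ax mu J)//].
by apply: closed_openC; exact: closed_closure.
Qed.
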